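(* The specializations $[[K]]|_{A=1}$ and $[[K]]|_{A=-1}$, for oriented virtual link diagrams $K$, are invariants of (oriented) free links: each depends only on the free link represented by $K$.
   Context: **Graphs.** $\mathcal S$ is the collection of all finite trivalent bipartite graphs (abstract graphs, multiple edges allowed, up to isomorphism) with every edge oriented from the first part to the second part. Circles (closed components with no vertices) are also allowed as components. A bigon is a pair of distinct edges joining the same two vertices; a quadrilateral is a $4$-cycle with four distinct vertices. $\mathcal T=\{t_1,t_2,\dots\}\subset\mathcal S$ is the set of connected graphs having neither bigons nor quadrilaterals. $\mathcal M=\mathbb Z[A,A^{-1}][t_1,t_2,\dots]$ consists of formal commutative products of graphs from $\mathcal T$ with Laurent polynomial coefficients. Setting $A=\pm1$ gives values in $\mathbb Z[t_1,t_2,\dots]$. **The map $f$.** $f$ is the unique map from finite disjoint unions of graphs of $\mathcal S$ and circles to $\mathcal M$ that sends disjoint unions to products, satisfies $f(t)=t$ for $t\in\mathcal T$, $f(\bigcirc)=A^6+1+A^{-6}$, $f(\Gamma)=(A^3+A^{-3})f(\Gamma')$ when $\Gamma'$ is obtained by resolving a bigon of $\Gamma$ (delete its two vertices and two edges and join the two remaining half-edges), and $f(\Gamma)=f(\Gamma_1)+f(\Gamma_2)$ for a quadrilateral $v_1v_2v_3v_4$ of $\Gamma$ with outer half-edges $l_i$ at $v_i$, where the quadrilateral's vertices and edges are deleted and one joins $l_1$ to $l_2$ and $l_3$ to $l_4$ (for $\Gamma_1$), or $l_2$ to $l_3$ and $l_4$ to $l_1$ (for $\Gamma_2$). Closed curves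 produced are circles. **Bracket.** At a classical crossing with sign $\epsilon=\pm1$, incoming edges $a,b$ and outgoing edges $c,d$, where $a$ continues to $c$ and $b$ to $d$, there are two local states: the oriented one (join $a$ to $d$ and $b$ to $c$), of weight $A^{2\epsilon}$; and the unoriented one (replace the crossing by a sink vertex receiving $a,b$, a source vertex emitting $c,d$, and a new edge from the source to the sink), of weight $-A^{-\epsilon}$. A state $s$ is a choice of local state at each classical crossing; $K_s$ is the resulting abstract graph (virtual crossings are ignored), possibly with circles; $w(s)$ is the product of the weights of the chosen local states. $[[K]]=\sum_s w(s)f(K_s)$. **Free links.** A free link is an equivalence class of virtual links (diagrams up to classical Reidemeister moves and detour moves) modulo virtualization (flanking a classical crossing by two virtual crossings) and crossing switches. Equivalently, free links are framed $4$-valent graphs (only the pairing of opposite edges at each node is specified) modulo flat Reidemeister moves. *)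

(* Defs.v *)
From Stdlib Require Import Relation_Operators.
From HB Require Import structures.
From mathcomp Require Import all_boot all_order all_fingroup all_algebra.
From mathcomp Require Import finmap generic_quotient boolp.
From mathcomp Require Import fraction monalg.

Set Implicit Arguments.
Unset Strict Implicit.
Unset Printing Implicit Defensive.

Import GRing.Theory.
Local Open Scope ring_scope.
Local Open Scope quotient_scope.

(** * The ring Z[A, A^-1], as the subring of Frac(Z[A]) of fractions p / A^n *)

Definition is_laurent : pred {fraction {poly int}} :=
  fun x => `[< exists (p : {poly int}) (n : nat),
               x = tofrac p / tofrac 'X ^+ n >].

Lemma tofracX_neq0 : tofrac ('X : {poly int}) != 0.
Proof. by rewrite tofrac_eq0 polyX_eq0. Qed.

Fact is_laurent_subring : subring_closed is_laurent.
Proof.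
have nz n : tofrac ('X : {poly int}) ^+ n != 0 by rewrite expf_neq0 ?tofracX_neq0.
split.
- by apply/asboolP; exists 1, 0; rewrite expr0 divr1 rmorph1.
- move=> x y /asboolP[p [n ->]] /asboolP[q [m ->]]; apply/asboolP.
  exists (p * 'X ^+ m - q * 'X ^+ n), (n + m)%N.
  rewrite -mulNr addf_div ?nz// exprD rmorphB !rmorphM !rmorphXn.
  by rewrite mulNr.
- move=> x y /asboolP[p [n ->]] /asboolP[q [m ->]]; apply/asboolP.
  exists (p * q), (n + m)%N.
  by rewrite mulf_div exprD rmorphM.
Qed.

HB.instance Definition _ :=
  GRing.isSubringClosed.Build {fraction {poly int}} is_laurent is_laurent_subring.

Record laurent := Laurent {
  laurent_val :> {fraction {poly int}};
  _ : laurent_val \in is_laurent }.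

HB.instance Definition _ := [isSub for laurent_val].
HB.instance Definition _ := [Choice of laurent by <:].
HB.instance Definition _ := [SubChoice_isSubComNzRing of laurent by <:].

Fact Apow_subproof (k : int) : tofrac 'X ^ k \in is_laurent.
Proof.
apply/asboolP; case: k => n.
  by exists ('X ^+ n), 0; rewrite expr0 divr1 rmorphXn.
by exists 1, n.+1; rewrite rmorph1 mul1r.
Qed.

(** [Apow k] is A^k. *)
Definition Apow (k : int) : laurent := Laurent (Apow_subproof k).

Fact laurent_fracP (x : laurent) :
  {pn : {poly int} * nat | laurent_val x = tofrac pn.1 / tofrac 'X ^+ pn.2}.
Proof.
apply/cid; case: x => x /= /asboolP[p [n ->]].
by exists (p, n).
Qed.

(** The value at A = c of a Laurent polynomial, for c = 1 or c = -1; it does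
    not depend on the chosen fraction, see [laurent_at_frac]. *)
Definition laurent_at (c : int) (x : laurent) : int :=
  let pn := sval (laurent_fracP x) in pn.1.[c] / c ^+ pn.2.

Lemma laurent_at_frac (c : int) (x : laurent) (p : {poly int}) (n : nat) :
  c \is a GRing.unit -> laurent_val x = tofrac p / tofrac 'X ^+ n ->
  laurent_at c x = p.[c] / c ^+ n.
Proof.
move=> cU xE; rewrite /laurent_at; case: (laurent_fracP x) => -[q m] /= yE.
have nz k : tofrac ('X : {poly int}) ^+ k != 0 by rewrite expf_neq0 ?tofracX_neq0.
have /eqP := etrans (esym yE) xE.
rewrite eqr_div ?nz// -!rmorphXn -!rmorphM tofrac_eq => /eqP /(congr1 (horner^~ c)).
rewrite !hornerM !hornerXn => e.
apply: (mulIr (unitrX n cU)); rewrite divrK ?unitrX//.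
apply: (mulIr (unitrX m cU)); rewrite mulrAC divrK ?unitrX//.
Qed.

Lemma laurent_at_Apow (c : int) (k : int) :
  c \is a GRing.unit -> laurent_at c (Apow k) = c ^ k.
Proof.
move=> cU; case: k => n.
  by rewrite (@laurent_at_frac _ _ ('X ^+ n) 0) //= ?expr0 ?divr1 ?hornerXn ?rmorphXn.
by rewrite (@laurent_at_frac _ _ 1 n.+1) ?hornerC ?mul1r//= rmorph1 mul1r.
Qed.

(** * Curves obtained by joining edges *)

Section Joining.

(** [k e = Some e'] means that the head of the edge [e] is joined to the tail
    of the edge [e'].  Joining gives maximal chains of edges and closed curves. *)
Variables (E : finType) (k : E -> option E).

Definition follow (e : E) : E := odflt e (k e).

(** The last edge of the chain starting at [e], if that chain ends: a chain has
    at most [#|E|] edges. *)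
Definition last_edge (e : E) : E := iter #|E| follow e.

Definition closed_curves : nat :=
  #|[set [set e' | fconnect follow e e'] | e in [set e | k (last_edge e) != None]]|.

End Joining.

Section FirstReturn.

Variables (T : finType) (g : T -> T) (Y : pred T).
Hypothesis g_inj : injective g.

Let k (p : T) := if Y (g p) then None else Some (g p).

Lemma first_return (p : T) : Y p ->
  exists m, [/\ last_edge k p = iter m g p, Y (iter m.+1 g p)
              & forall j, (j < m)%N -> ~~ Y (iter j.+1 g p)].
Proof.
move=> Yp.
have Yo : Y (iter (fingraph.order g p).-1.+1 g p).
  by rewrite prednK ?fingraph.order_gt0// iter_order.
have ex : exists m, Y (iter m.+1 g p) by exists (fingraph.order g p).-1.
exists (ex_minn ex); case: ex_minnP => m Ym m_min.
have lt j : (j < m)%N -> ~~ Y (iter j.+1 g p).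
  by move=> jm; apply/negP => /m_min; rewrite leqNgt jm.
split=> //.
have le_m : (m <= #|T|)%N.
  by rewrite (leq_trans (m_min _ Yo))// (leq_trans (leq_pred _))// max_card.
have run j : (j <= m)%N -> iter j (follow k) p = iter j g p.
  elim: j => // j IHj jm; rewrite iterS IHj 1?ltnW//.
  by rewrite /follow /k -iterS (negPf (lt _ jm)).
have stay j : iter j (follow k) (iter m g p) = iter m g p.
  by elim: j => // j IHj; rewrite iterS IHj /follow /k -iterS Ym.
by rewrite /last_edge -(subnK le_m) iterD run.
Qed.

Lemma first_return_mem (p : T) : Y p -> Y (g (last_edge k p)).
Proof. by case/first_return => m [-> ]. Qed.

Lemma first_return_inj : {in Y &, injective (last_edge k)}.
Proof.
have iterI n : injective (iter n g).
  by elim: n => // n IHn x y /= /g_inj /IHn.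
have key p q m n : Y p -> (forall j, (j < n)%N -> ~~ Y (iter j.+1 g q)) ->
    (m <= n)%N -> iter m g p = iter n g q -> p = q.
  move=> Yp nY mn; rewrite -{1}(subnKC mn) iterD => /iterI pE.
  case e: (n - m)%N pE => [//|j] pE.
  have /nY : (j < n)%N by rewrite -e leq_subr.
  by rewrite -pE Yp.
move=> p q Yp Yq; have [m [-> _ pY]] := first_return Yp.
have [n [-> _ qY]] := first_return Yq.
case: (leqP m n) => [mn|/ltnW nm] e; first exact: (key p q m n).
by apply/esym/(key q p n m).
Qed.

End FirstReturn.

(** * Trivalent bipartite graphs *)

(** Edges are oriented from the first part [src] to the second part [snk];
    [circles] is the number of components without vertices. *)
Record web := Web {
  src : finType;
  snk : finType;
  edge : finType;
  tail : edge -> src;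
  head : edge -> snk;
  circles : nat;
  tail_trivalent : forall v, #|[set e | tail e == v]| = 3%N;
  head_trivalent : forall w, #|[set e | head e == w]| = 3%N }.

Definition web_iso (G H : web) : Prop :=
  exists (a : src G -> src H) (b : snk G -> snk H) (c : edge G -> edge H),
    [/\ bijective a, bijective b & bijective c] /\
    [/\ forall e, tail (c e) = a (tail e),
        forall e, head (c e) = b (head e)
      & circles H = circles G].

Lemma web_iso_refl G : web_iso G G.
Proof. by exists id, id, id; split; split=> //; exists id. Qed.

Lemma web_iso_sym G H : web_iso G H -> web_iso H G.
Proof.
case=> a [b [c [[aB bB cB] [tE hE cE]]]].
have [a' aK a'K] := aB; have [b' bK b'K] := bB; have [c' cK c'K] := cB.
exists a', b', c'; split; first by split; [exists a|exists b|exists c].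
by split=> // e; [rewrite -{2}(c'K e) tE aK|rewrite -{2}(c'K e) hE bK].
Qed.

Lemma web_iso_trans G H K : web_iso G H -> web_iso H K -> web_iso G K.
Proof.
case=> a [b [c [[aB bB cB] [tE hE cE]]]].
case=> a' [b' [c' [[aB' bB' cB'] [tE' hE' cE']]]].
exists (a' \o a), (b' \o b), (c' \o c); split.
  by split; apply: bij_comp.
by split=> [e|e|]; rewrite /= ?tE' ?tE ?hE' ?hE // cE' cE.
Qed.

Fact sum_tail_trivalent (G H : web) (v : (src G + src H)%type) :
  #|[set e : (edge G + edge H)%type | match e with
      | inl e => inl (tail e) | inr e => inr (tail e) end == v]| = 3%N.
Proof.
rewrite -sum1_card big_sumType /=; case: v => v; rewrite -(tail_trivalent v) -sum1_card.
  rewrite [X in (_ + X)%N]big1 ?addn0 => [|e]; last by rewrite inE.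
  by apply: eq_bigl => e; rewrite !inE.
rewrite [X in (X + _)%N]big1 ?add0n => [|e]; last by rewrite inE.
by apply: eq_bigl => e; rewrite !inE.
Qed.

Fact sum_head_trivalent (G H : web) (w : (snk G + snk H)%type) :
  #|[set e : (edge G + edge H)%type | match e with
      | inl e => inl (head e) | inr e => inr (head e) end == w]| = 3%N.
Proof.
rewrite -sum1_card big_sumType /=; case: w => w; rewrite -(head_trivalent w) -sum1_card.
  rewrite [X in (_ + X)%N]big1 ?addn0 => [|e]; last by rewrite inE.
  by apply: eq_bigl => e; rewrite !inE.
rewrite [X in (X + _)%N]big1 ?add0n => [|e]; last by rewrite inE.
by apply: eq_bigl => e; rewrite !inE.
Qed.

Definition web_union (G H : web) : web := {|
  src := (src G + src H)%type;
  snk := (snk G + snk H)%type;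
  edge := (edge G + edge H)%type;
  circles := (circles G + circles H)%N;
  tail_trivalent := @sum_tail_trivalent G H;
  head_trivalent := @sum_head_trivalent G H |}.

Definition circle_web : web := {|
  src := void; snk := void; edge := void;
  tail := id; head := id; circles := 1%N;
  tail_trivalent := fun v => match v with end;
  head_trivalent := fun w => match w with end |}.

Definition bigon (G : web) (e e' : edge G) : Prop :=
  [/\ e != e', tail e = tail e' & head e = head e'].

(** The quadrilateral v1 v2 v3 v4 with v1, v3 in the first part, [eij] being the
    edge from vi to vj. *)
Definition quadrilateral (G : web) (e12 e32 e34 e14 : edge G) : Prop :=
  [/\ tail e12 = tail e14, tail e32 = tail e34,
      head e12 = head e32 & head e14 = head e34] /\
  (tail e12 != tail e32 /\ head e12 != head e14).

(** [H] is obtained from [G] by deleting the vertices in [X] and [Y] and the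
    edges between them, and joining the remaining half-edges as told by [k].
    A curve of [H] is named by its first edge in [G]. *)
Definition resolves (G : web) (X : {set src G}) (Y : {set snk G})
    (k : edge G -> option (edge G)) (H : web) : Prop :=
  exists (a : src H -> src G) (b : snk H -> snk G) (c : edge H -> edge G),
    [/\ injective a, injective b & injective c] /\
    [/\ forall v, (v \in codom a) = (v \notin X),
        forall w, (w \in codom b) = (w \notin Y)
      & forall e, (e \in codom c) = (tail e \notin X)] /\
    [/\ forall e, tail (c e) = a (tail e),
        forall e, head (last_edge k (c e)) = b (head e)
      & circles H = (circles G + closed_curves k)%N].

(** [lin] and [lout] are the remaining edges at the two vertices of the bigon;
    they may coincide, in which case joining them gives a circle. *)
Definition bigon_resolution (G H : web) : Prop :=
  exists e e' lin lout : edge G,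
    [/\ bigon e e',
        [/\ tail lout = tail e, lout != e & lout != e'],
        [/\ head lin = head e, lin != e & lin != e']
      & resolves [set tail e] [set head e]
          (fun x => if x == lin then Some lout else None) H].

(** [G1] joins l1 to l2 and l3 to l4; [G2] joins l2 to l3 and l4 to l1. *)
Definition quadrilateral_resolution (G G1 G2 : web) : Prop :=
  exists e12 e32 e34 e14 l1 l2 l3 l4 : edge G,
    let X := [set tail e12; tail e32] in
    let Y := [set head e12; head e14] in
    [/\ quadrilateral e12 e32 e34 e14,
        [/\ tail l1 = tail e12, l1 != e12 & l1 != e14] /\
        [/\ head l2 = head e12, l2 != e12 & l2 != e32],
        [/\ tail l3 = tail e32, l3 != e32 & l3 != e34] /\
        [/\ head l4 = head e14, l4 != e14 & l4 != e34],
        resolves X Y (fun x => if x == l2 then Some l1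
                               else if x == l4 then Some l3 else None) G1
      & resolves X Y (fun x => if x == l2 then Some l3
                               else if x == l4 then Some l1 else None) G2].

Definition web_adj (G : web) : rel (src G + snk G)%type := fun x y =>
  [exists e : edge G, ((x == inl (tail e)) && (y == inr (head e)))
                   || ((x == inr (head e)) && (y == inl (tail e)))].

(** The single circle is not included: it is not a generator of the target
    of the map f. *)
Definition web_connected (G : web) : Prop :=
  [/\ circles G = 0%N, (0 < #|src G|)%N & forall x y, connect (@web_adj G) x y].

Definition irreducible_web (G : web) : Prop :=
  [/\ web_connected G,
      forall e e' : edge G, ~ bigon e e'
    & forall e12 e32 e34 e14 : edge G, ~ quadrilateral e12 e32 e34 e14].

(** * The ring M = Z[A, A^-1][t1, t2, ...] *)

(** The variables are indexed by webs whose vertices and edges are ordinals, up to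
    isomorphism: by [std_webP], every web without circles is isomorphic to one
    of them. *)
Definition web_code : Type :=
  {n : nat * nat * nat & {ffun 'I_n.2 -> 'I_n.1.1 * 'I_n.1.2}}.

Definition trivalent_code (t : web_code) : bool :=
  [forall v, #|[set e | (tagged t e).1 == v]| == 3%N] &&
  [forall w, #|[set e | (tagged t e).2 == w]| == 3%N].

Record std_web := StdWeb { std_code : web_code; _ : trivalent_code std_code }.

HB.instance Definition _ := [isSub for std_code].
HB.instance Definition _ := [Choice of std_web by <:].

Fact std_tail_trivalent (t : std_web) v :
  #|[set e | (tagged (std_code t) e).1 == v]| = 3%N.
Proof. by case: t v => t /= /andP[/forallP H _] v; apply/eqP. Qed.

Fact std_head_trivalent (t : std_web) w :
  #|[set e | (tagged (std_code t) e).2 == w]| = 3%N.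
Proof. by case: t w => t /= /andP[_ /forallP H] w; apply/eqP. Qed.

Definition std (t : std_web) : web := {|
  circles := 0%N;
  tail_trivalent := @std_tail_trivalent t;
  head_trivalent := @std_head_trivalent t |}.

Lemma std_webP (G : web) : circles G = 0%N -> exists t, web_iso (std t) G.
Proof.
move=> G0; pose n := (#|src G|, #|snk G|, #|edge G|).
pose c : web_code := Tagged (fun n : nat * nat * nat =>
    {ffun 'I_n.2 -> 'I_n.1.1 * 'I_n.1.2})
  ([ffun e => (enum_rank (tail (enum_val e)), enum_rank (head (enum_val e)))]
    : {ffun 'I_n.2 -> 'I_n.1.1 * 'I_n.1.2}).
have evI (T : finType) : bijective (@enum_val T T).
  by exists enum_rank; [apply: enum_valK|apply: enum_rankK].
have triv : trivalent_code c.
  apply/andP; split; apply/forallP => v; apply/eqP.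
    rewrite -(tail_trivalent (enum_val v)).
    rewrite -(on_card_preimset (f := @enum_val _ (edge G))); last exact/onW_bij/evI.
    by apply: eq_card => e; rewrite !inE ffunE /= (can2_eq enum_rankK enum_valK).
  rewrite -(head_trivalent (enum_val v)).
  rewrite -(on_card_preimset (f := @enum_val _ (edge G))); last exact/onW_bij/evI.
  by apply: eq_card => e; rewrite !inE ffunE /= (can2_eq enum_rankK enum_valK).
exists (StdWeb triv), enum_val, enum_val, enum_val; split; first by split.
by split=> // e; rewrite /= ffunE /= enum_rankK.
Qed.

Record irr_web := IrrWeb {
  irr_val : std_web;
  _ : `[< irreducible_web (std irr_val) >] }.

HB.instance Definition _ := [isSub for irr_val].
HB.instance Definition _ := [Choice of irr_web by <:].

Definition irr_iso : rel irr_web := fun t u =>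
  `[< web_iso (std (irr_val t)) (std (irr_val u)) >].

Fact irr_iso_refl : reflexive irr_iso.
Proof. by move=> t; apply/asboolP/web_iso_refl. Qed.

Fact irr_iso_sym : symmetric irr_iso.
Proof. by move=> t u; apply/asboolP/asboolP; apply: web_iso_sym. Qed.

Fact irr_iso_trans : transitive irr_iso.
Proof.
by move=> u t v /asboolP tu /asboolP uv; apply/asboolP/(web_iso_trans tu).
Qed.

Canonical irr_iso_equiv := EquivRel irr_iso irr_iso_refl irr_iso_sym irr_iso_trans.

(** The set T of isomorphism classes t1, t2, ... *)
Definition irr_class := {eq_quot irr_iso}.

Definition ring_M := {malg laurent[{cmonom irr_class}]}.

Definition web_var (t : irr_web) : ring_M := << ucm (\pi_irr_class t) >>.

(** Specialization at A = c, for c = 1 or c = -1. *)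
Definition specialize (c : int) (x : ring_M) : {malg int[{cmonom irr_class}]} :=
  \sum_(m <- msupp x) << laurent_at c (mcoeff m x) *g m >>.

(** The defining properties of the map f. *)
Record web_evaluation (f : web -> ring_M) : Prop := WebEvaluation {
  eval_iso : forall G H, web_iso G H -> f G = f H;
  eval_union : forall G H, f (web_union G H) = f G * f H;
  eval_irr : forall t : irr_web, f (std (irr_val t)) = web_var t;
  eval_circle : f circle_web = (Apow 6 + 1 + Apow (- 6)) *: 1;
  eval_bigon : forall G H, bigon_resolution G H ->
    f G = (Apow 3 + Apow (- 3)) *: f H;
  eval_quadrilateral : forall G G1 G2, quadrilateral_resolution G G1 G2 ->
    f G = f G1 + f G2 }.

(** * Oriented virtual link diagrams *)

(** [Classical true] is a positive crossing, [Classical false] a negative one. *)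
Inductive crossing_kind := Classical of bool | Virtual.

(** Draw each crossing with both strands going upwards.  The passage [(c, true)]
    is the strand of [c] from bottom left to top right, [(c, false)] the strand
    from bottom right to top left.  Thus [(c, true)] is the upper strand of a
    positive crossing and [(c, false)] that of a negative one.  The edge leaving
    the passage [p] enters the passage [next p].  [loops] is the number of
    components without crossings. *)
Record diagram := Diagram {
  cr : finType;
  kind : cr -> crossing_kind;
  next : {perm cr * bool};
  loops : nat }.

Definition is_classical (D : diagram) (c : cr D) : bool :=
  if kind c is Classical _ then true else false.

(** [(p, true)] is the edge leaving [p] traversed forwards, [(p, false)] the same
    edge traversed backwards; [face_next] follows the boundary of the face lying
    to the left. *)
Definition face_next (D : diagram) (d : (cr D * bool) * bool) :
    (cr D * bool) * bool :=
  let: (p, forwards) := d in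
  if forwards then
    let q := next D p in
    if q.2 then ((q.1, false), true)
    else (((next D)^-1)%g (q.1, true), false)
  else
    if p.2 then (((next D)^-1)%g (p.1, false), false)
    else ((p.1, true), true).

Definition cr_adj (D : diagram) : rel (cr D) := fun x y =>
  [exists i, exists j, (next D (x, i) == (y, j)) || (next D (y, j) == (x, i))].

(** Euler's formula V - E + F = 2 C, where E = 2 V: the underlying 4-valent graph
    with its cyclic orders at crossings has genus zero. *)
Definition planar (D : diagram) : Prop :=
  fcard (@face_next D) predT = (#|cr D| + 2 * n_comp (@cr_adj D) predT)%N.

(** The relative position of the connected components of the plane diagram is not
    recorded; detour moves change it arbitrarily. *)
Record vdiagram := VDiagram { vdiag :> diagram; _ : planar vdiag }.

Definition diagram_iso (D E : diagram) : Prop :=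
  exists h : cr D -> cr E,
    [/\ bijective h, forall c, kind (h c) = kind c,
        forall p, next E (h p.1, p.2) = (h (next D p).1, (next D p).2)
      & loops E = loops D].

(** [E] is obtained from [D] by forgetting the crossings in [X], both strands of
    each of them going straight through. *)
Definition erases (D : diagram) (X : {set cr D}) (E : diagram) : Prop :=
  let k p := if (next D p).1 \in X then Some (next D p) else None in
  exists h : cr E -> cr D,
    [/\ injective h, forall c, (c \in codom h) = (c \notin X),
        forall c, kind (h c) = kind c,
        forall p, next D (last_edge k (h p.1, p.2))
                  = (h (next E p).1, (next E p).2)
      & loops E = (loops D + closed_curves k)%N].

Definition reidemeister1 (D E : diagram) : Prop :=
  exists (c : cr D) (i : bool),
    [/\ is_classical c, next D (c, i) = (c, ~~ i) & erases [set c] E].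

(** The two strands bounding the bigon are parallel or antiparallel. *)
Definition reidemeister2 (D E : diagram) : Prop :=
  exists (c d : cr D) (i b : bool),
    [/\ kind c = Classical b /\ kind d = Classical (~~ b),
        next D (c, i) = (d, ~~ i),
        next D (c, ~~ i) = (d, i) \/ next D (d, i) = (c, ~~ i)
      & erases [set c; d] E].

Definition precedes (D : diagram) (b : bool) (p q : cr D * bool) : Prop :=
  if b then next D p = q else next D q = p.

Definition reorder (D : diagram) (s : {perm cr D * bool}) : diagram :=
  @Diagram (cr D) (@kind D) ((next D) ^ s)%g (loops D).

(** Strand 1 lies above strand 2, which lies above strand 3; [x], [y], [z] are the
    crossings 12, 13, 23, and [i], [j], [k] their signs.  For straight lines with
    directions d1, d2, d3 these are the signs of the cross products d1 x d2,
    d1 x d3, d2 x d3, and the order of the two crossings on each line is given by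
    the product of the two signs involved, up to a common sign [s] which is the
    side of the triple point on which the lines are.  The move reverses the three
    orders. *)
Definition reidemeister3 (D E : diagram) : Prop :=
  exists (x y z : cr D) (i j k s : bool),
    [/\ uniq [:: x; y; z],
        [/\ kind x = Classical i, kind y = Classical j & kind z = Classical k],
        [/\ precedes (s (+) i (+) j) (x, i) (y, j),
            precedes (s (+) i (+) k) (x, ~~ i) (z, k)
          & precedes (s (+) j (+) k) (y, ~~ j) (z, ~~ k)]
      & diagram_iso
          (reorder (tperm (x, i) (y, j) * tperm (x, ~~ i) (z, k)
                    * tperm (y, ~~ j) (z, ~~ k))%g) E].

(** [D] and [E] have the same classical crossings, connected in the same way by
    arcs containing virtual crossings only: [E] is obtained from [D] by redrawing
    these arcs one after another. *)
Definition detour (D E : diagram) : Prop :=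
  exists F : diagram,
    erases [set c | ~~ @is_classical D c] F /\
    erases [set c | ~~ @is_classical E c] F.

(** [E] is obtained from [D] by flanking the classical crossing [c] by the virtual
    crossings [v] (below) and [w] (above); flanking on the left and on the right
    differs from this by detour moves. *)
Definition virtualization (D E : diagram) : Prop :=
  exists (c : cr D) (h : cr D -> cr E) (v w : cr E),
    let enter (p : cr D * bool) := (if p.1 == c then v else h p.1, p.2) in
    [/\ is_classical c,
        [/\ injective h, v != w
          & forall x, (x \in codom h) = (x \notin [set v; w])],
        [/\ kind v = Virtual, kind w = Virtual & forall x, kind (h x) = kind x],
        [/\ forall i, next E (v, i) = (h c, ~~ i),
            forall i, next E (h c, i) = (w, ~~ i),
            forall i, next E (w, i) = enter (next D (c, i))
          & forall p, p.1 != c -> next E (h p.1, p.2) = enter (next D p)]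
      & loops E = loops D].

Definition crossing_switch (D E : diagram) : Prop :=
  exists (c : cr D) (b : bool),
    kind c = Classical b /\
    diagram_iso (@Diagram (cr D)
      (fun x => if x == c then Classical (~~ b) else kind x) (next D) (loops D)) E.

Inductive virtual_move (D E : vdiagram) : Prop :=
| PlaneIsotopy of diagram_iso D E
| Reidemeister1 of reidemeister1 D E
| Reidemeister2 of reidemeister2 D E
| Reidemeister3 of reidemeister3 D E
| Detour of detour D E.

Inductive free_move (D E : vdiagram) : Prop :=
| VirtualMove of virtual_move D E
| Virtualization of virtualization D E
| CrossingSwitch of crossing_switch D E.

(** [D] and [E] represent the same oriented virtual link, resp. free link. *)
Definition same_virtual_link : vdiagram -> vdiagram -> Prop :=
  clos_refl_sym_trans vdiagram virtual_move.
Definition same_free_link : vdiagram -> vdiagram -> Prop :=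
  clos_refl_sym_trans vdiagram free_move.

(** * The bracket *)

Section StateWeb.

Variables (D : diagram) (s : {set cr D}).

(** The edge reached from the passage [p], at the next crossing, when the crossings
    in [s] are cut open, the other classical crossings are smoothed according to
    the orientation, and virtual crossings are passed straight through. *)
Definition smooth_next (p : cr D * bool) : cr D * bool :=
  let q := next D p in
  if (q.1 \notin s) && is_classical q.1 then (q.1, ~~ q.2) else q.

Definition state_join (p : cr D * bool) : option (cr D * bool) :=
  if (smooth_next p).1 \in s then None else Some (smooth_next p).

Lemma smooth_next_inj : injective smooth_next.
Proof.
move=> p q; rewrite /smooth_next.
case: ifP => hp; case: ifP => hq.
- case=> e1 /negb_inj e2; apply: (@perm_inj _ (next D)).
  by rewrite [LHS]surjective_pairing [RHS]surjective_pairing e1 e2.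
- by move=> e; move: hq; rewrite -e /= hp.
- by move=> e; move: hp; rewrite e /= hq.
- exact: perm_inj.
Qed.

Let cut : pred (cr D * bool) := fun p => p.1 \in s.

Lemma smooth_next_last (p : cr D * bool) : p.1 \in s ->
  smooth_next (last_edge state_join p) = next D (last_edge state_join p).
Proof.
move=> ps; have := @first_return_mem _ _ cut smooth_next_inj p ps.
rewrite /cut -/state_join /smooth_next; case: ifP => // /andP[/negPf /= ns _].
by rewrite ns.
Qed.

Fact state_head_subproof (p : {p : cr D * bool | p.1 \in s}) :
  (next D (last_edge state_join (val p))).1 \in s.
Proof.
rewrite -smooth_next_last ?(valP p)//.
exact: (@first_return_mem _ _ cut smooth_next_inj _ (valP p)).
Qed.

(** Each crossing [c] in [s] gives a source and a sink, and a new edge [inr c]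
    from the former to the latter; the edge leaving a passage of the source is
    followed up to a crossing in [s]. *)
Definition state_edge : finType :=
  ({p : cr D * bool | p.1 \in s} + {c : cr D | c \in s})%type.

Definition state_tail (e : state_edge) : {c : cr D | c \in s} :=
  match e with
  | inl p => exist _ (val p).1 (valP p)
  | inr c => c
  end.

Definition state_head (e : state_edge) : {c : cr D | c \in s} :=
  match e with
  | inl p => exist _ (next D (last_edge state_join (val p))).1 (state_head_subproof p)
  | inr c => c
  end.

Lemma card_passages (c : {c : cr D | c \in s}) :
  #|[pred p : {p : cr D * bool | p.1 \in s} | (val p).1 == val c]| = 2%N.
Proof.
pose g (b : bool) : {p : cr D * bool | p.1 \in s} := exist _ (val c, b) (valP c).
have gI : injective g by move=> b b' /(congr1 val) [].
rewrite -card_bool -(card_codom gI); apply: eq_card => p.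
rewrite !inE; apply/eqP/codomP => [e|[b ->]//].
by exists (val p).2; apply: val_inj => /=; rewrite -e -surjective_pairing.
Qed.

Fact state_tail_trivalent v : #|[set e | state_tail e == v]| = 3%N.
Proof.
rewrite -sum1_card big_sumType /= -[RHS]/(2 + 1)%N; congr (_ + _)%N.
  by rewrite -(card_passages v) -sum1_card; apply: eq_bigl => p; rewrite !inE.
by rewrite -[RHS](card1 v) -sum1_card; apply: eq_bigl => p; rewrite !inE.
Qed.

Fact state_head_trivalent w : #|[set e | state_head e == w]| = 3%N.
Proof.
pose g (p : {p : cr D * bool | p.1 \in s}) : {p : cr D * bool | p.1 \in s} :=
  exist _ (next D (last_edge state_join (val p))) (state_head_subproof p).
have gI : injective g.
  move=> p q /(congr1 val) /= /perm_inj e; apply: val_inj.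
  exact: (@first_return_inj _ _ cut smooth_next_inj _ _ (valP p) (valP q) e).
rewrite -sum1_card big_sumType /= -[RHS]/(2 + 1)%N; congr (_ + _)%N.
  rewrite -(card_passages w) -(on_card_preimset (f := g)); last first.
    exact/onW_bij/injF_bij.
  by rewrite -sum1_card; apply: eq_bigl => p; rewrite !inE.
by rewrite -[RHS](card1 w) -sum1_card; apply: eq_bigl => p; rewrite !inE.
Qed.

Definition state_web : web := {|
  edge := state_edge;
  circles := (loops D + closed_curves state_join)%N;
  tail_trivalent := state_tail_trivalent;
  head_trivalent := state_head_trivalent |}.

End StateWeb.

Definition crossing_sign (D : diagram) (c : cr D) : int :=
  if kind c is Classical false then -1 else 1.

(** A state is given by the set [s] of the classical crossings where the
    unoriented local state is chosen. *)
Definition state_weight (D : diagram) (s : {set cr D}) : laurent :=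
  \prod_(c | is_classical c)
    (if c \in s then - Apow (- crossing_sign c) else Apow (2 * crossing_sign c)).

Definition bracket (f : web -> ring_M) (D : diagram) : ring_M :=
  \sum_(s : {set cr D} | s \subset [set c | is_classical c])
    state_weight s *: f (state_web s).

(* Main.v *)
From HB Require Import structures.
From mathcomp Require Import all_boot all_order all_fingroup all_algebra.
From mathcomp Require Import zify ring.
From mathcomp Require Import finmap fraction monalg.
Require Import Defs.

(** At A = 1 and at A = -1 the two local states of a classical crossing have the
    weights 1 and -A, whatever the sign of the crossing.  A coefficient of the
    specialized map f is then an integer function of webs for which a circle
    counts 3, a bigon 2A, and a quadrilateral is the sum of its two resolutions
    ([web_functional]); it suffices to prove, for every such function, that the sum
    over the states is invariant ([bracket_free_link]).

    Isotopies, detour moves, virtualizations and crossing switches do not change the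
    state webs at all: forgetting virtual crossings, possibly with an exchange of the
    two passages of a crossing, induces an isomorphism between the webs of
    corresponding states ([bracket_value_erasure]).  In the same way the first two
    Reidemeister moves are reduced to the statement that the crossings involved may
    be declared virtual.

    For the Reidemeister moves webs are presented by permutations.  A trivalent
    bipartite graph has as many sources as sinks; pair them off and put three points
    over each pair.  A permutation [g] of the points over a set [V] and a subset [s]
    of [V] define a web: its vertices are the pairs in [s], its edges are the walks
    of [g] from a point over [s] to the next one, and the cycles of [g] that avoid
    the points over [s] are its circles.  A crossing is an element of [V]; its two
    passages are two of the points over it, and the third carries the edge that the
    unoriented state adds.  All states of a diagram share one permutation and differ
    by the set [s] only ([value_state]).  Local changes of a web become products with
    transpositions ([value_conj], [value_sink], [value_loosen]), and the two relations
    defining f take the normal forms [value_bigon] and [value_quad].  A point that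
    lies on no strand of the web is a fixed point, hence a circle; this is where the
    powers of 3 come from, and they can be cancelled in the integers.

    Near the crossings of a move the permutation is the product of one that fixes the
    local points and of a product of transpositions of local points, that is, of a
    list of pairs of numbers.  Equality of local tangles is then decided by following
    the strands, and the moves follow from the relations of Kuperberg's calculus:
    - at A = 1, with h for the unoriented state, a kink gives 3 - 2 = 1, two parallel
      crossings give 1 - h - h + h h = 1 because h h = 2 h, and in two antiparallel
      crossings the turned-back tangle occurs with coefficient 3 - 2 - 2 + 1 = 0;
    - for three strands crossing acyclically the third move is the braid relation,
      which reduces to h1 h2 h1 - h1 = h2 h1 h2 - h2: both sides are the tangle with
      one sink and one source not joined to each other ([acyclic_triangle]);
    - for three strands crossing cyclically both sides reduce to the same hexagon and
      to the same three resolutions of quadrilaterals ([cyclic_triangle]).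
    Every configuration in the third move is one of these two, up to the names of the
    crossings ([bracket_reidemeister3]). *)

Set Implicit Arguments.
Unset Strict Implicit.
Unset Printing Implicit Defensive.
Import GRing.Theory.

(** * First returns of a permutation to a set of points *)

Section Return.
Variables (P : finType) (g : P -> P) (Y : pred P).
Hypothesis g_inj : injective g.

(** The joining maps of states, erasures and resolutions all have this form: they
    follow a permutation and stop before entering [Y]. *)
Definition return_step (p : P) : option P := if Y (g p) then None else Some (g p).

Definition orbit_avoids (p : P) : bool := ~~ [exists q, fconnect g p q && Y q].

Definition cycles_avoiding : nat := fcard g orbit_avoids.

Lemma orbit_avoidsP p : reflect (forall n, ~~ Y (iter n g p)) (orbit_avoids p).
Proof.
apply: (iffP idP) => [/= /existsPn nY n|nY].
  by have := nY (iter n g p); rewrite fconnect_iter.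
apply/existsPn => q; apply/negP => /andP[/iter_findex <- Yq].
by have := nY (findex g p q); rewrite Yq.
Qed.

Lemma orbit_avoids_closed : fclosed g orbit_avoids.
Proof.
move=> p q /eqP /= <-; congr (~~ _); apply: eq_existsb => r.
by rewrite -same_fconnect1.
Qed.

(** The bound on the length of a chain built into [last_edge] does no harm, since a
    return takes place within one turn of the cycle of [p]. *)
Lemma return_last (m : nat) p : Y (iter m.+1 g p) ->
  (forall j, (j < m)%N -> ~~ Y (iter j.+1 g p)) ->
  last_edge return_step p = iter m g p.
Proof.
move=> Ym lt.
have mo : (m < fingraph.order g p)%N.
  rewrite ltnNge; apply/negP => om; have /negP[] : ~~ Y (iter (m - fingraph.order g p).+1 g p).
    by apply: lt; have := fingraph.order_gt0 g p; lia.
  by move: Ym; rewrite -(subnK om) -addSn iterD iter_order // (subnK om).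
have run j : (j <= m)%N -> iter j (follow return_step) p = iter j g p.
  elim: j => // j IHj jm; rewrite iterS IHj 1?ltnW//.
  by rewrite /follow /return_step -iterS (negPf (lt _ jm)).
have stay j : iter j (follow return_step) (iter m g p) = iter m g p.
  by elim: j => // j IHj; rewrite iterS IHj /follow /return_step -iterS Ym.
have le_m : (m <= #|P|)%N by rewrite (leq_trans (ltnW mo)) ?max_card.
by rewrite /last_edge -(subnK le_m) iterD run.
Qed.

Lemma return_ex p : ~~ orbit_avoids p ->
  exists m, Y (iter m.+1 g p) /\ forall j, (j < m)%N -> ~~ Y (iter j.+1 g p).
Proof.
rewrite negbK => /existsP[q /andP[pq Yq]].
have ex : exists m, Y (iter m.+1 g p).
  have : fconnect g (g p) q by rewrite -same_fconnect1.
  by move=> /iter_findex e; exists (findex g (g p) q); rewrite iterSr e.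
exists (ex_minn ex); case: ex_minnP => m Ym m_min; split=> // j jm.
by apply/negP => /m_min; rewrite leqNgt jm.
Qed.

Lemma last_edge_avoids p : orbit_avoids p ->
  forall n, iter n (follow return_step) p = iter n g p.
Proof.
move=> /orbit_avoidsP nY; elim=> // n IHn.
by rewrite iterS IHn /follow /return_step -iterS (negPf (nY _)).
Qed.

(** A chain closes up exactly along a cycle of [g] that never meets [Y]; so closed
    curves are counted by cycles of a permutation. *)
Lemma closed_curvesE : closed_curves return_step = cycles_avoiding.
Proof.
rewrite /closed_curves.
have -> : [set e | return_step (last_edge return_step e) != None]
    = [set e | orbit_avoids e].
  apply/setP => p; rewrite !inE; case: (boolP (orbit_avoids p)).
    move=> av; rewrite /last_edge last_edge_avoids // /return_step -iterS.
    by move/orbit_avoidsP: av => /(_ _)/negPf->.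
  by move=> /return_ex [m [Ym lt]]; rewrite (return_last Ym lt) /return_step -iterS Ym.
have orbE p : orbit_avoids p ->
    [set q | fconnect (follow return_step) p q] = [set q | fconnect g p q].
  move=> av; apply/setP => q; rewrite !inE.
  apply/idP/idP => /iter_findex <-.
    by rewrite last_edge_avoids // fconnect_iter.
  by rewrite -last_edge_avoids // fconnect_iter.
have -> : [set [set q | fconnect (follow return_step) p q] | p in [set p | orbit_avoids p]]
   = [set [set q | fconnect g p q] | p in [set p | orbit_avoids p]].
  by apply: eq_in_imset => p; rewrite inE => /orbE.
have -> : [set [set q | fconnect g p q] | p in [set p | orbit_avoids p]]
   = [set [set q | fconnect g p q] | p in predI (froots g) orbit_avoids].
  apply/setP => O; apply/imsetP/imsetP => -[p]; rewrite inE => pA ->; last first.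
    by exists p; rewrite ?inE //; case/andP: pA.
  exists (froot g p).
    rewrite inE; apply/andP; split; first exact/roots_root/fconnect_sym.
    have := closed_connect orbit_avoids_closed (connect_root (frel g) p).
    by move=> e; rewrite -[X in is_true X]e.
  apply/setP => q; rewrite !inE.
  by rewrite (same_connect (fconnect_sym g_inj) (connect_root _ p)).
rewrite card_in_imset // => p q; rewrite !inE => /andP[/eqP pr _] /andP[/eqP qr _] /setP/(_ q).
by rewrite !inE connect0 -(root_connect (fconnect_sym g_inj)) pr qr => /eqP.
Qed.

End Return.

Lemma return_step_last (P : finType) (g : P -> P) (Y Y' : pred P) (g_inj : injective g) p :
  Y p -> (forall n, Y (iter n g p) = Y' (iter n g p)) ->
  last_edge (return_step g Y) p = last_edge (return_step g Y') p.
Proof.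
move=> Yp e; have [] := @return_ex _ g Y g_inj p.
  by rewrite negbK; apply/existsP; exists p; rewrite connect0.
move=> m [Ym lt]; rewrite (return_last g_inj Ym lt).
by rewrite (@return_last _ g Y' g_inj m) -?e // => j jm; rewrite -e lt.
Qed.

(** Stopping also at the points of a union [O] of avoiding cycles takes these cycles
    out of the count. *)
Lemma cycles_avoidingU (P : finType) (g : P -> P) (Y O : pred P) (g_inj : injective g) :
  fclosed g O -> {in O, forall p, orbit_avoids g Y p} ->
  cycles_avoiding g Y = (cycles_avoiding g (predU Y O) + fcard g O)%N.
Proof.
move=> Ocl Oav; rewrite /cycles_avoiding /n_comp_mem -(cardID O) addnC; congr (_ + _)%N.
  apply: eq_card => p; rewrite !inE /= -!topredE /=.
  case: (froots g p) => /=; last by rewrite andbF.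
  apply/andP/orbit_avoidsP => [[pO /orbit_avoidsP pY] n|nY].
    by rewrite negb_or pY /= -[O _]/(_ \in O) -(closed_connect Ocl (fconnect_iter g n p)).
  split; first by have := nY 0; rewrite negb_or => /andP[].
  by apply/orbit_avoidsP => n; have := nY n; rewrite negb_or => /andP[].
apply: eq_card => p; rewrite !inE /= -!topredE /=.
case: (boolP (O p)) => pO; last by rewrite !andbF.
by rewrite Oav ?andbT.
Qed.

Lemma cycles_avoiding_orbit (P : finType) (g : P -> P) (Y : pred P) (g_inj : injective g) p :
  orbit_avoids g Y p ->
  cycles_avoiding g Y = (cycles_avoiding g (predU Y (fconnect g p))).+1.
Proof.
move=> av; rewrite (cycles_avoidingU g_inj (O := fconnect g p)).
- by rewrite n_comp_connect ?addn1 //; apply: fconnect_sym.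
- by apply: connect_closed; apply: fconnect_sym.
- move=> q pq; apply/orbit_avoidsP => n; have /orbit_avoidsP := av.
  by move=> /(_ (n + findex g p q)%N); rewrite iterD iter_findex.
Qed.

Lemma fcard_fixed (P : finType) (g : P -> P) (O : {pred P}) :
  {in O, forall p, g p = p} -> fcard g O = #|O|.
Proof.
move=> fx; rewrite /n_comp_mem; apply: eq_card => p; rewrite !inE.
case: (boolP (p \in O)) => pO; rewrite ?andbF // andbT.
have fxn n : iter n g p = p by elim: n => // n IHn; rewrite iterS IHn fx.
have /iter_findex e : fconnect g p (froot g p) by apply: connect_root.
by apply/eqP; rewrite -[LHS]e fxn.
Qed.

Lemma eq_cycles_avoiding (P : finType) (g g' : P -> P) (Y Y' : pred P) :
  g =1 g' -> Y =1 Y' -> cycles_avoiding g Y = cycles_avoiding g' Y'.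
Proof.
move=> eg eY; rewrite /cycles_avoiding (eq_fcard eg); apply: eq_n_comp_r => p.
congr (~~ _); apply: eq_existsb => q.
by rewrite (eq_fconnect eg) eY.
Qed.

Lemma eq_last_edge (P : finType) (k k' : P -> option P) :
  k =1 k' -> last_edge k =1 last_edge k'.
Proof. by move=> e p; apply: eq_iter => q; rewrite /follow e. Qed.

Lemma eq_closed_curves (P : finType) (k k' : P -> option P) :
  k =1 k' -> closed_curves k = closed_curves k'.
Proof. by move=> /boolp.funext ->. Qed.

Section Contraction.
Variables (P1 P2 : finType) (h : P1 -> P2) (g1 : P1 -> P1) (g2 : P2 -> P2).
Variables (Y1 : pred P1) (Y2 : pred P2).
Hypothesis h_inj : injective h.
Hypothesis g1_inj : injective g1.
Hypothesis g2_inj : injective g2.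
Hypothesis Yh : forall p, Y2 (h p) = Y1 p.
Hypothesis gh : forall p, exists m, iter m.+1 g2 (h p) = h (g1 p) /\
  forall j, (j < m)%N -> ~~ Y2 (iter j.+1 g2 (h p)) /\ iter j.+1 g2 (h p) \notin codom h.

Lemma contract_iter n p : exists m, iter m g2 (h p) = h (iter n g1 p).
Proof.
elim: n p => [|n IHn] p; first by exists 0.
have [m [mE _]] := gh p; have [m' m'E] := IHn (g1 p).
by exists (m' + m.+1)%N; rewrite iterD mE m'E -iterSr.
Qed.

Lemma contract_run n p : exists m, (n <= m)%N /\
  forall j, (j <= m)%N -> (exists2 i, (i <= j)%N & iter j g2 (h p) = h (iter i g1 p)) \/
                         (~~ Y2 (iter j g2 (h p)) /\ iter j g2 (h p) \notin codom h).
Proof.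
elim: n p => [|n IHn] p.
  by exists 0; split=> // -[|//] _; left; exists 0.
have [m [mE lt]] := gh p; have [m' [le' run]] := IHn (g1 p).
exists (m' + m.+1)%N; split; first by lia.
move=> j jm; case: (leqP j m) => jm0.
  case: j jm jm0 => [|j] jm jm0; first by left; exists 0.
  by right; apply: lt.
have e : iter j g2 (h p) = iter (j - m.+1) g2 (h (g1 p)) by rewrite -mE -iterD subnK.
case: (run (j - m.+1)%N); first by lia.
  by case=> i ij iE; left; exists i.+1; [lia|rewrite e iE iterSr].
by rewrite -e; right.
Qed.

Lemma contract_cases n p : (exists i, iter n g2 (h p) = h (iter i g1 p)) \/
   (~~ Y2 (iter n g2 (h p)) /\ iter n g2 (h p) \notin codom h).
Proof.
have [m [le run]] := contract_run n p.
by case: (run n le) => [[i _ e]|//]; [left; exists i|right].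
Qed.

Lemma contract_avoids p : orbit_avoids g2 Y2 (h p) = orbit_avoids g1 Y1 p.
Proof.
apply/orbit_avoidsP/orbit_avoidsP => nY n.
  by rewrite -Yh; have [m <-] := contract_iter n p.
by case: (contract_cases n p) => [[i ->]|[] //]; rewrite Yh.
Qed.

(** Returns can be computed in stages.  The hypotheses say that [g1] is [g2] watched
    at the points of the image of [h] only, and that nothing of [Y2] is met in
    between; so no return of [g2] is overlooked by [g1]. *)
Lemma contract_last p : Y1 p ->
  h (g1 (last_edge (return_step g1 Y1) p)) = g2 (last_edge (return_step g2 Y2) (h p)).
Proof.
move=> Yp; have [] := @return_ex _ g1 Y1 g1_inj p.
  by rewrite negbK; apply/existsP; exists p; rewrite connect0.
move=> n [Yn lt]; rewrite (return_last g1_inj Yn lt) -iterS.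
suff [m [mE mlt]] : exists m, iter m.+1 g2 (h p) = h (iter n.+1 g1 p) /\
    forall j, (j < m)%N -> ~~ Y2 (iter j.+1 g2 (h p)).
  by rewrite (return_last g2_inj _ mlt) -?iterS mE ?Yh.
elim: n p {Yp} Yn lt => [|n IHn] p Yn lt.
  by have [m [mE mlt]] := gh p; exists m; split=> // j /mlt[].
have [m [mE mlt]] := gh p.
have [||m' [mE' mlt']] := IHn (g1 p).
- by rewrite -iterSr.
- by move=> j jn; rewrite -iterSr lt.
exists (m' + m.+1)%N; split.
  by rewrite -addSn iterD mE mE' -iterSr.
move=> j jm; case: (ltngtP j m) => jm0; first by case: (mlt j jm0).
  rewrite -(subnK (ltnW jm0)) -addnS iterD mE.
  have -> : (j - m = (j - m).-1.+1)%N by lia.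
  by apply: mlt'; lia.
by rewrite jm0 mE Yh; apply: (lt 0).
Qed.

(** What [g1] overlooks are the cycles that never meet the image of [h]. *)
Lemma contract_cycles : cycles_avoiding g2 Y2 =
  (cycles_avoiding g1 Y1 + cycles_avoiding g2 (predU Y2 [pred q | q \in codom h]))%N.
Proof.
pose meets := [pred q | ~~ orbit_avoids g2 [pred q | q \in codom h] q].
have meets_cl : fclosed g2 meets.
  move=> q r qr; rewrite !inE; congr (~~ _); apply: (@orbit_avoids_closed _ g2 _ g2_inj q r qr).
pose A := [pred q | orbit_avoids g2 Y2 q && meets q].
have A_cl : fclosed g2 A.
  move=> q r qr; rewrite !inE.
  congr (_ && _); last exact: meets_cl.
  exact: (@orbit_avoids_closed _ g2 _ g2_inj q r qr).
have hE p p' : fconnect g1 p p' = fconnect g2 (h p) (h p').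
  apply/idP/idP => /iter_findex.
    have [m e] := contract_iter (findex g1 p p') p => <-.
    by rewrite -e fconnect_iter.
  case: (contract_cases (findex g2 (h p) (h p')) p).
    by case=> i -> /h_inj <-; apply: fconnect_iter.
  by case=> _ /negP nc e; case: nc; rewrite e codom_f.
have adj : fun_adjunction h g2 g1 A.
  split=> [q Aq|p p' _]; last exact: hE.
  apply: sigW; have /andP[_] : A q by [].
  rewrite /meets /= negbK => /existsP[r /andP[qr /codomP[p rE]]].
  by exists p; rewrite -rE.
rewrite {1}/cycles_avoiding {1}/n_comp_mem -(cardID meets).
congr (_ + _)%N.
  have -> : cycles_avoiding g1 Y1 = fcard g2 A.
    rewrite (adjunction_n_comp h (fconnect_sym g2_inj) (fconnect_sym g1_inj) A_cl adj).
    apply: eq_n_comp_r => p.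
    rewrite !inE.
    rewrite contract_avoids andb_idr // => _.
    by rewrite negbK; apply/existsP; exists (h p); rewrite connect0 /= codom_f.
  by apply: eq_card => q; rewrite !inE -andbA.
apply: eq_card => q; rewrite !inE /= negbK.
case: (froots g2 q); rewrite ?andbF //=.
rewrite -!topredE /=.
apply/andP/orbit_avoidsP => [[/orbit_avoidsP pO /orbit_avoidsP pY] n|nY].
  by rewrite negb_or pO pY.
by split; apply/orbit_avoidsP => n; have := nY n; rewrite negb_or => /andP[].
Qed.

End Contraction.

(** * Webs presented by permutations *)

Section PermWeb.
Variable V : finType.
Local Notation pt := (V * 'I_3)%type.
Implicit Types (g k r : {perm pt}) (s X : {set V}) (p q : pt).

Definition over s : pred pt := fun p => p.1 \in s.

(** The first return map of [g] to the points over [s]. *)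
Definition arrive g s p : pt := g (last_edge (return_step g (over s)) p).

Lemma arrive_over g s p : over s p -> over s (arrive g s p).
Proof. exact: (@first_return_mem _ _ (over s) (@perm_inj _ g)). Qed.

Lemma arrive_inj g s : {in over s &, injective (arrive g s)}.
Proof.
move=> p q ps qs /perm_inj.
exact: (@first_return_inj _ _ (over s) (@perm_inj _ g) p q ps qs).
Qed.

Definition pweb_vertex s : finType := {v : V | v \in s}.
Definition pweb_edge s : finType := {p : pt | p.1 \in s}.

Lemma card_over s : #|{: pweb_edge s}| = (3 * #|s|)%N.
Proof.
rewrite card_sub mulnC -[3%N in RHS](card_ord 3) -cardsT -cardsX.
by apply: eq_card => p; rewrite !inE andbT.
Qed.

Definition pweb_tail s (e : pweb_edge s) : pweb_vertex s := exist _ (val e).1 (valP e).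

Definition pweb_arrive g s (e : pweb_edge s) : pweb_edge s :=
  exist _ (arrive g s (val e)) (arrive_over g (valP e)).

Definition pweb_head g s (e : pweb_edge s) : pweb_vertex s :=
  pweb_tail (pweb_arrive g e).

Lemma pweb_arrive_inj g s : injective (@pweb_arrive g s).
Proof.
by move=> e e' /(congr1 val) /= /arrive_inj ee'; apply/val_inj/ee'; apply: valP.
Qed.

Fact pweb_tail_trivalent s v : #|[set e | @pweb_tail s e == v]| = 3%N.
Proof.
rewrite -[RHS](card_ord 3); pose f (i : 'I_3) : pweb_edge s := exist _ (val v, i) (valP v).
rewrite -(card_codom (f := f)); last by move=> i j /(congr1 val) [].
apply: eq_card => e; rewrite inE; apply/eqP/codomP => [ev|[i ->]].
  by exists (val e).2; apply/val_inj; rewrite /= -ev /= -surjective_pairing.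
exact/val_inj.
Qed.

Fact pweb_head_trivalent g s v : #|[set e | @pweb_head g s e == v]| = 3%N.
Proof.
rewrite -(pweb_tail_trivalent v) -[RHS](on_card_preimset (f := @pweb_arrive g s)).
  by apply: eq_card => e; rewrite !inE.
exact/onW_bij/injF_bij/pweb_arrive_inj.
Qed.

(** An element of [s] is at the same time a source, from which the walks through the
    three points over it start, and a sink, at which the walks arriving there end. *)
Definition pweb g s (n : nat) : web := {|
  src := pweb_vertex s; snk := pweb_vertex s; edge := pweb_edge s;
  tail := @pweb_tail s; head := @pweb_head g s; circles := n;
  tail_trivalent := @pweb_tail_trivalent s;
  head_trivalent := @pweb_head_trivalent g s |}.

Lemma eq_return_step_cycles g k s :
  return_step g (over s) =1 return_step k (over s) ->
  cycles_avoiding g (over s) = cycles_avoiding k (over s).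
Proof.
by rewrite -!(closed_curvesE _ (@perm_inj _ _)) => /eq_closed_curves.
Qed.

End PermWeb.

(** Bijectivity comes for free: all three maps are injective between sets of equal
    size, a web with [n] sources having [3 * n] edges. *)
Lemma pweb_iso (V W : finType) (g : {perm V * 'I_3}) (s : {set V})
    (k : {perm W * 'I_3}) (t : {set W}) (a b : V -> W)
    (c : V * 'I_3 -> W * 'I_3) n :
  #|s| = #|t| ->
  {in s, forall v, a v \in t} -> {in s, forall v, b v \in t} ->
  {in s &, injective a} -> {in s &, injective b} ->
  {in over s &, injective c} ->
  (forall p, over s p -> (c p).1 = a p.1) ->
  (forall p, over s p -> (arrive k t (c p)).1 = b (arrive g s p).1) ->
  web_iso (pweb g s n) (pweb k t n).
Proof.
move=> cst aM bM aI bI cI cT cH.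
have cM p : over s p -> over t (c p) by move=> ps; rewrite /over cT // aM.
have cV : #|pweb_vertex s| = #|pweb_vertex t|.
  by rewrite !card_sub.
have bij (A B : finType) (h : A -> B) : injective h -> #|A| = #|B| -> bijective h.
  by move=> hI AB; apply: (inj_card_bij hI); rewrite AB.
exists (fun v : pweb_vertex s => exist _ (a (val v)) (aM _ (valP v)) : pweb_vertex t).
exists (fun v : pweb_vertex s => exist _ (b (val v)) (bM _ (valP v)) : pweb_vertex t).
exists (fun e : pweb_edge s => exist _ (c (val e)) (cM _ (valP e)) : pweb_edge t).
split; split.
- by apply: (bij _ _ _ _ cV) => v w /(congr1 val) /= /aI vw; apply/val_inj/vw; apply: valP.
- by apply: (bij _ _ _ _ cV) => v w /(congr1 val) /= /bI vw; apply/val_inj/vw; apply: valP.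
- apply: bij => [v w /(congr1 val) /= /cI vw|]; first by apply/val_inj/vw; apply: valP.
  by rewrite !card_over -cst.
- by move=> e; apply/val_inj; rewrite /= cT //; apply: valP.
- by move=> e; apply/val_inj; rewrite /= cH //; apply: valP.
- by [].
Qed.

(** The properties that a coefficient of the map f has after specialization at
    A = c, where c = 1 or c = -1. *)
Record web_functional (c : int) (ev : web -> int) : Prop := WebFunctional {
  functional_iso : forall G H, web_iso G H -> ev G = ev H;
  functional_circle : forall G, ev (web_union G circle_web) = (3%:R * ev G)%R;
  functional_bigon : forall G H, bigon_resolution G H -> ev G = (2%:R * c * ev H)%R;
  functional_quad : forall G G1 G2, quadrilateral_resolution G G1 G2 ->
    ev G = (ev G1 + ev G2)%R }.

Section Skein.
Variables (c : int) (ev : web -> int).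
Hypothesis ev_functional : web_functional c ev.

Section PermSkein.
Variable V : finType.
Local Notation pt := (V * 'I_3)%type.
Implicit Types (g k r : {perm pt}) (s X : {set V}) (p q : pt).

Lemma ev_pweb_circle g s n m : ev (pweb g s (n + m)) = (3%:R ^+ m * ev (pweb g s n))%R.
Proof.
elim: m => [|m IHm]; first by rewrite addn0 mul1r.
rewrite exprS -mulrA -IHm -(functional_circle ev_functional).
apply: (functional_iso ev_functional); apply: web_iso_sym.
pose drop A (x : (A + void)%type) : A :=
  match x with inl a => a | inr v => match v with end end.
exists (@drop _), (@drop _), (@drop _).
split; split; try by exists inl => // -[|[]].
- by move=> [|[]].
- by move=> [|[]].
- by rewrite /= addn1 addnS.
Qed.

(** Every cycle of [g] without cut points counts as a circle, in particular every
    uncut fixed point. *)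
Definition value g s : int := ev (pweb g s (cycles_avoiding g (over s))).

(** Conjugation renames the points; it also renames the vertices as soon as points
    over the same cut vertex are sent over the same cut vertex. *)
Lemma value_conj g s k t :
  (forall p, over t (k p) = over s p) ->
  (forall v i, v \in s -> (k (v, i)).1 = (k (v, ord0)).1) ->
  value (g ^ k)%g t = value g s.
Proof.
move=> st fib; rewrite /value.
have gk p : (g ^ k)%g (k p) = k (g p) by rewrite /conjg !permM permK.
have hyp p : exists m, iter m.+1 (g ^ k)%g (k p) = k (g p) /\
    forall j, (j < m)%N -> ~~ over t (iter j.+1 (g ^ k)%g (k p)) /\
      iter j.+1 (g ^ k)%g (k p) \notin codom k.
  by exists 0; split=> //=; apply: gk.
have -> : cycles_avoiding (g ^ k)%g (over t) = cycles_avoiding g (over s).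
  rewrite (contract_cycles (@perm_inj _ k) (@perm_inj _ g) (@perm_inj _ _) st hyp).
  rewrite -[RHS]addn0; congr (_ + _)%N; apply/eq_card0 => p; rewrite !inE.
  apply/negP => /andP[_ /orbit_avoidsP/(_ 0)] /=.
  by rewrite negb_or => /andP[_ /negP[]]; rewrite -(permKV k p) codom_f.
apply/esym/(functional_iso ev_functional).
have pE p : p = (p.1, p.2) by case: p.
have cst : #|s| = #|t|.
  apply/eqP; rewrite -(eqn_pmul2l (m := 3)) // -!card_over !card_sub; apply/eqP.
  rewrite -(card_imset _ (@perm_inj _ k)); apply: eq_card => p.
  apply/imsetP/idP => [[q qs ->]|]; first by rewrite inE -[_ \in _]/(over _ _) st.
  by move=> pt0; exists (k^-1 p)%g; rewrite ?permKV // inE -[_ \in _]/(over s _) -st permKV.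
have aM : {in s, forall v, (k (v, ord0)).1 \in t}.
  by move=> v vs; rewrite -[_ \in _]/(over t _) st.
have aI : {in s &, injective (fun v => (k (v, ord0)).1)}.
  apply/imset_injP; rewrite cst; apply/eqP/eq_card => w.
  apply/imsetP/idP => [[v vs ->]|wt]; first exact: aM.
  have : over s (k^-1 (w, ord0))%g by rewrite -st permKV.
  rewrite /over => vs; exists (k^-1 (w, ord0))%g.1 => //.
  by rewrite -(fib _ (k^-1 (w, ord0))%g.2 vs) -pE permKV.
apply: (@pweb_iso _ _ g s (g ^ k)%g t _ _ k _ cst aM aM aI aI).
- exact: in2W perm_inj.
- by move=> p ps; rewrite {1}(pE p) fib.
- move=> p ps; rewrite /arrive -(contract_last (@perm_inj _ g) (@perm_inj _ _) st hyp ps).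
  rewrite {1}(pE (g _)) fib //; exact: (arrive_over g ps).
Qed.

(** A sink remembers neither the order in which its three edges arrive nor the source
    it is paired with, so points over cut vertices may be permuted upon arrival.  This
    is what brings bigons and quadrilaterals into normal form. *)
Lemma value_sink g s k :
  (forall p, over s (k p) = over s p) -> (forall p, ~~ over s p -> k p = p) ->
  (forall v i, v \in s -> (k (v, i)).1 = (k (v, ord0)).1) ->
  value (g * k)%g s = value g s.
Proof.
move=> ks kf fib; rewrite /value.
have step : return_step (g * k)%g (over s) =1 return_step g (over s).
  by move=> p; rewrite /return_step permM ks; case: ifP => // /negbT/kf->.
have -> : cycles_avoiding (g * k)%g (over s) = cycles_avoiding g (over s).
  exact: eq_return_step_cycles.
apply/esym/(functional_iso ev_functional).
have pE p : p = (p.1, p.2) by case: p.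
have aM : {in s, forall v, (k (v, ord0)).1 \in s}.
  by move=> v vs; rewrite -[_ \in _]/(over s _) ks.
have aI : {in s &, injective (fun v => (k (v, ord0)).1)}.
  apply/imset_injP; apply/eqP/eq_card => w.
  apply/imsetP/idP => [[v vs ->]|wt]; first exact: aM.
  have : over s (k^-1 (w, ord0))%g by rewrite -ks permKV.
  rewrite /over => vs; exists (k^-1 (w, ord0))%g.1 => //.
  by rewrite -(fib _ (k^-1 (w, ord0))%g.2 vs) -pE permKV.
apply: (@pweb_iso _ _ g s (g * k)%g s id _ id _ erefl _ aM _ aI) => // p ps.
rewrite /arrive (eq_last_edge step) permM -/(arrive g s p) {1}(pE (arrive g s p)) fib //.
exact: arrive_over.
Qed.

(** An uncut point in the interior of a walk does not influence the web; taken out of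
    the walk it becomes a fixed point, that is, one more circle. *)
Lemma value_loosen g s p : g p != p -> ~~ over s p ->
  value (g * tperm p (g p))%g s = (3%:R * value g s)%R.
Proof.
move=> gp ps; set g' := (g * _)%g.
have g'p : g' p = p by rewrite permM tpermR.
pose Q : finType := {q : pt | q != p}.
have nep (q : Q) : g' (val q) != p.
  by rewrite -[X in _ != X]g'p (inj_eq perm_inj) (valP q).
pose r (q : Q) : Q := exist _ (g' (val q)) (nep q).
have r_inj : injective r by move=> q q' /(congr1 val) /= /perm_inj/val_inj.
pose Y (q : Q) := over s (val q).
have Yh (q : Q) : over s (val q) = Y q by [].
have hyp' (q : Q) : exists m, iter m.+1 g' (val q) = val (r q) /\
    forall j, (j < m)%N -> ~~ over s (iter j.+1 g' (val q)) /\
      iter j.+1 g' (val q) \notin codom (val : Q -> pt).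
  by exists 0.
have hyp (q : Q) : exists m, iter m.+1 g (val q) = val (r q) /\
    forall j, (j < m)%N -> ~~ over s (iter j.+1 g (val q)) /\
      iter j.+1 g (val q) \notin codom (val : Q -> pt).
  case: (eqVneq (g (val q)) p) => gq.
    exists 1; rewrite /= /g' permM gq tpermL; split=> // -[|//] _ /=; rewrite gq; split=> //.
    by apply/negP => /codomP[x xE]; have := valP x; rewrite /= -xE eqxx.
  exists 0; split=> //=; rewrite /g' permM tpermD // eq_sym //.
  by rewrite (inj_eq perm_inj) (valP q).
have cE : cycles_avoiding g (over s) = cycles_avoiding r Y.
  rewrite (contract_cycles val_inj r_inj (@perm_inj _ g) Yh hyp).
  rewrite -[RHS]addn0; congr (_ + _)%N; apply/eq_card0 => q; rewrite !inE.
  apply/negP => /andP[_ /orbit_avoidsP nY].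
  have := nY 0; have := nY 1; rewrite /= !negb_or => /andP[_ g1] /andP[_ q1].
  have codP x : x != p -> x \in codom (val : Q -> pt).
    by move=> xp; apply/codomP; exists (exist _ x xp).
  have {}q1 : q = p by apply/eqP; apply: contraNT q1 => /codP.
  by move/negP: g1; apply; apply: codP; rewrite q1.
have c'E : cycles_avoiding g' (over s) = (cycles_avoiding r Y).+1.
  rewrite (contract_cycles val_inj r_inj (@perm_inj _ g') Yh hyp') -[RHS]addn1; congr (_ + _)%N.
  rewrite /cycles_avoiding; transitivity #|pred1 p|; last exact: card1.
  have eO : orbit_avoids g' (predU (over s) [pred q in codom (val : Q -> pt)]) =i pred1 p.
    move=> q; rewrite !inE; apply/orbit_avoidsP/eqP => [nY|->].
      have := nY 0; rewrite /= negb_or => /andP[_ nq]; apply/eqP; apply: contraNT nq => qp.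
      by apply/codomP; exists (exist _ q qp).
    move=> n; have -> : iter n g' p = p by elim: n => // n IHn; rewrite iterS IHn.
    rewrite /= negb_or ps; apply/negP => /codomP[x xE]; by have := valP x; rewrite /= -xE eqxx.
  by rewrite (eq_n_comp_r eO) fcard_fixed // => q /eqP->.
rewrite /value c'E -cE -addn1 ev_pweb_circle expr1; congr (_ * _)%R.
apply: (functional_iso ev_functional).
apply: (@pweb_iso _ _ g' s g s id id id) => // q qs.
have qp : q != p by apply: contraTneq qs => ->.
have := contract_last r_inj (@perm_inj _ g) Yh hyp (p := exist _ q qp) qs.
have := contract_last r_inj (@perm_inj _ g') Yh hyp' (p := exist _ q qp) qs.
by rewrite /arrive /= => <- <-.
Qed.

(** The same, for a point known by its predecessor. *)
Lemma value_loosen_left g s p q : g q = p -> q != p -> ~~ over s p ->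
  value (tperm q p * g)%g s = (3%:R * value g s)%R.
Proof.
move=> gq qp ps; have gp : g p != p.
  by apply: contra qp => /eqP gp; rewrite -(inj_eq (@perm_inj _ g)) gp gq.
rewrite -(value_loosen gp ps); congr value.
have := conjgC (tperm q p) g; rewrite tpermJ gq; exact.
Qed.

End PermSkein.
End Skein.

(** * Bigon and quadrilateral relations for permutations *)

Lemma cycles_avoiding_fixed (P : finType) (h : P -> P) (Y : pred P) p :
  injective h -> h p = p -> ~~ Y p ->
  cycles_avoiding h Y = (cycles_avoiding h (fun q => (q == p) || Y q)).+1.
Proof.
move=> hI hp Yp; have it n : iter n h p = p by elim: n => // n IHn; rewrite iterS IHn.
rewrite (cycles_avoiding_orbit hI (p := p)); last by apply/orbit_avoidsP => n; rewrite it.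
congr _.+1; apply: eq_cycles_avoiding => // q /=; rewrite orbC; congr (_ || _).
by apply/idP/eqP => [/iter_findex <-|->]; rewrite ?it ?connect0.
Qed.

Lemma cycles_avoiding_swapped (P : finType) (h : P -> P) (Y : pred P) p q :
  injective h -> h p = q -> h q = p -> ~~ Y p -> ~~ Y q ->
  cycles_avoiding h Y = (cycles_avoiding h (fun x => (x == p) || (x == q) || Y x)).+1.
Proof.
move=> hI hp hq Yp Yq; have it n : iter n h p = if odd n then q else p.
  by elim: n => // n IHn; rewrite iterS IHn /=; case: (odd n).
rewrite (cycles_avoiding_orbit hI (p := p)); last first.
  by apply/orbit_avoidsP => n; rewrite it; case: (odd n).
congr _.+1; apply: eq_cycles_avoiding => // x /=; rewrite orbC; congr (_ || _).
apply/idP/orP => [/iter_findex <-|[/eqP->|/eqP->]].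
- by rewrite it; case: (odd _); [right|left].
- exact: connect0.
- by rewrite -hp fconnect1.
Qed.

Lemma fibre3 (V : finType) (v : V) (p q r x : V * 'I_3) :
  p.1 = v -> q.1 = v -> r.1 = v -> uniq [:: p; q; r] -> x.1 = v ->
  [|| x == p, x == q | x == r].
Proof.
move=> pv qv rv pqr xv.
have sub : {subset [:: p; q; r] <= [seq (v, i) | i <- enum 'I_3]}.
  move=> y; rewrite !inE => yE; apply/mapP; exists y.2; rewrite ?mem_enum //.
  by have <- : y.1 = v; [case/or3P: yE => /eqP-> | rewrite -surjective_pairing].
have [|_ eqi] := uniq_min_size pqr sub; first by rewrite size_map size_enum_ord.
have : x \in [:: p; q; r] by rewrite eqi; apply/mapP; exists x.2; rewrite ?mem_enum // -xv -surjective_pairing.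
by rewrite !inE.
Qed.

Section Resolution.
Variables (c : int) (ev : web -> int).
Hypothesis ev_functional : web_functional c ev.
Variable V : finType.
Local Notation pt := (V * 'I_3)%type.
Implicit Types (g r : {perm pt}) (s X : {set V}) (p q : pt).
Local Notation value := (@value ev V).

(** Common form of the resolutions of bigons and quadrilaterals.  The points over the
    deleted vertices [X] are either legs ([L]) or lie on internal edges; the internal
    points form cycles of the first return map, [m] in number, which would survive as
    circles.  Uncutting the vertices of [X] after the permutation [r] of the legs joins
    the legs as prescribed by [k], up to these [m] circles. *)
Lemma resolves_pweb g r s X (L : pred pt) (k : pweb_edge s -> option (pweb_edge s)) m n :
  X \subset s -> (forall p, L p -> p.1 \in X) -> (forall p, ~~ L p -> r p = p) ->
  (forall e, omap val (k e) =
     let q := r (arrive g s (val e)) in if L q then Some q else None) ->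
  (forall p, over X p -> ~~ L p -> over X (arrive g s p) && ~~ L (arrive g s p)) ->
  (forall h : pweb_edge s -> pweb_edge s, injective h ->
     (forall e, val (h e) = r (arrive g s (val e))) ->
     cycles_avoiding h (fun e => over (s :\: X) (val e))
      = (m + cycles_avoiding h (fun e => ~~ L (val e)))%N) ->
  exists2 n', resolves [set v : src (pweb g s n) | val v \in X]
     [set v : snk (pweb g s n) | val v \in X] k (pweb (g * r)%g (s :\: X) n') &
    (n' + m + cycles_avoiding g (over s) = n + cycles_avoiding (g * r)%g (over (s :\: X)))%N.
Proof.
move=> Xs LX rL kE OO hm.
have rI := @perm_inj _ r.
have rLL p : L (r p) = L p.
  apply/idP/idP => [|Lp]; last by apply: contraLR Lp => /[dup] + /rL /rI <-.
  by apply: contraTT => nL; rewrite rL.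
have rs p : over s (r p) = over s p.
  case: (boolP (L p)) => Lp; last by rewrite rL.
  by rewrite /over !(subsetP Xs) ?LX // rLL.
pose h (e : pweb_edge s) : pweb_edge s :=
  exist _ (r (arrive g s (val e))) (etrans (rs _) (arrive_over g (valP e))).
have hI : injective h.
  by move=> e e' /(congr1 val) /= /rI /arrive_inj ee'; apply/val_inj/ee'; apply: valP.
have {}hm := hm h hI (fun e => erefl).
pose Y1 (e : pweb_edge s) := over (s :\: X) (val e).
pose g' := (g * r)%g.
have step : return_step g' (over s) =1 return_step g (over s).
  move=> p; rewrite /return_step permM rs; case: ifP => // /negbT ns.
  by rewrite rL //; apply: contra ns => /LX; apply: (subsetP Xs).
have arr e : arrive g' s (val e) = val (h e).
  by rewrite /arrive (eq_last_edge step) permM.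
have s's p : over (s :\: X) p -> over s p by rewrite /over inE => /andP[].
have Yh e : over (s :\: X) (val e) = Y1 e by [].
have gh e : exists m, iter m.+1 g' (val e) = val (h e) /\
    forall j, (j < m)%N -> ~~ over (s :\: X) (iter j.+1 g' (val e)) /\
      iter j.+1 g' (val e) \notin codom (val : pweb_edge s -> pt).
  have [] := @return_ex _ g' (over s) (@perm_inj _ _) (val e).
    by rewrite negbK; apply/existsP; exists (val e); rewrite connect0; apply: valP.
  move=> j [js lt]; exists j; split.
    by rewrite -arr /arrive (return_last (@perm_inj _ g') js lt).
  move=> i /lt nis; split; first by apply: contra nis; apply: s's.
  by apply: contra nis => /codomP[x ->]; apply: valP.
have kE' : k =1 return_step h (fun e => ~~ L (val e)).
  move=> e; have := kE e; rewrite /return_step /=.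
  case: ifP => Lq; first by case: (k e) => // q [qE]; congr Some; apply/val_inj.
  by case: (k e).
have c1 := contract_cycles val_inj hI (@perm_inj _ g') Yh gh.
have c2 : cycles_avoiding g' (over s) = cycles_avoiding g (over s).
  exact: eq_return_step_cycles.
have c3 : cycles_avoiding g' (predU (over (s :\: X))
   [pred q | q \in codom (val : pweb_edge s -> pt)]) = cycles_avoiding g' (over s).
  apply: eq_cycles_avoiding; first exact: frefl.
  move=> p; rewrite [LHS]/=; apply/orP/idP => [[/s's //|/codomP[x ->]]|ps].
    exact: valP.
  by right; apply/codomP; exists (exist _ p ps).
exists (n + closed_curves k)%N; last first.
  have c4 := etrans (eq_closed_curves kE') (closed_curvesE _ hI).
  rewrite c3 c2 {}hm -{}c4 in c1.
  rewrite -/g' c1.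
  by rewrite (addnC m) !addnA.
clear c1 c2 c3 hm; have inc v : v \in s :\: X -> v \in s by rewrite inE => /andP[].
exists (fun v : pweb_vertex (s :\: X) => exist _ (val v) (inc _ (valP v)) : pweb_vertex s).
exists (fun v : pweb_vertex (s :\: X) => exist _ (val v) (inc _ (valP v)) : pweb_vertex s).
exists (fun e : pweb_edge (s :\: X) => exist _ (val e) (inc _ (valP e)) : pweb_edge s).
have cod : forall v : pweb_vertex s, (v \in codom
   (fun v : pweb_vertex (s :\: X) => exist _ (val v) (inc _ (valP v)) : pweb_vertex s)) =
   (v \notin [set v : pweb_vertex s | val v \in X]).
  move=> v; rewrite inE; apply/codomP/idP => [[w ->] /=|vX].
    by have := valP w; rewrite inE => /andP[].
  have vsX : val v \in s :\: X by rewrite inE vX (valP v).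
  by exists (exist _ (val v) vsX); apply: val_inj.
split; split.
- by move=> v w /(congr1 val) /= vw; apply: val_inj.
- by move=> v w /(congr1 val) /= vw; apply: val_inj.
- by move=> v w /(congr1 val) /= vw; apply: val_inj.
- split; [exact: cod | exact: cod | move=> e].
  rewrite inE; apply/codomP/idP => [[x ->] /=|eX].
    by have := valP x; rewrite inE => /andP[].
  have esX : (val e).1 \in s :\: X by rewrite inE eX; apply: (valP e).
  by exists (exist _ (val e) esX); apply: val_inj.
have head_eq (e : pweb_edge (s :\: X)) (x : pweb_edge s) : val x = val e ->
    (arrive g s (val (last_edge k x))).1 = (arrive g' (s :\: X) (val e)).1.
  move=> xe; have Yx : Y1 x by rewrite /Y1 xe; apply: (valP e).
  pose O (z : pweb_edge s) := over X (val z) && ~~ L (val z).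
  have Oh z : O z -> O (h z).
    move=> /andP[zX zL]; have /andP[hX hL] := OO _ zX zL.
    have e1 : val (h z) = arrive g s (val z) := rL _ hL.
    by rewrite /O e1 hX hL.
  have Oit i z : O z -> O (iter i h z) by move=> Oz; elim: i => // i; apply: Oh.
  have nX z : Y1 z = ~~ over X (val z).
    by rewrite /Y1 /over inE andbC; have -> : (val z).1 \in s by apply: (valP z).
  have avO i : Y1 (iter i h x) = ~~ L (val (iter i h x)).
    have nO : ~~ O (iter i h x).
      apply: contraL Yx => Oi; rewrite nX negbK.
      have : fconnect h (iter i h x) x by rewrite (fconnect_sym hI) fconnect_iter.
      by move=> /iter_findex <-; have /andP[] := Oit (findex h (iter i h x) x) _ Oi.
    rewrite nX; congr (~~ _); apply/idP/idP => [zX|]; last exact: LX.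
    by move: nO; rewrite /O zX negbK.
  have -> : last_edge k x = last_edge (return_step h Y1) x.
    by rewrite (eq_last_edge kE'); apply/esym; apply: (return_step_last hI Yx avO).
  have last := contract_last hI (@perm_inj _ g') Yh gh Yx.
  have -> : arrive g' (s :\: X) (val e) = val (h (last_edge (return_step h Y1) x)).
    by rewrite -xe; apply: esym last.
  have : Y1 (h (last_edge (return_step h Y1) x)).
    by rewrite -Yh last; apply: (arrive_over g' (s := s :\: X)); rewrite Yh.
  rewrite nX => nXq; have nLq : ~~ L (arrive g s (val (last_edge (return_step h Y1) x))).
    by apply: contra nXq => Lq; apply: LX; rewrite rLL.
  by congr (_.1); apply: esym (rL _ nLq).
- split; [move=> e; exact: val_inj | move=> e | exact: erefl].
  apply: val_inj; exact: head_eq.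
Qed.

(** The source over [v] is joined to the sink over [v] by the two edges [p] and [q].
    Uncutting [v] joins the third edges and leaves [p] and [q] behind as circles,
    whence the factor 9. *)
Lemma value_bigon g s v (p q r : pt) : v \in s -> p.1 = v -> q.1 = v -> r.1 = v ->
  uniq [:: p; q; r] -> g p = p -> g q = q ->
  (9%:R * value g s = 2%:R * c * value g (s :\ v))%R.
Proof.
move=> vs pv qv rv pqr gp gq.
have fib x : x.1 = v -> [|| x == p, x == q | x == r] := fibre3 pv qv rv pqr.
have over_v x : x.1 = v -> over s x by rewrite /over => ->.
have arr x : x.1 = v -> g x = x -> arrive g s x = x.
  move=> xv gx; rewrite /arrive (@return_last _ g (over s) (@perm_inj _ g) 0) //= gx.
  exact: over_v.
have /and3P[pq pr qr] : [&& p != q, p != r & q != r].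
  by move: pqr; rewrite /= !inE negb_or andbT -andbA.
pose E x (xv : x.1 = v) : pweb_edge s := exist _ x (over_v x xv).
have [lin linE] : exists lin, pweb_arrive g lin = E r rv.
  have [f _ fK] := injF_bij (@pweb_arrive_inj _ g s); by exists (f (E r rv)).
pose k (e : pweb_edge s) := if e == lin then Some (E r rv) else None.
have arr_inj := @arrive_inj _ g s.
have linP (e : pweb_edge s) : (e == lin) = (arrive g s (val e) == r).
  apply/eqP/eqP => [->|er]; first by rewrite -[LHS]/(val (pweb_arrive g lin)) linE.
  by apply: (@pweb_arrive_inj _ g s); rewrite linE; apply: val_inj.
have [||||||n' res cyc] := @resolves_pweb g 1%g s [set v] (pred1 r) k 2 (cycles_avoiding g (over s)).
- by rewrite sub1set.
- by move=> x /eqP->; rewrite rv inE.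
- by move=> x _; rewrite perm1.
- by move=> e; rewrite perm1 /= /k linP; case: eqP => // ->.
- move=> x; rewrite /over inE => /eqP /fib /or3P[]/eqP-> /= nL.
  + by rewrite (arr p pv gp) pv inE eqxx pr.
  + by rewrite (arr q qv gq) qv inE eqxx qr.
  + by rewrite eqxx in nL.
- move=> h hI hE.
  have hp : h (E p pv) = E p pv by apply: val_inj; rewrite hE perm1; apply: arr.
  have hq : h (E q qv) = E q qv by apply: val_inj; rewrite hE perm1; apply: arr.
  set Y := (fun e : pweb_edge s => _).
  have Yp : ~~ Y (E p pv) by rewrite /Y /over !inE /= pv eqxx.
  have Yq : ~~ ((E q qv == E p pv) || Y (E q qv)).
    by rewrite -(inj_eq val_inj) /= (eq_sym q) (negPf pq) /Y /over !inE /= qv eqxx.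
  rewrite (cycles_avoiding_fixed hI hp Yp) (cycles_avoiding_fixed hI hq Yq).
  + congr _.+2; apply: eq_cycles_avoiding; first exact: frefl.
    move=> x; rewrite /Y.
    rewrite -!(inj_eq val_inj) /= /over !inE.
    case: eqP => [->|xq]; first by rewrite qr.
    case: eqP => [->|xp]; first by rewrite pr.
    case: eqP => [xv|xv] /=; last by rewrite (valP x); case: eqP => // xr; rewrite xr in xv.
    by have /or3P[/eqP|/eqP|/eqP->] // := fib _ xv; rewrite eqxx.

rewrite mulg1 in res cyc.
have /(functional_bigon ev_functional) bg :
    bigon_resolution (pweb g s (cycles_avoiding g (over s))) (pweb g (s :\ v) n').
  have head_arr x (xv : x.1 = v) : g x = x -> @head (pweb g s (cycles_avoiding g (over s))) (E x xv) = exist _ v vs.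
    by move=> gx; apply: val_inj; rewrite /= arr.
  have tailE x (xv : x.1 = v) : @tail (pweb g s (cycles_avoiding g (over s))) (E x xv) = exist _ v vs.
    exact: val_inj.
  exists (E p pv), (E q qv), lin, (E r rv); split.
  + split; first by rewrite -(inj_eq val_inj).
      by rewrite !tailE.
    by rewrite !head_arr.
  + by split; rewrite ?tailE // -(inj_eq val_inj) eq_sym.
  + split; first by rewrite head_arr //; apply: val_inj; rewrite /= -[arrive _ _ _]/(val (pweb_arrive g lin)) linE.
      by rewrite eq_sym linP arr.
    by rewrite eq_sym linP arr.
  + rewrite tailE head_arr //.
    suff -> : [set exist _ v vs] = [set w : pweb_vertex s | val w \in [set v]] by [].
    by apply/setP => w; rewrite !inE -(inj_eq val_inj).
rewrite /value bg; have -> : cycles_avoiding g (over (s :\ v)) = (n' + 2)%N.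
  by apply/eqP; rewrite -(eqn_add2l (cycles_avoiding g (over s))) -cyc addnC.
rewrite (ev_pweb_circle ev_functional); ring.
Qed.

Section Quadrilateral.
Variables (g : {perm pt}) (s : {set V}) (u v : V) (u0 u1 u2 v0 v1 v2 : pt).
Hypotheses (us : u \in s) (vs : v \in s) (uv : u != v).
Hypotheses (u0u : u0.1 = u) (u1u : u1.1 = u) (u2u : u2.1 = u) (uniq_u : uniq [:: u0; u1; u2]).
Hypotheses (v0v : v0.1 = v) (v1v : v1.1 = v) (v2v : v2.1 = v) (uniq_v : uniq [:: v0; v1; v2]).
Hypotheses (gu0 : g u0 = u0) (gv0 : g v0 = v0) (gu1 : g u1 = v1) (gv1 : g v1 = u1).

Let over_u x : x.1 = u -> over s x. Proof. by rewrite /over => ->. Qed.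
Let over_v x : x.1 = v -> over s x. Proof. by rewrite /over => ->. Qed.
Let Eu x (xu : x.1 = u) : pweb_edge s := exist _ x (over_u xu).
Let Ev x (xv : x.1 = v) : pweb_edge s := exist _ x (over_v xv).

Let arr x y : g x = y -> over s y -> arrive g s x = y.
Proof.
by move=> gx ys; rewrite /arrive (@return_last _ g (over s) (@perm_inj _ g) 0) //= gx.
Qed.

Let uvF (x y : pt) : x.1 = u -> y.1 = v -> (x == y) = false.
Proof. by move=> xu yv; apply: contraNF uv => /eqP e; rewrite -xu e yv. Qed.

Let vuF (x y : pt) : x.1 = v -> y.1 = u -> (x == y) = false.
Proof. by move=> xu yv; rewrite eq_sym uvF. Qed.

Let uniqE : [/\ u0 != u1, u0 != u2 & u1 != u2] /\ [/\ v0 != v1, v0 != v2 & v1 != v2].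
Proof.
by move: uniq_u uniq_v; rewrite /= !inE !negb_or !andbT -!andbA => /and3P[] ? ? ? /and3P[].
Qed.

Lemma resolves_quad (r : {perm pt}) (k : pweb_edge s -> option (pweb_edge s)) :
  (forall p, ~~ ((p == u2) || (p == v2)) -> r p = p) ->
  (forall e, omap val (k e) = let q := r (arrive g s (val e)) in
     if (q == u2) || (q == v2) then Some q else None) ->
  exists2 n', resolves [set w : src (pweb g s (cycles_avoiding g (over s))) | val w \in [set u; v]]
     [set w : snk (pweb g s (cycles_avoiding g (over s))) | val w \in [set u; v]]
     k (pweb (g * r)%g (s :\: [set u; v]) n') &
    cycles_avoiding (g * r)%g (over (s :\: [set u; v])) = (n' + 3)%N.
Proof.
move=> rL kE; have [[u01 u02 u12] [v01 v02 v12]] := uniqE.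
have fib_u x : x.1 = u -> [|| x == u0, x == u1 | x == u2] := fibre3 u0u u1u u2u uniq_u.
have fib_v x : x.1 = v -> [|| x == v0, x == v1 | x == v2] := fibre3 v0v v1v v2v uniq_v.
have [||||n' res cyc] := @resolves_pweb g r s [set u; v] (fun p => (p == u2) || (p == v2))
   k 3 (cycles_avoiding g (over s)) _ _ rL kE.
- by apply/subsetP => x; rewrite !inE => /orP[]/eqP->.
- by move=> x /orP[]/eqP->; rewrite ?u2u ?v2v !inE eqxx ?orbT.
- move=> x; rewrite /over !inE => /orP[] /eqP.
    move=> /fib_u/or3P[]/eqP-> nL.
    + by rewrite (arr gu0 (over_u u0u)) u0u eqxx.
    + by rewrite (arr gu1 (over_v v1v)) v1v eqxx orbT (negPf v12) vuF.
    + by rewrite eqxx in nL.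
  move=> /fib_v/or3P[]/eqP-> nL.
  + by rewrite (arr gv0 (over_v v0v)) v0v eqxx orbT (negPf v02) vuF.
  + by rewrite (arr gv1 (over_u u1u)) u1u eqxx (negPf u12) uvF.
  + by rewrite eqxx orbT in nL.
- move=> h hI hE.
  have hu0 : h (Eu u0u) = Eu u0u.
    by apply: val_inj; rewrite hE /= (arr gu0 (over_u u0u)) rL // (negPf u02) uvF.
  have hv0 : h (Ev v0v) = Ev v0v.
    by apply: val_inj; rewrite hE /= (arr gv0 (over_v v0v)) rL // (negPf v02) vuF.
  have hu1 : h (Eu u1u) = Ev v1v.
    by apply: val_inj; rewrite hE /= (arr gu1 (over_v v1v)) rL // (negPf v12) vuF.
  have hv1 : h (Ev v1v) = Eu u1u.
    by apply: val_inj; rewrite hE /= (arr gv1 (over_u u1u)) rL // (negPf u12) uvF.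
  set Y := (fun e : pweb_edge s => _).
  have Yu x (xu : x.1 = u) : Y (Eu xu) = false by rewrite /Y /over !inE /= xu eqxx.
  have Yv x (xv : x.1 = v) : Y (Ev xv) = false by rewrite /Y /over !inE /= xv eqxx orbT.
  have eE (x y : pweb_edge s) : (x == y) = (val x == val y) by rewrite -(inj_eq val_inj).
  have Y2 : ~~ ((Ev v0v == Eu u0u) || Y (Ev v0v)) by rewrite eE /= vuF ?Yv.
  (* [u0] and [v0] are fixed points, [u1] and [v1] form a cycle of length two. *)
  have Y3 : ~~ ((Eu u1u == Ev v0v) || ((Eu u1u == Eu u0u) || Y (Eu u1u))).
    by rewrite !eE /= uvF // (eq_sym u1) (negPf u01) Yu.
  have Y4 : ~~ ((Ev v1v == Ev v0v) || ((Ev v1v == Eu u0u) || Y (Ev v1v))).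
    by rewrite !eE /= (eq_sym v1) (negPf v01) vuF ?Yv.
  rewrite (cycles_avoiding_fixed hI hu0 (negbT (Yu _ u0u))) (cycles_avoiding_fixed hI hv0 Y2).
  rewrite (cycles_avoiding_swapped hI hu1 hv1 Y3 Y4).
  congr _.+3; apply: eq_cycles_avoiding; first exact: frefl.
  case=> x xs; rewrite !eE /= /Y /over !inE /= xs andbT.
  case: (eqVneq x u0) => [->|xu0]; first by rewrite (negPf u02) uvF ?orbT.
  case: (eqVneq x v0) => [->|xv0]; first by rewrite (negPf v02) vuF ?orbT.
  case: (eqVneq x u1) => [->|xu1]; first by rewrite (negPf u12) uvF.
  case: (eqVneq x v1) => [->|xv1]; first by rewrite (negPf v12) vuF.
  case: (eqVneq x.1 u) => [xu|xu] /=.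
    by have := fib_u _ xu; rewrite (negPf xu0) (negPf xu1) /= => ->.
  case: (eqVneq x.1 v) => [xv|xv] /=.
    by have := fib_v _ xv; rewrite (negPf xv0) (negPf xv1) /= => ->; rewrite orbT.
  by apply/esym/norP; split; [apply: contra xu => /eqP-> | apply: contra xv => /eqP->];
    rewrite ?u2u ?v2v.
exists n' => //.
by apply/eqP; rewrite -(eqn_add2l (cycles_avoiding g (over s))) -cyc addnC.
Qed.

(** The internal edges [u0], [v0], [u1], [v1] are left behind as three circles. *)
Lemma value_quad : (27%:R * value g s = value g (s :\: [set u; v])
   + value (g * tperm u2 v2)%g (s :\: [set u; v]))%R.
Proof.
have [[u01 u02 u12] [v01 v02 v12]] := uniqE.
have [inv _ invK] := injF_bij (@pweb_arrive_inj _ g s).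
pose lu := inv (Eu u2u); pose lv := inv (Ev v2v).
have luP (e : pweb_edge s) : (e == lu) = (arrive g s (val e) == u2).
  apply/eqP/eqP => [->|er]; first by rewrite -[LHS]/(val (pweb_arrive g lu)) invK.
  by apply: (@pweb_arrive_inj _ g s); rewrite invK; apply: val_inj.
have lvP (e : pweb_edge s) : (e == lv) = (arrive g s (val e) == v2).
  apply/eqP/eqP => [->|er]; first by rewrite -[LHS]/(val (pweb_arrive g lv)) invK.
  by apply: (@pweb_arrive_inj _ g s); rewrite invK; apply: val_inj.
pose k1 (e : pweb_edge s) := if e == lu then Some (Eu u2u) else if e == lv then Some (Ev v2v) else None.
pose k2 (e : pweb_edge s) := if e == lu then Some (Ev v2v) else if e == lv then Some (Eu u2u) else None.
have [||n1 res1 cyc1] := @resolves_quad 1%g k1.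
- by move=> p _; rewrite perm1.
- by move=> e; rewrite perm1 /k1 luP lvP /=; do 2! case: eqP => [->|] //.
have [||n2 res2 cyc2] := @resolves_quad (tperm u2 v2) k2.
- by move=> p; rewrite negb_or => /andP[pu pv]; rewrite tpermD // eq_sym.
- move=> e; rewrite /k2 luP lvP /=; case: eqP => [->|/eqP nu].
    by rewrite tpermL eqxx orbT.
  case: eqP => [->|/eqP nv]; first by rewrite tpermR eqxx.
  have -> : tperm u2 v2 (arrive g s (sval e)) = arrive g s (sval e).
    by apply: tpermD; rewrite eq_sym.
  by rewrite (negPf nu) (negPf nv).
rewrite mulg1 in res1 cyc1.
pose G := pweb g s (cycles_avoiding g (over s)).
have tailu x (xu : x.1 = u) : @tail G (Eu xu) = exist _ u us by apply: val_inj.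
have tailv x (xv : x.1 = v) : @tail G (Ev xv) = exist _ v vs by apply: val_inj.
have headu (e : edge G) x : arrive g s (val e) = x -> x.1 = u -> head e = exist _ u us.
  by move=> ex xu; apply: val_inj; rewrite /= ex.
have headv (e : edge G) x : arrive g s (val e) = x -> x.1 = v -> head e = exist _ v vs.
  by move=> ex xu; apply: val_inj; rewrite /= ex.
have hu0 := headu (Eu u0u) _ (arr gu0 (over_u u0u)) u0u.
have hv0 := headv (Ev v0v) _ (arr gv0 (over_v v0v)) v0v.
have hu1 := headv (Eu u1u) _ (arr gu1 (over_v v1v)) v1v.
have hv1 := headu (Ev v1v) _ (arr gv1 (over_u u1u)) u1u.
have eqlu := luP lu; rewrite eqxx in eqlu; have hlu := headu lu _ (eqP (esym eqlu)) u2u.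
have eqlv := lvP lv; rewrite eqxx in eqlv; have hlv := headv lv _ (eqP (esym eqlv)) v2v.
have uvE : exist _ u us != exist _ v vs :> pweb_vertex s by rewrite -(inj_eq val_inj).
have eE (x y : pweb_edge s) : (x == y) = (val x == val y) by rewrite -(inj_eq val_inj).
have setE : [set exist _ u us; exist _ v vs] = [set w : pweb_vertex s | val w \in [set u; v]].
  by apply/setP => w; rewrite !inE -!(inj_eq val_inj).
have : quadrilateral_resolution G (pweb g (s :\: [set u; v]) n1)
    (pweb (g * tperm u2 v2)%g (s :\: [set u; v]) n2).
  exists (Eu u0u), (Ev v1v), (Ev v0v), (Eu u1u), (Eu u2u), lu, (Ev v2v), lv.
  cbv zeta; rewrite !tailu !tailv hu0 hu1 hlu hlv setE.
  split.
  - split; first by split=> //; rewrite ?tailu ?tailv ?hu0 ?hu1 ?hv0 ?hv1.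
    by rewrite ?tailu ?tailv ?hu0 ?hu1 ?hv0 ?hv1.
  - split; split; [by [] | | | by [] | |].
    + by rewrite eE /= eq_sym.
    + by rewrite eE /= eq_sym.
    + by rewrite eq_sym luP (arr gu0 (over_u u0u)).
    + by rewrite eq_sym luP (arr gv1 (over_u u1u)).
  - split; split; [by [] | | | by [] | |].
    + by rewrite eE /= eq_sym.
    + by rewrite eE /= eq_sym.
    + by rewrite eq_sym lvP (arr gu1 (over_v v1v)).
    + by rewrite eq_sym lvP (arr gv0 (over_v v0v)).
  - exact: res1.
  - exact: res2.
move=> /(functional_quad ev_functional) qd.
rewrite /value qd cyc1 cyc2 !(ev_pweb_circle ev_functional); ring.
Qed.

End Quadrilateral.

End Resolution.

(** * State webs presented by permutations *)

Section Lift.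
Variables (C : finType) (o : C -> bool).

Definition i0 : 'I_3 := @Ordinal 3 0 isT.
Definition i1 : 'I_3 := @Ordinal 3 1 isT.
Definition i2 : 'I_3 := @Ordinal 3 2 isT.

(** The two passages of a crossing are two of the points over it; the third point
    stands for the edge from the source to the sink of the unoriented state.  The map
    [o] tells which passage comes first, so that a move has to be treated for one
    labelling of the passages only.  The three points over [None] belong to no crossing;
    they are at the disposal of the strands entering a local tangle. *)
Definition pass (p : C * bool) : option C * 'I_3 :=
  (Some p.1, if p.2 == o p.1 then i0 else i1).

Definition unpass (q : option C * 'I_3) : option (C * bool) :=
  if q.1 is Some x then
    if q.2 == i0 then Some (x, o x) else if q.2 == i1 then Some (x, ~~ o x) else None
  else None.

Lemma passK : pcancel pass unpass.
Proof. by case=> x b; rewrite /unpass /pass /=; case: b (o x) => -[]. Qed.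

Lemma pass_inj : injective pass. Proof. exact: pcan_inj passK. Qed.

Lemma unpassK : ocancel unpass pass.
Proof.
case=> -[x|] i //; rewrite /unpass /=; case: eqP => [->|_] /=; first by rewrite /pass /= eqxx.
by case: eqP => [->|_] //=; rewrite /pass /=; case: (o x).
Qed.

Lemma unpassP q : if unpass q is Some p then q = pass p else q \notin codom pass.
Proof.
have := unpassK q; case e: (unpass q) => [p|] //= _.
by apply/negP => /codomP[p pE]; rewrite pE passK in e.
Qed.

Definition lift_fun (n : {perm C * bool}) q := if unpass q is Some p then pass (n p) else q.

Lemma lift_inj n : injective (lift_fun n).
Proof.
rewrite /lift_fun => q q'; have := unpassP q; have := unpassP q'.
case: (unpass q) => [p|]; case: (unpass q') => [p'|] //.
- by move=> -> -> /pass_inj/perm_inj->.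
- by move=> /negP nq' _ e; case: nq'; rewrite -e codom_f.
- by move=> _ /negP nq e; case: nq; rewrite e codom_f.
Qed.

Definition lift_perm n : {perm option C * 'I_3} := perm (@lift_inj n).

Lemma lift_pass n p : lift_perm n (pass p) = pass (n p).
Proof. by rewrite permE /lift_fun passK. Qed.

Lemma lift_out n q : q \notin codom pass -> lift_perm n q = q.
Proof.
rewrite permE /lift_fun; have := unpassP q; case: (unpass q) => // p ->.
by rewrite codom_f.
Qed.

Lemma lift_permM n m : lift_perm (n * m)%g = (lift_perm n * lift_perm m)%g.
Proof.
apply/permP => q; rewrite permM; case: (boolP (q \in codom pass)) => [/codomP[p ->]|qo].
  by rewrite !lift_pass permM.
by rewrite !lift_out.
Qed.

Lemma lift_perm1 : lift_perm 1%g = 1%g.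
Proof.
apply/permP => q; rewrite perm1; case: (boolP (q \in codom pass)) => [/codomP[p ->]|qo].
  by rewrite !lift_pass perm1.
by rewrite !lift_out.
Qed.

Lemma lift_permV n : lift_perm n^-1%g = ((lift_perm n)^-1)%g.
Proof. by apply/esym/mulg1_eq; rewrite -lift_permM mulgV lift_perm1. Qed.

Lemma lift_permJ n m : lift_perm (n ^ m)%g = (lift_perm n ^ lift_perm m)%g.
Proof. by rewrite /conjg !lift_permM lift_permV. Qed.

Lemma lift_tperm p q : lift_perm (tperm p q) = tperm (pass p) (pass q).
Proof.
apply/permP => x; case: (boolP (x \in codom pass)) => [/codomP[y ->]|xo].
  by rewrite lift_pass; apply: inj_tperm pass_inj.
rewrite lift_out // tpermD //; by apply: contraNneq xo => <-; rewrite codom_f.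
Qed.

Definition swap_fun (r : {set C}) (p : C * bool) := if p.1 \in r then (p.1, ~~ p.2) else p.

Lemma swap_inj r : injective (swap_fun r).
Proof.
apply: (can_inj (g := swap_fun r)) => -[x b]; rewrite /swap_fun /=.
by case e: (x \in r); rewrite /= e ?negbK.
Qed.

Definition swap_perm r : {perm C * bool} := perm (@swap_inj r).

Lemma swap_permE r p : swap_perm r p = if p.1 \in r then (p.1, ~~ p.2) else p.
Proof. by rewrite permE. Qed.

Lemma swap_permU (r t : {set C}) : [disjoint r & t] -> swap_perm (r :|: t) = (swap_perm r * swap_perm t)%g.
Proof.
move=> /disjointFr rt; apply/permP => -[x b]; rewrite permM !swap_permE !inE /=.
by case e: (x \in r) => //=; rewrite rt.
Qed.

End Lift.

Lemma card_edge (G : web) : #|edge G| = (3 * #|src G|)%N.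
Proof.
rewrite -sum1_card (partition_big (@tail G) predT) //= mulnC -sum_nat_const.
by apply: eq_bigr => v _; rewrite -(tail_trivalent v) -sum1_card; apply: eq_bigl => e; rewrite inE.
Qed.

Section State.
Variables (c : int) (ev : web -> int).
Hypothesis ev_functional : web_functional c ev.
Variables (D : diagram) (o : cr D -> bool).

Definition classical_set : {set cr D} := [set x | is_classical x].

Lemma smooth_nextE (s : {set cr D}) p :
  smooth_next s p = (next D * swap_perm (classical_set :\: s))%g p.
Proof. by rewrite permM swap_permE /smooth_next !inE; case: ifP. Qed.

(** Cutting a smoothed crossing does not require a change of the permutation, since
    the two arrivals at a sink may be exchanged.  Outside the web there remain the
    three points over [None] and the third points over the crossings not in [s]. *)
Lemma value_state (s : {set cr D}) : s \subset classical_set ->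
  (3%:R ^+ (3 + #|~: s|) * ev (state_web s)
   = 3%:R ^+ loops D * value ev (lift_perm o (next D * swap_perm classical_set)) (Some @: s))%R.
Proof.
move=> scl; pose n := (next D * swap_perm (classical_set :\: s))%g.
pose g := lift_perm o n; pose S := Some @: s.
have SE x : (Some x \in S) = (x \in s) by rewrite mem_imset //; apply: Some_inj.
have -> : value ev (lift_perm o (next D * swap_perm classical_set)) S = value ev g S.
  have -> : (next D * swap_perm classical_set)%g = (n * swap_perm s)%g.
    rewrite -mulgA -swap_permU; last by rewrite disjoint_sym disjoints_subset; apply/subsetP => x; rewrite !inE => ->.
    by congr (_ * swap_perm _)%g; rewrite setUC -{1}(setIidPr scl) setID.
  rewrite lift_permM; apply: (value_sink ev_functional).
  - move=> q; case: (boolP (q \in codom (pass o))) => [/codomP[[x b] ->]|qo]; last by rewrite lift_out.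
    by rewrite lift_pass swap_permE /=; case: ifP => xs; rewrite /over /= SE.
  - move=> q; case: (boolP (q \in codom (pass o))) => [/codomP[[x b] ->]|qo]; last by rewrite lift_out.
    by rewrite /over lift_pass SE swap_permE /= => /negPf->.
  - move=> v i _; have fst q : (lift_perm o (swap_perm s) q).1 = q.1; last by rewrite !fst.
    case: (boolP (q \in codom (pass o))) => [/codomP[[x b] ->]|qo]; last by rewrite lift_out.
    by rewrite lift_pass swap_permE; case: ifP.
pose Y1 (p : cr D * bool) := p.1 \in s.
have Yh p : over S (pass o p) = Y1 p by rewrite /over SE.
have hyp p : exists m, iter m.+1 g (pass o p) = pass o (smooth_next s p) /\
    forall j, (j < m)%N -> ~~ over S (iter j.+1 g (pass o p)) /\
      iter j.+1 g (pass o p) \notin codom (pass o).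
  by exists 0; split=> //; rewrite /= lift_pass smooth_nextE.
have sI := @smooth_next_inj D s.
have cc : closed_curves (state_join s) = cycles_avoiding (smooth_next s) Y1.
  exact: (closed_curvesE Y1 sI).
have out : cycles_avoiding g (predU (over S) [pred q | q \in codom (pass o)]) = (3 + #|~: s|)%N.
  pose f (x : 'I_3 + {y : cr D | y \notin s}) := match x with
    | inl i => (None, i) | inr y => (Some (val y), i2) end.
  have f_inj : injective f.
    by move=> [i|y] [j|z] //= => [[->]|[/val_inj->]].
  have cod2 x : (Some x, i2) \notin codom (pass o).
    by apply/negP => /codomP[p []] _; case: ifP.
  have codf q : (q \in codom f) = ~~ over S q && (q \notin codom (pass o)).
    apply/codomP/andP => [[[i|y] ->]|[]] /=.
    - split; first by rewrite /over /=; apply/negP => /imsetP[].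
      by apply/negP => /codomP[].
    - by rewrite /over /= SE (valP y).
    case: q => -[x|] i; last by exists (inl i).
    rewrite /over SE /= => xs nq; have iE : i = i2.
      apply/eqP; apply: contraNT nq => ni; apply/codomP.
      exists (x, if i == i0 then o x else ~~ o x); rewrite /pass /=.
      by case: i ni => -[|[|[|//]]] lt //= _; congr pair; case: (o x); apply: val_inj.
    by exists (inr (exist _ x xs)); rewrite iE.
  transitivity #|codom f|.
    rewrite /cycles_avoiding.
    have eO : orbit_avoids g (predU (over S) [pred q | q \in codom (pass o)]) =i codom f.
      move=> q; rewrite codf; apply/orbit_avoidsP/andP => [/(_ 0)|[qS qo] j].
        by rewrite /= negb_or => /andP.
      have -> : iter j g q = q by elim: j => //= j ->; apply: lift_out.
      by rewrite /= negb_or qS.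
    rewrite (eq_n_comp_r eO) fcard_fixed // => q; rewrite codf => /andP[_ qo].
    exact: lift_out.
  rewrite card_codom // card_sum card_ord card_sub; congr (_ + _)%N.
  by apply: eq_card => x; rewrite !inE.
have {}out : cycles_avoiding g (over S) = (closed_curves (state_join s) + (3 + #|~: s|))%N.
  by rewrite cc (contract_cycles (@pass_inj _ o) sI (@perm_inj _ g) Yh hyp) out.
rewrite /value out (ev_pweb_circle ev_functional) mulrCA; congr (_ * _)%R.
rewrite -(ev_pweb_circle ev_functional); apply: (functional_iso ev_functional).
have SM (x : {x | x \in s}) : Some (val x) \in S by rewrite SE (valP x).
pose a (x : {x | x \in s}) : pweb_vertex S := exist _ (Some (val x)) (SM x).
have PM (p : {p : cr D * bool | p.1 \in s}) : over S (pass o (val p)).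
  by rewrite Yh; apply: (valP p).
pose e (x : state_edge s) : pweb_edge S := match x with
  | inl p => exist _ (pass o (val p)) (PM p)
  | inr y => exist _ (Some (val y), i2) (SM y) end.
have aI : injective a by move=> x y /(congr1 val) [/val_inj].
have eI : injective e.
  move=> [p|x] [q|y] /(congr1 val) /=; first by move/pass_inj/val_inj->.
  - by case=> _; case: ifP.
  - by case=> _; case: ifP.
  - by case=> /val_inj->.
have cV : #|{: pweb_vertex S}| = #|{: {x | x \in s}}|.
  by rewrite !card_sub; apply: card_imset Some_inj.
have aB : bijective a by apply: inj_card_bij; rewrite ?cV.
exists a, a, e; split; split.
- exact: aB.
- exact: aB.
- apply: inj_card_bij => //; rewrite (card_edge (state_web s)) (card_edge (pweb g S 0)).
  by rewrite cV.
- by case=> [p|x]; apply: val_inj.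
- case=> [p|x]; apply: val_inj => /=.
    rewrite /arrive -(contract_last sI (@perm_inj _ g) Yh hyp (valP p)) /=.
    by congr (Some _.1); apply: smooth_next_last; apply: (valP p).
  have gx : g (Some (val x), i2) = (Some (val x), i2).
    by apply: lift_out; apply/negP => /codomP[p []] _; case: ifP.
  by rewrite /arrive (@return_last _ g (over S) (@perm_inj _ g) 0) //= gx // /over /= SE (valP x).
- by rewrite addnC.
Qed.

End State.

(** * Erasing virtual crossings *)

Section Twist.
Variables (D E : diagram) (X : {set cr D}) (h : cr E -> cr D) (tw : cr E -> bool).

(** Between two virtual crossings the passages of a crossing are exchanged. *)
Definition twist (p : cr E * bool) : cr D * bool := (h p.1, p.2 (+) tw p.1).

Definition erase_step (p : cr D * bool) :=
  if (next D p).1 \in X then Some (next D p) else None.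

Definition twisted_erasure : Prop :=
  [/\ injective h, forall x, (x \in codom h) = (x \notin X),
      forall p, next D (last_edge erase_step (twist p)) = twist (next E p)
    & loops E = (loops D + closed_curves erase_step)%N].

Hypothesis erasure : twisted_erasure.
Hypothesis X_virtual : forall x, x \in X -> ~~ is_classical x.
Hypothesis h_classical : forall x, is_classical (h x) = is_classical x.

Let h_inj : injective h. Proof. by case: erasure. Qed.
Let codom_h x : (x \in codom h) = (x \notin X). Proof. by case: erasure. Qed.

Let twist_inj : injective twist.
Proof. by move=> [x b] [y d] [/h_inj -> /addIb ->]. Qed.

Let codom_twist q : (q \in codom twist) = (q.1 \notin X).
Proof.
rewrite -codom_h; apply/codomP/codomP => [[p ->]|[x qx]]; first by exists p.1.
by exists (x, q.2 (+) tw x); rewrite /twist /= -addbA addbb addbF -qx -surjective_pairing.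
Qed.

Let erase_stepE : erase_step =1 return_step (next D) (fun q => q.1 \notin X).
Proof. by move=> p; rewrite /erase_step /return_step; case: (_ \in X). Qed.

Let erasure_run p : exists m, iter m.+1 (next D) (twist p) = twist (next E p) /\
  forall j, (j < m)%N -> (iter j.+1 (next D) (twist p)).1 \in X.
Proof.
have [] := @return_ex _ (next D) (fun q => q.1 \notin X) (@perm_inj _ _) (twist p).
  by rewrite negbK; apply/existsP; exists (twist p); rewrite connect0 -codom_twist codom_f.
move=> m [mX lt]; exists m; split; last by move=> j /lt /negbNE.
case: erasure => _ _ <- _; rewrite (eq_last_edge erase_stepE).
by rewrite (return_last (@perm_inj _ _) mX lt) -iterS.
Qed.

Section ErasureState.
Variable s : {set cr E}.
Let Y1 (p : cr E * bool) := p.1 \in s.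
Let Y2 (q : cr D * bool) := q.1 \in h @: s.
Let g1 := smooth_next s.
Let g2 := smooth_next (h @: s).

Let Yh p : Y2 (twist p) = Y1 p.
Proof. by rewrite /Y2 /Y1 /= mem_imset. Qed.

Let g2X p : (next D p).1 \in X -> g2 p = next D p.
Proof. by move=> pX; rewrite /g2 /smooth_next (negPf (X_virtual pX)) andbF. Qed.

Let nY2 q : q.1 \in X -> ~~ Y2 q.
Proof.
by apply: contraL => /imsetP[x _ ->]; rewrite -codom_h codom_f.
Qed.

Let run p : exists m, iter m.+1 g2 (twist p) = twist (g1 p) /\
  forall j, (j < m)%N -> ~~ Y2 (iter j.+1 g2 (twist p)) /\
    iter j.+1 g2 (twist p) \notin codom twist.
Proof.
have [m [mE lt]] := erasure_run p; exists m.
have same j : (j <= m)%N -> iter j g2 (twist p) = iter j (next D) (twist p).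
  elim: j => // j IHj jm; rewrite iterS IHj 1?ltnW // g2X -?iterS //; exact: lt.
split=> [|j jm].
  rewrite iterS same // /g2 /smooth_next -iterS mE /= mem_imset // h_classical.
  by rewrite /g1 /smooth_next; case: ifP => _ //; rewrite /twist /= addNb.
by rewrite same // codom_twist nY2 ?lt.
Qed.

(** Virtual crossings are passed straight through, so the walk in [D] agrees with the
    erasing walk until it reaches a crossing of [E], where both are smoothed alike. *)
Lemma erasure_state_iso : web_iso (state_web s) (state_web (h @: s)).
Proof.
have s1I := @smooth_next_inj E s; have s2I := @smooth_next_inj D (h @: s).
have SM (x : {x | x \in s}) : h (val x) \in h @: s by rewrite mem_imset // (valP x).
have PM (p : {p : cr E * bool | p.1 \in s}) : Y2 (twist (val p)) by rewrite Yh; apply: (valP p).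
pose a (x : {x | x \in s}) : {y | y \in h @: s} := exist _ (h (val x)) (SM x).
pose e (x : state_edge s) : state_edge (h @: s) := match x with
  | inl p => inl (exist _ (twist (val p)) (PM p)) | inr y => inr (a y) end.
have aI : injective a by move=> x y /(congr1 val) /h_inj/val_inj.
have eI : injective e.
  move=> [p|x] [q|y] // exy; last first.
    have := congr1 (fun z : state_edge (h @: s) => if z is inr r then val r else h (val x)) exy.
    by move=> /= /h_inj/val_inj->.
  have := congr1 (fun z : state_edge (h @: s) => if z is inl r then val r else twist (val p)) exy.
  by move=> /= /twist_inj/val_inj->.
have cV : #|{: {x | x \in h @: s}}| = #|{: {x | x \in s}}|.
  by rewrite !card_sub; apply: card_imset h_inj.
have aB : bijective a by apply: inj_card_bij; rewrite ?cV.
exists a, a, e; split; split.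
- exact: aB.
- exact: aB.
- apply: inj_card_bij => //.
  by rewrite (card_edge (state_web s)) (card_edge (state_web (h @: s))) cV.
- by case=> [p|x]; apply: val_inj.
- case=> [p|x]; apply: val_inj => //=.
  have := contract_last s1I s2I Yh run (valP p); rewrite /g1 /g2.
  rewrite (smooth_next_last (valP p)) (smooth_next_last (PM p)).
  by move=> /(congr1 fst) /= <-.
have cE : cycles_avoiding g2 (predU Y2 [pred q | q \in codom twist]) = closed_curves erase_step.
  rewrite (eq_closed_curves erase_stepE) closed_curvesE; last exact: perm_inj.
  have YE : predU Y2 [pred q | q \in codom twist] =1 (fun q => q.1 \notin X).
    move=> q /=; rewrite codom_twist orb_idl // => Yq.
    by apply/negP => /nY2 /negP; apply.
  rewrite (@eq_cycles_avoiding _ g2 g2 _ _ (frefl _) YE).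
  rewrite -!closed_curvesE //; last exact: perm_inj.
  have fstE q : (g2 q).1 = (next D q).1 by rewrite /g2 /smooth_next; case: ifP.
  apply: eq_closed_curves => q; rewrite /return_step fstE.
  by case: ifP => // /negbFE/g2X->.
rewrite /=; case: erasure => _ _ _ ->.
rewrite (closed_curvesE Y2 s2I) (contract_cycles twist_inj s1I s2I Yh run).
by rewrite -/g2 cE (closed_curvesE Y1 s1I) -!addnA (addnC (closed_curves _)).
Qed.

End ErasureState.

End Twist.

(** The specialized bracket: at A = c the weight of a state is a power of - c. *)
Definition bracket_value (c : int) (ev : web -> int) (F : diagram) : int :=
  (\sum_(s : {set cr F} | s \subset classical_set F) (- c) ^+ #|s| * ev (state_web s))%R.

Lemma bracket_value_erasure (c : int) ev (D E : diagram) (X : {set cr D}) h tw :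
  web_functional c ev -> @twisted_erasure D E X h tw ->
  (forall x, x \in X -> ~~ is_classical x) ->
  (forall x, is_classical (h x) = is_classical x) ->
  bracket_value c ev D = bracket_value c ev E.
Proof.
move=> evF er Xv hc; have [h_inj codh _ _] := er.
rewrite /bracket_value (reindex_onto (fun s : {set cr E} => h @: s) (fun t => h @^-1: t)).
  apply: eq_big => [s|s _].
    have -> : h @^-1: (h @: s) = s by apply/setP => x; rewrite inE mem_imset.
    rewrite eqxx andbT; apply/subsetP/subsetP => sub x.
      by move=> xs; have := sub (h x); rewrite mem_imset // !inE hc => ->.
    by move=> /imsetP[y ys ->]; have := sub y ys; rewrite !inE hc.
  rewrite card_imset //; congr (_ * _)%R.
  by apply/esym/(functional_iso evF)/(erasure_state_iso er Xv hc).
move=> s /subsetP scl; apply/setP => x; apply/imsetP/idP => [[y] + ->|xs]; first by rewrite inE.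
have /codomP[y xy] : x \in codom h.
  by rewrite codh; apply/negP => /Xv; have := scl _ xs; rewrite inE => ->.
by exists y => //; rewrite inE -xy.
Qed.

(** * Moves that preserve every state web *)

Lemma erases_twisted (D E : diagram) (X : {set cr D}) : erases X E ->
  exists2 h : cr E -> cr D, twisted_erasure X h (fun _ => false) & forall x, kind (h x) = kind x.
Proof.
move=> [h [hI hX hk hn hl]]; exists h => //.
have tE p : twist h (fun _ => false) p = (h p.1, p.2) by rewrite /twist addbF.
by split=> // p; rewrite !tE; apply: hn.
Qed.

Section SameShape.
Variables (D E : diagram) (h : cr E -> cr D) (tw : cr E -> bool).

Lemma twisted_erasure0 : bijective h ->
  (forall p, next D (twist h tw p) = twist h tw (next E p)) -> loops E = loops D ->
  twisted_erasure set0 h tw.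
Proof.
move=> hB hn hl.
have stepE p : erase_step set0 p = None :> option (cr D * bool) by rewrite /erase_step inE.
split=> [|x|p|]; first exact: bij_inj.
- by rewrite inE; have [h' _ h'K] := hB; rewrite -(h'K x) codom_f.
- by rewrite -hn; congr (next D _); rewrite /last_edge; elim: #|_| => //= n ->;
    rewrite /follow stepE.
- rewrite hl; suff -> : closed_curves (erase_step (D := D) set0) = 0%N by rewrite addn0.
  rewrite /closed_curves; have -> : [set e | erase_step set0 (last_edge (erase_step set0) e) != None]
      = set0 :> {set cr D * bool}.
    by apply/setP => e; rewrite !inE stepE eqxx.
  by rewrite imset0 cards0.
Qed.

End SameShape.

(** Making crossings virtual has the effect of erasing them, but keeps the type of
    crossings; so the two sides of a move can be compared over the same points. *)
Definition make_virtual (D : diagram) (X : {set cr D}) : diagram :=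
  @Diagram (cr D) (fun x => if x \in X then Virtual else kind x) (next D) (loops D).

Section Moves.
Variables (c : int) (ev : web -> int).
Hypothesis ev_functional : web_functional c ev.
Local Notation B := (bracket_value c ev).

Lemma bracket_iso (D E : diagram) : diagram_iso D E -> B D = B E.
Proof.
move=> [h [hB hk hn hl]]; apply/esym.
apply: (@bracket_value_erasure c ev E D set0 h (fun _ => false)) => //.
- by apply: twisted_erasure0 => // p; rewrite /twist !addbF.
- by move=> x; rewrite inE.
- by move=> x; rewrite /is_classical hk.
Qed.

Lemma bracket_erase_virtual (D E : diagram) (X : {set cr D}) :
  (forall x, x \in X -> ~~ is_classical x) -> erases X E -> B D = B E.
Proof.
move=> Xv /erases_twisted[h er hk]; apply: (bracket_value_erasure ev_functional er Xv).
by move=> x; rewrite /is_classical hk.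
Qed.

Lemma bracket_detour (D E : diagram) : detour D E -> B D = B E.
Proof.
by move=> [F [DF EF]]; transitivity (B F); [|apply/esym];
  apply: bracket_erase_virtual; try eassumption; move=> x; rewrite inE.
Qed.

Lemma bracket_make_virtual (D E : diagram) (X : {set cr D}) : erases X E ->
  B (make_virtual X) = B E.
Proof.
move=> /erases_twisted[h [hI hX hn hl] hk].
apply: (@bracket_value_erasure c ev (make_virtual X) E X h (fun _ => false)) => //.
  by move=> x; rewrite /is_classical /= => ->.
by move=> x; rewrite /is_classical /= -hk; have := hX (h x); rewrite codom_f; case: (_ \in X).
Qed.

Lemma bracket_switch (D E : diagram) : crossing_switch D E -> B D = B E.
Proof.
move=> [x [b [xb iso]]]; rewrite -(bracket_iso iso); set D' := Diagram _ _ _.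
apply: (@bracket_value_erasure c ev D D' set0 id (fun _ => false)) => //.
- by apply: twisted_erasure0 => // [|p]; [exists id|rewrite /twist !addbF -!surjective_pairing].
- by move=> y; rewrite inE.
- by move=> y; rewrite /is_classical /=; case: eqP => // ->; rewrite xb.
Qed.

Lemma bracket_virtualization (D E : diagram) : virtualization D E -> B D = B E.
Proof.
move=> [x [h [v [w [xcl [hI vw hX] [kv kw hk] [nv nh nw nE] hl]]]]]; apply/esym.
pose enter (p : cr D * bool) := (if p.1 == x then v else h p.1, p.2).
have {}nw i : next E (w, i) = enter (next D (x, i)) := nw i.
have {}nE p : p.1 != x -> next E (h p.1, p.2) = enter (next D p) := nE p.
pose tw y := y == x; pose X := [set v; w].
have tE p : twist h tw p = (h p.1, p.2 (+) (p.1 == x)) by [].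
have nX y : h y \notin X by rewrite -hX codom_f.
have hvF y : (h y == v) = false by apply: contraNF (nX y) => /eqP->; rewrite !inE eqxx.
have hwF y : (h y == w) = false by apply: contraNF (nX y) => /eqP->; rewrite !inE eqxx orbT.
have runs p : exists m, iter m.+1 (next E) (twist h tw p) = twist h tw (next D p) /\
    forall j, (j < m)%N -> (iter j.+1 (next E) (twist h tw p)).1 \in X.
  have enterP q : exists m, iter m (next E) (enter q) = twist h tw q /\
      forall j, (j < m)%N -> (iter j (next E) (enter q)).1 \in X.
    rewrite tE /enter; case: (eqVneq q.1 x) => [->|qx]; last by exists 0; rewrite addbF.
    exists 1; rewrite /= nv addbT; split=> // -[|//] _ /=.
    by rewrite !inE eqxx.
  have [m [mE lt]] := enterP (next D p).
  case: (eqVneq p.1 x) => px.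
    have pE : next E (next E (twist h tw p)) = enter (next D p).
      by rewrite tE px eqxx addbT nh negbK nw -px -surjective_pairing.
    have pE1 : (next E (twist h tw p)).1 = w by rewrite tE px eqxx addbT nh.
    exists m.+1; split=> [|[|j] jm]; first by rewrite !iterSr pE.
      by rewrite /= pE1 !inE eqxx orbT.
    by rewrite !iterSr pE; apply: lt.
  have pE : next E (twist h tw p) = enter (next D p).
    by rewrite tE (negPf px) addbF nE.
  by exists m; split=> [|j jm]; rewrite iterSr pE //; apply: lt.
have stepE : @erase_step E X =1 return_step (next E) (fun q => q.1 \notin X).
  by move=> p; rewrite /erase_step /return_step; case: (_ \in X).
apply: (@bracket_value_erasure c ev E D X h tw) => //.
- split=> //.
  + move=> p; have [m [mE lt]] := runs p.
    rewrite (eq_last_edge stepE) (@return_last _ _ _ (@perm_inj _ _) m) -?iterS //.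
      by rewrite mE tE nX.
    by move=> j jm; rewrite negbK; apply: lt.
  + rewrite hl (eq_closed_curves stepE) closed_curvesE; last exact: perm_inj.
    suff -> : cycles_avoiding (next E) (fun q => q.1 \notin X) = 0%N by rewrite addn0.
    apply/eq_card0 => q; rewrite !inE; apply/negP => /andP[_ /orbit_avoidsP av].
    have := av 0; rewrite negbK !inE /= => /orP[]/eqP qX.
      by have := av 1; rewrite negbK /= (surjective_pairing q) qX nv !inE hvF hwF.
    case: (eqVneq (next D (x, q.2)).1 x) => [nx|nx].
      have := av 2; rewrite negbK /= (surjective_pairing q) qX nw /enter nx eqxx nv.
      by rewrite !inE hvF hwF.
    have := av 1; rewrite negbK /= (surjective_pairing q) qX nw /enter (negPf nx).
    by rewrite !inE hvF hwF.
- by move=> y; rewrite !inE => /orP[]/eqP->; rewrite /is_classical ?kv ?kw.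
- by move=> y; rewrite /is_classical hk.
Qed.

End Moves.

(** * A calculus of local tangles *)

(** A permutation of local points is given by a list of transpositions of their
    numbers, performed from left to right.  The points 0, 1 and 2 are anchors, through
    which the strands leave the tangle; [3 * a], [3 * a + 1], [3 * a + 2] are the points
    over the local vertex number [a]. *)
Definition swaps := seq (nat * nat).

Definition swap_image (l : swaps) (k : nat) : nat :=
  foldl (fun k t => if k == t.1 then t.2 else if k == t.2 then t.1 else k) k l.

(** Taking the point [k] out of its walk, and counting the circles so created. *)
Definition loosen_step (lm : swaps * nat) (k : nat) : swaps * nat :=
  if swap_image lm.1 k == k then lm else (rcons lm.1 (k, swap_image lm.1 k), lm.2.+1).

Definition loose_points (N : nat) (t : seq nat) : seq nat :=
  [seq k <- iota 3 (N - 3) | k %/ 3 \notin t].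

Definition loosen (N : nat) (t : seq nat) (l : swaps) : swaps * nat :=
  foldl loosen_step (l, 0) (loose_points N t).

Definition within (N : nat) (l : swaps) : bool :=
  all (fun t => (t.1 < N) && (t.2 < N)) l.

Definition inner (N : nat) (l : swaps) : bool :=
  all (fun t => (3 <= t.1 < N) && (3 <= t.2 < N)) l.

(** Points over the vertices in [t] are sent to points over the vertices in [t'],
    compatibly with the vertices. *)
Definition fibre_map (N : nat) (h : swaps) (t t' : seq nat) : bool :=
  all (fun k => ((swap_image h k %/ 3 \in t') == (k %/ 3 \in t)) &&
    ((k %/ 3 \in t) ==> (swap_image h k %/ 3 == swap_image h (3 * (k %/ 3)) %/ 3))) (iota 0 N).

(** After all uncut points have been loosened, a tangle is determined by its strands,
    and [h] is an isomorphism from the first tangle to the second. *)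
Definition same_tangle (N : nat) (h : swaps) (l : swaps) (t : seq nat)
    (l' : swaps) (t' : seq nat) : bool :=
  let f := (loosen N t l).1 in let f' := (loosen N t' l').1 in
  [&& inner N h, fibre_map N h t t' &
      all (fun k => swap_image (rev h ++ f ++ h) k == swap_image f' k) (iota 0 N)].

Definition cut_swaps (N : nat) (p : swaps) (t : seq nat) : bool :=
  [&& within N p, fibre_map N p t t &
     all (fun k => (k %/ 3 \in t) || (swap_image p k == k)) (iota 0 N)].

(** The pairs [(p, a)] of [l] are the last local points of the strands with their
    anchors, according to [m]. *)
Fixpoint anchored (N : nat) (l m : swaps) : bool :=
  if l is (p, a) :: l' then
    [&& 3 <= p < N, a < 3, swap_image l' p == p, swap_image m p == a & anchored N l' m]
  else true.

Section Tangle.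
Variables (c : int) (ev : web -> int).
Hypothesis ev_functional : web_functional c ev.
Variables (V : finType) (v0 : V) (nodes : seq V) (S0 : {set V}).
Hypothesis uniq_nodes : uniq nodes.
Hypothesis nodes_S0 : forall v, v \in nodes -> v \notin S0.

Local Notation N := (3 * size nodes).

(** The first node is reserved for the anchors. *)
Definition point (k : nat) : V * 'I_3 :=
  (nth v0 nodes (k %/ 3), nth i0 [:: i0; i1; i2] (k %% 3)).

Definition list_perm (l : swaps) : {perm V * 'I_3} :=
  foldr (fun t g => tperm (point t.1) (point t.2) * g)%g 1%g l.

Definition cut (t : seq nat) : {set V} :=
  [set v | (v \in S0) || (v \in [seq nth v0 nodes a | a <- t])].

Lemma point_div k : k < N -> k %/ 3 < size nodes.
Proof. by move=> kN; rewrite ltn_divLR // mulnC. Qed.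

Lemma point_inj k k' : k < N -> k' < N -> (point k == point k') = (k == k').
Proof.
move=> kN kN'; apply/eqP/eqP => [[/eqP e1 e2]|->//].
rewrite nth_uniq ?point_div // in e1.
rewrite (divn_eq k 3) (divn_eq k' 3) (eqP e1); congr (_ + _)%N.
have := ltn_pmod k (isT : 0 < 3); have := ltn_pmod k' (isT : 0 < 3).
by move: e2; case: (k %% 3) => [|[|[|//]]]; case: (k' %% 3) => [|[|[|//]]].
Qed.

Lemma swap_image_lt l k : within N l -> k < N -> swap_image l k < N.
Proof.
elim: l k => //= t l IHl k /andP[/andP[t1 t2] lN] kN; apply: IHl => //.
by case: ifP => // _; case: ifP.
Qed.

Lemma list_perm_point l k : within N l -> k < N -> list_perm l (point k) = point (swap_image l k).
Proof.
elim: l k => [|t l IHl] k /=; first by rewrite perm1.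
move=> /andP[/andP[t1 t2] lN] kN; rewrite permM -IHl //; last first.
  by case: ifP => // _; case: ifP.
congr (list_perm l _); rewrite permE /= !point_inj //.
by case: ifP => // _; case: ifP.
Qed.

Lemma list_perm_out l q : within N l -> (forall k, k < N -> q != point k) -> list_perm l q = q.
Proof.
move=> + qk; elim: l => [|t l IHl] /=; first by rewrite perm1.
by move=> /andP[/andP[t1 t2] lN]; rewrite permM tpermD ?IHl // eq_sym qk.
Qed.

Lemma pointP q : (exists2 k, k < N & q = point k) \/ (forall k, k < N -> q != point k).
Proof.
case: (boolP [exists k : 'I_N, q == point k]) => [/existsP[k /eqP ->]|/existsPn nk].
  by left; exists k.
by right => k kN; apply: (nk (Ordinal kN)).
Qed.

Lemma eq_list_perm l l' : within N l -> within N l' ->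
  all (fun k => swap_image l k == swap_image l' k) (iota 0 N) -> list_perm l = list_perm l'.
Proof.
move=> lN lN' /allP eqa; apply/permP => q; case: (pointP q) => [[k kN ->]|qk].
  rewrite !list_perm_point //; congr point; apply/eqP/eqa.
  by rewrite mem_iota.
by rewrite !list_perm_out.
Qed.

Lemma list_perm_cat l l' : list_perm (l ++ l') = (list_perm l * list_perm l')%g.
Proof. by elim: l => [|t l IHl] /=; rewrite ?mul1g // IHl mulgA. Qed.

Lemma list_perm_rcons l p q : list_perm (rcons l (p, q)) = (list_perm l * tperm (point p) (point q))%g.
Proof. by rewrite -cats1 list_perm_cat /= mulg1. Qed.

Lemma list_perm_rev l : list_perm (rev l) = (list_perm l)^-1%g.
Proof.
elim: l => [|[p q] l IHl] /=; first by rewrite invg1.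
by rewrite rev_cons list_perm_rcons IHl invMg tpermV.
Qed.

Lemma inner_within l : inner N l -> within N l.
Proof. by apply: sub_all => t /andP[/andP[_ ->] /andP[_ ->]]. Qed.

Lemma within_cat l l' : within N (l ++ l') = within N l && within N l'.
Proof. exact: all_cat. Qed.

Lemma within_rev l : within N (rev l) = within N l.
Proof. exact: all_rev. Qed.

Lemma over_point t k : all (fun a => a < size nodes) t -> k < N ->
  over (cut t) (point k) = (k %/ 3 \in t).
Proof.
move=> /allP tN kN; rewrite /over inE (negPf (nodes_S0 _)) ?mem_nth ?point_div //=.
apply/mapP/idP => [[a at_] /eqP|kt]; last by exists (k %/ 3).
by rewrite nth_uniq ?point_div ?tN // => /eqP->.
Qed.

Lemma fibre_point v i t : v \in cut t -> v \notin S0 -> all (fun a => a < size nodes) t ->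
  exists2 k, (k < N) && (k %/ 3 \in t) & (v, i) = point k /\ (v, ord0) = point (3 * (k %/ 3)).
Proof.
rewrite inE => + vS /allP tN; rewrite (negPf vS) => /mapP[a at_ ->].
have aN := tN _ at_.
have iE : i = nth i0 [:: i0; i1; i2] i by apply: val_inj; case: i => -[|[|[|]]].
have kE : (3 * a + i) %/ 3 = a by rewrite mulnC divnMDl // divn_small ?addn0.
exists (3 * a + i).
  by rewrite kE at_ andbT; have := ltn_ord i; lia.
rewrite kE /point kE mulKn // modnMr; split; last by congr pair; apply: val_inj.
by rewrite [in LHS]iE mulnC modnMDl modn_small.
Qed.

Lemma over_swaps h t t' q : within N h -> all (fun a => a < size nodes) t ->
  all (fun a => a < size nodes) t' -> fibre_map N h t t' ->
  over (cut t') (list_perm h q) = over (cut t) q.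
Proof.
move=> hN tN tN' /allP fm; case: (pointP q) => [[k kN ->]|qk].
  rewrite list_perm_point // !over_point ?swap_image_lt //.
  by have := fm k; rewrite mem_iota /= add0n kN => /(_ isT) /andP[/eqP].
rewrite list_perm_out // /over !inE; congr (_ || _).
have nN s : all (fun a => a < size nodes) s -> q.1 \notin [seq nth v0 nodes a | a <- s].
  move=> /allP sN; apply/negP => /mapP[a /sN aN qa].
  have := ltn_ord q.2 => q2.
  have := qk (3 * a + q.2); rewrite /point mulnC divnMDl // divn_small // addn0 -qa.
  rewrite modnMDl modn_small //; have -> : nth i0 [:: i0; i1; i2] q.2 = q.2.
    by apply: val_inj; case: (q.2) => -[|[|[|]]].
  rewrite -surjective_pairing eqxx => /(_ _)/negP; case=> //; lia.
by rewrite (negPf (nN _ tN)) (negPf (nN _ tN')).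
Qed.

Lemma fibre_swaps h t t' v i : within N h -> all (fun a => a < size nodes) t ->
  fibre_map N h t t' ->
  v \in cut t -> (list_perm h (v, i)).1 = (list_perm h (v, ord0)).1.
Proof.
move=> hN tN /allP fm vt; case: (boolP (v \in S0)) => [vS|vS].
  have out j : forall k, k < N -> (v, j) != point k.
    move=> k kN; apply: contraL vS => /eqP[-> _]; apply: nodes_S0.
    by rewrite mem_nth ?point_div.
  by rewrite !list_perm_out //; apply: out.
have [k /andP[kN kt] [-> ->]] := fibre_point i vt vS tN.
have := fm k; rewrite mem_iota /= add0n kN => /(_ isT) /andP[_ /implyP/(_ kt)/eqP e].
rewrite !list_perm_point //; last by rewrite mulnC; apply: leq_ltn_trans kN; apply: leq_divM.
by rewrite /point /= e.
Qed.

Section Base.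
Variable b : {perm V * 'I_3}.
Hypothesis b_inner : forall k, 3 <= k < N -> b (point k) = point k.

Definition tangle (l : swaps) (t : seq nat) : int := value ev (b * list_perm l)%g (cut t).

Lemma base_point l k : within N l -> 3 <= k < N -> (b * list_perm l)%g (point k) = point (swap_image l k).
Proof.
by move=> lN kN; rewrite permM b_inner // list_perm_point //; case/andP: kN.
Qed.

Lemma tangle_loosen_step t l k : all (fun a => a < size nodes) t -> within N l ->
  3 <= k < N -> k %/ 3 \notin t -> swap_image l k != k ->
  tangle (rcons l (k, swap_image l k)) t = (3%:R * tangle l t)%R.
Proof.
move=> tN lN kN kt nk; have /andP[_ kN'] := kN.
have gk := base_point lN kN.
rewrite /tangle list_perm_rcons mulgA -gk; apply: (value_loosen ev_functional).
  by rewrite gk point_inj // swap_image_lt.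
by rewrite over_point.
Qed.

Lemma tangle_loosen t l : all (fun a => a < size nodes) t -> within N l ->
  within N (loosen N t l).1 /\ tangle (loosen N t l).1 t = (3%:R ^+ (loosen N t l).2 * tangle l t)%R.
Proof.
move=> tN; rewrite /loosen.
have : all (fun k => (3 <= k < N) && (k %/ 3 \notin t)) (loose_points N t).
  rewrite all_filter; apply/allP => k; rewrite mem_iota => /andP[k3 kN]; apply/implyP => ->.
  by rewrite k3 andbT /=; lia.
move: (loose_points N t) => ks al.
suff gen m l' : within N l' ->
    within N (foldl loosen_step (l', m) ks).1 /\
    (3%:R ^+ m * tangle (foldl loosen_step (l', m) ks).1 t =
      3%:R ^+ (foldl loosen_step (l', m) ks).2 * tangle l' t)%R.
  move=> lN; have [w e] := gen 0 l lN; split=> //.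
  by rewrite -e expr0 mul1r.
elim: ks al m l' => [|k ks IHks] al m l' lN; first by split.
have /andP[/andP[kN kt] {}al] := al.
rewrite -![foldl loosen_step (l', m) (k :: ks)]/(foldl loosen_step (loosen_step (l', m) k) ks).
have -> : loosen_step (l', m) k =
  if swap_image l' k == k then (l', m) else (rcons l' (k, swap_image l' k), m.+1) by [].
case: eqP => [_|/eqP nk]; first exact: IHks.
have lN' : within N (rcons l' (k, swap_image l' k)).
  by rewrite /within all_rcons /= swap_image_lt ?andbT //; case/andP: kN => _ ->.
have [w e] := IHks al m.+1 (rcons l' (k, swap_image l' k)) lN'; split; first exact: w.
have n3 : (3%:R : int)%R != 0%R by [].
have st := tangle_loosen_step tN lN kN kt nk.
move: e; rewrite st exprS -mulrA [RHS]mulrCA => e; exact: (mulfI n3 e).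
Qed.

Lemma swap_image_inner h k : inner N h -> 3 <= k < N -> 3 <= swap_image h k < N.
Proof.
elim: h k => //= t h IHh k /andP[/andP[t1 t2] hN] kN; apply: IHh => //.
by case: ifP => // _; case: ifP.
Qed.

Lemma inner_out h q : inner N h -> (forall k, 3 <= k < N -> q != point k) -> list_perm h q = q.
Proof.
move=> + qk; elim: h => [|t h IHh] /=; first by rewrite perm1.
by move=> /andP[/andP[t1 t2] hN]; rewrite permM tpermD ?IHh // eq_sym qk.
Qed.

(** [b] moves no local point other than the anchors, [h] moves only such points. *)
Lemma base_conj h : inner N h -> (b ^ list_perm h)%g = b.
Proof.
move=> hN; have hw := inner_within hN.
rewrite conjgE; apply/permP => q; rewrite -(permKV (list_perm h) q); move: ((list_perm h)^-1%g q) => r.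
rewrite !permM permK; case: (boolP [exists k : 'I_N, (3 <= k) && (r == point k)]).
  move=> /existsP[k /andP[k3 /eqP->]]; have kN : 3 <= k < N by rewrite k3 /=.
  by rewrite b_inner // list_perm_point // b_inner // swap_image_inner.
move=> /existsPn nk; have out k : 3 <= k < N -> r != point k.
  by move=> /andP[k3 kN]; have := nk (Ordinal kN); rewrite /= k3.
rewrite !inner_out // => k kN; apply: contra (out k kN) => /eqP e.
by rewrite -(inj_eq (@perm_inj _ b)) e b_inner.
Qed.

Lemma conj_anchored h la m : inner N h ->
  ((list_perm la * (b * list_perm m)) ^ list_perm h
   = list_perm (rev h ++ la ++ h) * (b * list_perm (rev h ++ m ++ h)))%g.
Proof.
move=> /base_conj; rewrite !list_perm_cat list_perm_rev.
move: (list_perm h) (list_perm la) (list_perm m) => x y z bx.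
by rewrite !conjMg bx !conjgE.
Qed.

(** The exterior [b] is unaffected by a renaming of the local points; this makes
    isomorphisms of tangles independent of the way the strands are connected outside. *)
Lemma tangle_conj h l t t' : inner N h -> all (fun a => a < size nodes) t ->
  all (fun a => a < size nodes) t' -> fibre_map N h t t' ->
  tangle (rev h ++ l ++ h) t' = tangle l t.
Proof.
move=> hN tN tN' fm; have hw := inner_within hN; rewrite /tangle.
have -> : (b * list_perm (rev h ++ l ++ h) = (b * list_perm l) ^ list_perm h)%g.
  by rewrite conjMg base_conj // !list_perm_cat list_perm_rev conjgE.
apply: (value_conj ev_functional) => [p|v i vt]; first exact: over_swaps.
exact: (fibre_swaps _ hw tN fm vt).
Qed.

Lemma tangle_eq l l' t : within N l -> within N l' ->
  all (fun k => swap_image l k == swap_image l' k) (iota 0 N) -> tangle l t = tangle l' t.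
Proof. by move=> lN lN' e; rewrite /tangle (eq_list_perm lN lN' e). Qed.

Lemma tangle_same h l t l' t' : within N l -> within N l' ->
  all (fun a => a < size nodes) t -> all (fun a => a < size nodes) t' ->
  same_tangle N h l t l' t' ->
  (3%:R ^+ (loosen N t l).2 * tangle l t = 3%:R ^+ (loosen N t' l').2 * tangle l' t')%R.
Proof.
move=> lN lN' tN tN'; rewrite /same_tangle => /and3P[hN fm e].
have hw := inner_within hN.
have [fN <-] := tangle_loosen tN lN; have [fN' <-] := tangle_loosen tN' lN'.
rewrite -(tangle_conj (loosen N t l).1 hN tN tN' fm); apply: tangle_eq => //.
by rewrite !within_cat within_rev hw fN.
Qed.

Lemma tangle_sink p l t : all (fun a => a < size nodes) t -> cut_swaps N p t ->
  tangle (l ++ p) t = tangle l t.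
Proof.
move=> tN /and3P[pN fm /allP fx]; rewrite /tangle list_perm_cat mulgA.
apply: (value_sink ev_functional) => [q|q|v i vt]; first exact: over_swaps.
  case: (pointP q) => [[k kN ->]|qk _]; last by rewrite list_perm_out.
  rewrite over_point // list_perm_point // => /negPf kt.
  by have := fx k; rewrite mem_iota /= add0n kN kt => /(_ isT)/eqP->.
exact: (fibre_swaps _ pN tN fm vt).
Qed.

Lemma cut_remove t (P : pred nat) (X : {set V}) : all (fun a => a < size nodes) t ->
  (forall a, a < size nodes -> (nth v0 nodes a \in X) = ~~ P a) -> {subset X <= nodes} ->
  cut t :\: X = cut (filter P t).
Proof.
move=> /allP tN XP Xn; apply/setP => v; rewrite !inE.
case: (boolP (v \in S0)) => vS /=.
  rewrite andbT; apply/negP => /Xn/nodes_S0; by rewrite vS.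
apply/andP/mapP => [[vX /mapP[a at_ va]]|[a]].
  exists a => //; rewrite mem_filter at_ andbT.
  by move: vX; rewrite va XP ?tN // negbK.
rewrite mem_filter => /andP[Pa at_] va; split; last by apply/mapP; exists a.
by rewrite va XP ?tN // Pa.
Qed.

Lemma tangle_bigon l t a p q r : 0 < a < size nodes -> a \in t ->
  all (fun a => a < size nodes) t -> within N l ->
  perm_eq [:: p; q; r] [:: 3 * a; (3 * a).+1; (3 * a).+2] ->
  swap_image l p = p -> swap_image l q = q ->
  (9%:R * tangle l t = 2%:R * c * tangle l (filter (predC1 a) t))%R.
Proof.
move=> /andP[a0 aN] at_ tN lN pe lp lq.
have vt : nth v0 nodes a \in cut t by rewrite inE; apply/orP; right; apply/mapP; exists a.
have idx k : k \in [:: p; q; r] -> [/\ k %/ 3 = a & 3 <= k < N].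
  by rewrite (perm_mem pe) !inE => /or3P[]/eqP->; split; lia.
have [pa pN] : p %/ 3 = a /\ 3 <= p < N by apply: idx; rewrite !inE eqxx.
have [qa qN] : q %/ 3 = a /\ 3 <= q < N by apply: idx; rewrite !inE eqxx orbT.
have [ra rN] : r %/ 3 = a /\ 3 <= r < N by apply: idx; rewrite !inE eqxx !orbT.
have uniq_pqr : uniq [:: point p; point q; point r].
  have : uniq [:: p; q; r] by rewrite (perm_uniq pe) /= !inE; apply/and3P; split; lia.
  have /andP[_ pN'] := pN; have /andP[_ qN'] := qN; have /andP[_ rN'] := rN.
  by rewrite /= !inE !point_inj.
rewrite /tangle (value_bigon ev_functional (v := nth v0 nodes a) (p := point p) (q := point q) (r := point r)) //.
- rewrite (@cut_remove _ (predC1 a)) // => [b' b'N|v]; last by rewrite inE => /eqP->; apply: mem_nth.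
  by rewrite inE nth_uniq //= negbK.
- by rewrite /= pa.
- by rewrite /= qa.
- by rewrite /= ra.
- by rewrite base_point // lp.
- by rewrite base_point // lq.
Qed.

Lemma tangle_quad l t a a' p0 p1 p2 q0 q1 q2 :
  0 < a < size nodes -> 0 < a' < size nodes -> a != a' -> a \in t -> a' \in t ->
  all (fun a => a < size nodes) t -> within N l ->
  perm_eq [:: p0; p1; p2] [:: 3 * a; (3 * a).+1; (3 * a).+2] ->
  perm_eq [:: q0; q1; q2] [:: 3 * a'; (3 * a').+1; (3 * a').+2] ->
  swap_image l p0 = p0 -> swap_image l q0 = q0 -> swap_image l p1 = q1 -> swap_image l q1 = p1 ->
  let t' := filter [predC pred2 a a'] t in
  (27%:R * tangle l t = tangle l t' + tangle (rcons l (p2, q2)) t')%R.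
Proof.
move=> aN aN' aa at_ at_' tN lN pe pe' lp lq lpq lqp t'.
have idx x k : 0 < x < size nodes -> k \in [:: 3 * x; (3 * x).+1; (3 * x).+2] ->
    k %/ 3 = x /\ 3 <= k < N.
  by rewrite !inE => xN /or3P[]/eqP->; split; lia.
have uq x s : 0 < x < size nodes -> perm_eq s [:: 3 * x; (3 * x).+1; (3 * x).+2] ->
    uniq (map point s).
  move=> xN ps; rewrite map_inj_in_uniq; last first.
    move=> k k'; rewrite !(perm_mem ps) => /(idx _ _ xN)[_ /andP[_ kN]] /(idx _ _ xN)[_ /andP[_ kN']].
    by move=> /eqP; rewrite point_inj // => /eqP.
  by rewrite (perm_uniq ps) /= !inE; apply/and3P; split; lia.
have vt x : x \in t -> nth v0 nodes x \in cut t.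
  by move=> xt; rewrite inE; apply/orP; right; apply/mapP; exists x.
have [p0a p0N] : p0 %/ 3 = a /\ 3 <= p0 < N by apply: idx => //; rewrite -(perm_mem pe) !inE eqxx.
have [p1a p1N] : p1 %/ 3 = a /\ 3 <= p1 < N by apply: idx => //; rewrite -(perm_mem pe) !inE eqxx orbT.
have [p2a p2N] : p2 %/ 3 = a /\ 3 <= p2 < N by apply: idx => //; rewrite -(perm_mem pe) !inE eqxx !orbT.
have [q0a q0N] : q0 %/ 3 = a' /\ 3 <= q0 < N by apply: idx => //; rewrite -(perm_mem pe') !inE eqxx.
have [q1a q1N] : q1 %/ 3 = a' /\ 3 <= q1 < N by apply: idx => //; rewrite -(perm_mem pe') !inE eqxx orbT.
have [q2a q2N] : q2 %/ 3 = a' /\ 3 <= q2 < N by apply: idx => //; rewrite -(perm_mem pe') !inE eqxx !orbT.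
have := @value_quad c ev ev_functional V (b * list_perm l)%g (cut t) (nth v0 nodes a) (nth v0 nodes a')
  (point p0) (point p1) (point p2) (point q0) (point q1) (point q2) (vt _ at_) (vt _ at_').
rewrite !base_point // lp lq lpq lqp /= p0a p1a p2a q0a q1a q2a => qd.
have aaN : nth v0 nodes a != nth v0 nodes a'.
  by case/andP: aN => _ ?; case/andP: aN' => _ ?; rewrite nth_uniq.
rewrite /tangle qd //; [|exact: (uq _ _ aN pe)|exact: (uq _ _ aN' pe')].
rewrite list_perm_rcons mulgA.
rewrite (@cut_remove _ [predC pred2 a a']) // => [x xN|v]; rewrite !inE.
  case/andP: aN => _ ?; case/andP: aN' => _ ?.
  by rewrite !nth_uniq ?negbK.
by case/andP: aN => _ ?; case/andP: aN' => _ ?; case/orP => /eqP->; apply: mem_nth.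
Qed.

(** Inserting anchors at the ends of the strands is the inverse of loosening them. *)
Lemma tangle_anchored la m t : all (fun a => 0 < a < size nodes) t -> 3 <= N -> within N m ->
  anchored N la m ->
  value ev (list_perm la * (b * list_perm m))%g (cut t) = (3%:R ^+ size la * tangle m t)%R.
Proof.
move=> tN N3 mN; elim: la => [|[p a] la IHla]; first by rewrite /= mul1g expr0 mul1r.
move=> /and5P[pN a3 lp mp la_ok]; rewrite exprS -mulrA -IHla //= -mulgA.
have lN : within N la.
  by elim: la {IHla lp} la_ok => //= -[q d] la IH /and5P[/andP[_ ->] d3 _ _ /IH ->];
    rewrite (leq_trans d3 N3).
have /andP[p3 pN'] := pN.
apply: (value_loosen_left ev_functional).
- by rewrite permM list_perm_point // (eqP lp) base_point // (eqP mp).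
- by rewrite point_inj // ?(leq_trans a3) //; apply: contraTneq a3 => <-; rewrite -leqNgt.
- rewrite over_point ?(leq_trans a3) //.
    by rewrite divn_small //; apply/negP => /(allP tN).
  by apply: sub_all tN => x /andP[].
Qed.

End Base.

(** The permutation of a diagram splits off its local part: [rev la] inserts the anchors
    into the strands, after which the local points are moved as [m] says, and what is
    left fixes them. *)
Lemma anchored_base (G : {perm V * 'I_3}) la m : within N la -> within N m ->
  (forall k, 3 <= k < N -> G (point (swap_image (rev la) k)) = point (swap_image m k)) ->
  exists2 b : {perm V * 'I_3}, forall k, 3 <= k < N -> b (point k) = point k
    & G = (list_perm la * (b * list_perm m))%g.
Proof.
move=> lN mN Gk; exists (list_perm (rev la) * G * list_perm (rev m))%g => [k /andP[k3 kN]|].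
  rewrite !permM list_perm_point ?within_rev // Gk ?k3 //.
  by rewrite list_perm_rev -(list_perm_point mN kN) permK.
by rewrite !list_perm_rev -!mulgA mulVg mulg1 mulKVg.
Qed.

End Tangle.

(** * The second Reidemeister move on tangles *)

(** The following tests contain all that has to be known about the lists in order to
    compare two tangles or to resolve a bigon or a quadrilateral; for concrete lists
    they are evaluated by computation.  The numbers [n] and [n'] count loosened points. *)
Definition same_check (K : nat) (h l : swaps) (t : seq nat) (l' : swaps) (t' : seq nat)
    (n n' : nat) : bool :=
  let N := (3 * K)%N in
  [&& within N l, within N l', all (fun a => a < K) t, all (fun a => a < K) t',
      same_tangle N h l t l' t', (loosen N t l).2 == n & (loosen N t' l').2 == n'].

Definition bigon_check (K : nat) (p l : swaps) (t : seq nat) (a i j k n : nat) : bool :=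
  let N := (3 * K)%N in let f := loosen N t l in
  [&& 0 < a < K, a \in t, all (fun a => a < K) t, within N l, cut_swaps N p t,
      perm_eq [:: i; j; k] [:: 3 * a; (3 * a).+1; (3 * a).+2],
      swap_image (f.1 ++ p) i == i, swap_image (f.1 ++ p) j == j & f.2 == n].

Definition quad_check (K : nat) (p l : swaps) (t : seq nat) (a a' : nat)
    (i0 i1 i2 j0 j1 j2 n : nat) : bool :=
  let N := (3 * K)%N in let f := loosen N t l in
  [&& 0 < a < K, 0 < a' < K, a != a', a \in t, a' \in t &
  [&& all (fun a => a < K) t, within N l, cut_swaps N p t,
      perm_eq [:: i0; i1; i2] [:: 3 * a; (3 * a).+1; (3 * a).+2],
      perm_eq [:: j0; j1; j2] [:: 3 * a'; (3 * a').+1; (3 * a').+2] &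
  [&& swap_image (f.1 ++ p) i0 == i0, swap_image (f.1 ++ p) j0 == j0,
      swap_image (f.1 ++ p) i1 == j1, swap_image (f.1 ++ p) j1 == i1 & f.2 == n]]].

Section Moves.
Variables (c : int) (ev : web -> int).
Hypothesis ev_functional : web_functional c ev.
Variables (V : finType) (v0 : V) (nodes : seq V) (S0 : {set V}) (K : nat).
Hypothesis uniq_nodes : uniq nodes.
Hypothesis nodes_S0 : forall v, v \in nodes -> v \notin S0.
Hypothesis size_nodes : size nodes = K.

Local Notation N := (3 * K)%N.
Local Notation point := (point v0 nodes).
Local Notation list_perm := (list_perm v0 nodes).
Local Notation cut := (cut v0 nodes S0).

Section Base.
Variable b : {perm V * 'I_3}.
Hypothesis b_inner : forall k, 3 <= k < N -> b (point k) = point k.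
Local Notation T := (tangle ev v0 nodes S0 b).

Lemma same_checkP h l t l' t' n n' : same_check K h l t l' t' n n' ->
  (3%:R ^+ n * T l t = 3%:R ^+ n' * T l' t')%R.
Proof.
move: b_inner; rewrite -size_nodes => bi.
case/and5P=> lN lN' tK tK' /and3P[st /eqP <- /eqP <-].
exact: (tangle_same ev_functional uniq_nodes nodes_S0 bi lN lN' tK tK' st).
Qed.

Lemma sink_checkP l p t : cut_swaps N p t -> all (fun a => a < K) t ->
  T (l ++ p) t = T l t.
Proof. by rewrite -size_nodes => cs tK; apply: (tangle_sink ev_functional). Qed.

Lemma bigon_checkP p l t a i j k n : bigon_check K p l t a i j k n ->
  (9%:R * (3%:R ^+ n * T l t) =
    2%:R * c * T ((loosen N t l).1 ++ p) (filter (predC1 a) t))%R.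
Proof.
move: b_inner; rewrite -size_nodes => bi.
case/and5P=> aK at_ tK lN /and5P[cs pe /eqP pi /eqP pj /eqP <-].
have [fN fE] := tangle_loosen ev_functional uniq_nodes nodes_S0 bi tK lN.
rewrite -fE -(tangle_sink ev_functional v0 uniq_nodes nodes_S0 b (loosen (3 * size nodes) t l).1 tK cs).
apply: (tangle_bigon ev_functional uniq_nodes nodes_S0 bi aK at_ tK _ pe pi pj).
by rewrite within_cat fN; case/and3P: cs.
Qed.

Lemma quad_checkP p l t a a' i0 i1 i2 j0 j1 j2 n :
  quad_check K p l t a a' i0 i1 i2 j0 j1 j2 n ->
  (27%:R * (3%:R ^+ n * T l t) =
    T ((loosen N t l).1 ++ p) (filter [predC pred2 a a'] t) +
    T (rcons ((loosen N t l).1 ++ p) (i2, j2)) (filter [predC pred2 a a'] t))%R.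
Proof.
move: b_inner; rewrite -size_nodes => bi.
case/and5P=> aK aK' aa at_ /andP[at_' /and5P[tK lN cs pi]].
case/andP=> pj /and5P[/eqP e1 /eqP e2 /eqP e3 /eqP e4 /eqP <-].
have [fN fE] := tangle_loosen ev_functional uniq_nodes nodes_S0 bi tK lN.
rewrite -fE -(tangle_sink ev_functional v0 uniq_nodes nodes_S0 b (loosen (3 * size nodes) t l).1 tK cs).
apply: (tangle_quad ev_functional uniq_nodes nodes_S0 bi aK aK' aa at_ at_' tK _ pi pj e1 e2 e3 e4).
by rewrite within_cat fN; case/and3P: cs.
Qed.

End Base.

Lemma anchored_value (b : {perm V * 'I_3}) la m l t :
  (forall k, 3 <= k < N -> b (point k) = point k) ->
  [&& all (fun a => 0 < a < K) t, 3 <= N, within N (m ++ l) & anchored N la (m ++ l)] ->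
  value ev (list_perm la * (b * list_perm m) * list_perm l)%g (cut t)
    = (3%:R ^+ size la * tangle ev v0 nodes S0 b (m ++ l) t)%R.
Proof.
rewrite -size_nodes => bi /and4P[tK N3 ml la_ok].
rewrite -(tangle_anchored ev_functional uniq_nodes nodes_S0 bi tK N3 ml la_ok).
by congr value; rewrite list_perm_cat !mulgA.
Qed.

End Moves.

Section SecondMove.
Variables (c : int) (ev : web -> int).
Hypothesis ev_functional : web_functional c ev.
Hypothesis c_sign : (c = 1 \/ c = -1)%R.
Variables (V : finType) (v0 : V) (nodes : seq V) (S0 : {set V}).
Hypothesis uniq_nodes : uniq nodes.
Hypothesis nodes_S0 : forall v, v \in nodes -> v \notin S0.
Hypothesis size_nodes : size nodes = 3.
Local Notation point := (point v0 nodes).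
Local Notation list_perm := (list_perm v0 nodes).
Local Notation cut := (cut v0 nodes S0).
Variable G : {perm V * 'I_3}.
Hypothesis G_fixed : forall k, k \in [:: 0; 1; 2; 5; 8] -> G (point k) = point k.

Local Notation sigma := [:: (3, 4); (6, 7)].
Local Notation smoothed t := (value ev (G * list_perm sigma)%g (cut t)).

(** Cutting either crossing gives the same tangle, and cutting both gives a bigon whose
    resolution is this tangle. *)
Lemma parallel_move : G (point 3) = point 6 -> G (point 4) = point 7 ->
  (smoothed [::] - 3%:R * c * smoothed [:: 1%N] - 3%:R * c * smoothed [:: 2%N]
   + 9%:R * smoothed [:: 1%N; 2%N] = value ev G (cut [::]))%R.
Proof.
move=> G3 G4; pose la : swaps := [:: (6, 0); (7, 1)].
pose m : swaps := [:: (0, 3); (0, 6); (1, 4); (1, 7)].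
have [||k kN|b bi GE] := @anchored_base V v0 nodes uniq_nodes G la m; rewrite ?size_nodes //.
  have : k \in iota 3 6 by rewrite mem_iota; lia.
  by rewrite !inE; do ?case/orP; move=> /eqP->; rewrite /swap_image /= ?G3 ?G4 ?G_fixed.
rewrite size_nodes in bi.
have val := anchored_value ev_functional uniq_nodes nodes_S0 size_nodes bi (la := la) (m := m).
have -> : value ev G (cut [::]) = value ev (G * list_perm [::])%g (cut [::]) by rewrite mulg1.
rewrite GE !val //.
pose r := m ++ sigma.
have same := same_checkP ev_functional uniq_nodes nodes_S0 size_nodes bi.
have bigon := bigon_checkP ev_functional uniq_nodes nodes_S0 size_nodes bi.
have e0 := same _ _ _ _ _ _ _ (isT : same_check 3 [::] r [::] m [::] 4 4).
have e1 := same _ _ _ _ _ _ _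
  (isT : same_check 3 [:: (3, 7); (3, 4); (3, 6); (5, 8)] r [:: 1] r [:: 2] 2 2).
pose p : swaps := [:: (3, 7); (4, 6); (5, 8)].
have e2 := bigon _ _ _ _ _ _ _ _ (isT : bigon_check 3 p r [:: 1; 2] 1 3 4 5 0).
have e3 := same _ _ _ _ _ _ _ (isT : same_check 3 [::] ((loosen (3 * 3) [:: 1; 2] r).1 ++ p)
  (filter (predC1 1) [:: 1; 2]) r [:: 2] 1 2).
rewrite -/r cats0; move: e0 e1 e2 e3; rewrite !exprS !expr0.
case: c_sign => ->; lia.
Qed.

(** Cutting one crossing gives a bigon, cutting both a quadrilateral; one of the two
    resolutions of the latter is the pair of straight strands. *)
Lemma antiparallel_move : G (point 3) = point 6 -> G (point 7) = point 4 ->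
  (smoothed [::] - 3%:R * c * smoothed [:: 1%N] - 3%:R * c * smoothed [:: 2%N]
   + 9%:R * smoothed [:: 1%N; 2%N] = value ev G (cut [::]))%R.
Proof.
move=> G3 G4; pose la : swaps := [:: (6, 0); (4, 1)].
pose m : swaps := [:: (0, 3); (0, 6); (1, 7); (1, 4)].
have [||k kN|b bi GE] := @anchored_base V v0 nodes uniq_nodes G la m; rewrite ?size_nodes //.
  have : k \in iota 3 6 by rewrite mem_iota; lia.
  by rewrite !inE; do ?case/orP; move=> /eqP->; rewrite /swap_image /= ?G3 ?G4 ?G_fixed.
rewrite size_nodes in bi.
have val := anchored_value ev_functional uniq_nodes nodes_S0 size_nodes bi (la := la) (m := m).
have -> : value ev G (cut [::]) = value ev (G * list_perm [::])%g (cut [::]) by rewrite mulg1.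
rewrite GE !val //.
pose r := m ++ sigma.
have same := same_checkP ev_functional uniq_nodes nodes_S0 size_nodes bi.
have bigon := bigon_checkP ev_functional uniq_nodes nodes_S0 size_nodes bi.
have quad := quad_checkP ev_functional uniq_nodes nodes_S0 size_nodes bi.
have e1 := bigon _ _ _ _ _ _ _ _ (isT : bigon_check 3 [::] r [:: 1] 1 3 5 4 2).
have e1' := same _ _ _ _ _ _ _ (isT : same_check 3 [::] ((loosen (3 * 3) [:: 1] r).1 ++ [::])
  (filter (predC1 1) [:: 1]) r [::] 1 3).
have e2 := bigon _ _ _ _ _ _ _ _ (isT : bigon_check 3 [::] r [:: 2] 2 7 8 6 2).
have e2' := same _ _ _ _ _ _ _ (isT : same_check 3 [::] ((loosen (3 * 3) [:: 2] r).1 ++ [::])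
  (filter (predC1 2) [:: 2]) r [::] 1 3).
have e3 := quad _ _ _ _ _ _ _ _ _ _ _ _ (isT : quad_check 3 [::] r [:: 1; 2] 1 2 5 3 4 8 7 6 0).
pose q := (loosen (3 * 3) [:: 1; 2] r).1 ++ [::].
have e4 := same _ _ _ _ _ _ _ (isT : same_check 3 [::] q
  (filter [predC pred2 1 2] [:: 1; 2]) r [::] 3 3).
have e5 := same _ _ _ _ _ _ _ (isT : same_check 3 [::] (rcons q (4, 6))
  (filter [predC pred2 1 2] [:: 1; 2]) m [::] 3 4).
rewrite -/r cats0; move: e1 e1' e2 e2' e3 e4 e5; rewrite -/q !exprS !expr0.
case: c_sign => ->; lia.
Qed.

End SecondMove.

(** * The third Reidemeister move on tangles *)

Definition crossing_swaps : swaps := [:: (3, 4); (6, 7); (9, 10)].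

(** The sum over the states of the three crossings 1, 2 and 3, the factor - c of a cut
    crossing being multiplied by 3 for the circle that its third point loses.  The
    square of c has been replaced by 1. *)
Definition triangle_sum (c : int) (F : seq nat -> int) : int :=
  (F [::] - 3%:R * c * (F [:: 1%N] + F [:: 2%N] + F [:: 3%N])
   + 9%:R * (F [:: 1%N; 2%N] + F [:: 1%N; 3%N] + F [:: 2%N; 3%N])
   - 27%:R * c * F [:: 1%N; 2%N; 3%N])%R.

Lemma triangle_sumZ c k (F F' : seq nat -> int) :
  (forall t, all (fun a => 0 < a < 4)%N t -> F t = k * F' t)%R ->
  triangle_sum c F = (k * triangle_sum c F')%R.
Proof. by move=> e; rewrite /triangle_sum !e //; ring. Qed.

Lemma pow3_inj k (u v : int) : (3%:R ^+ k * u = 3%:R ^+ k * v)%R -> u = v.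
Proof. by apply: mulfI; rewrite expf_neq0. Qed.

(** Because of the bigon in the last of them, the terms with 1, with 3 and with both
    cut cancel.  The quadrilateral that appears when all three crossings are cut
    contributes the term of the other side in which only the middle crossing 2 is cut,
    and a tangle [w] common to both sides. *)
Lemma acyclic_triangle_sum c (F F' : seq nat -> int) z z' p p' w w' :
  (3%:R ^+ 6 * F [::] = 3%:R ^+ 6 * F' [::])%R ->
  (3%:R ^+ 4 * F [:: 1%N] = 3%:R ^+ 4 * F [:: 3%N])%R ->
  (3%:R ^+ 4 * F' [:: 1%N] = 3%:R ^+ 4 * F' [:: 3%N])%R ->
  (9%:R * (3%:R ^+ 2 * F [:: 1%N; 3%N]) = 2%:R * c * z)%R ->
  (3%:R ^+ 1 * z = 3%:R ^+ 4 * F [:: 3%N])%R ->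
  (9%:R * (3%:R ^+ 2 * F' [:: 1%N; 3%N]) = 2%:R * c * z')%R ->
  (3%:R ^+ 1 * z' = 3%:R ^+ 4 * F' [:: 1%N])%R ->
  (3%:R ^+ 2 * F [:: 1%N; 2%N] = 3%:R ^+ 2 * F' [:: 1%N; 2%N])%R ->
  (3%:R ^+ 2 * F [:: 2%N; 3%N] = 3%:R ^+ 2 * F' [:: 2%N; 3%N])%R ->
  (27%:R * (3%:R ^+ 0 * F [:: 1%N; 2%N; 3%N]) = p + w)%R ->
  (27%:R * (3%:R ^+ 0 * F' [:: 1%N; 2%N; 3%N]) = p' + w')%R ->
  (3%:R ^+ 3 * p = 3%:R ^+ 4 * F' [:: 2%N])%R ->
  (3%:R ^+ 3 * p' = 3%:R ^+ 4 * F [:: 2%N])%R ->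
  (3%:R ^+ 3 * w = 3%:R ^+ 3 * w')%R ->
  triangle_sum c F = triangle_sum c F'.
Proof.
move=> /pow3_inj e0 /pow3_inj e1 /pow3_inj e1' ez ez3 ez' ez3' /pow3_inj e12 /pow3_inj e23.
rewrite !expr0 !mul1r => ep ep' epy epx /pow3_inj ew.
have {}ez3 : (z = 27%:R * F [:: 3%N])%R by apply: (@pow3_inj 1); rewrite ez3; ring.
have {}ez3' : (z' = 27%:R * F' [:: 1%N])%R by apply: (@pow3_inj 1); rewrite ez3'; ring.
have {}epy : (p = 3%:R * F' [:: 2%N])%R by apply: (@pow3_inj 3); rewrite epy; ring.
have {}epx : (p' = 3%:R * F [:: 2%N])%R by apply: (@pow3_inj 3); rewrite epx; ring.
have double u v y : (9%:R * (3%:R ^+ 2 * u) = 2%:R * c * y)%R -> (y = 27%:R * v)%R ->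
    (3%:R * u = 2%:R * c * v)%R.
  move=> e ey; apply: (@pow3_inj 3); transitivity (9%:R * (3%:R ^+ 2 * u))%R; first by ring.
  by rewrite e ey; ring.
have {}ez := double _ _ _ ez ez3; have {}ez' := double _ _ _ ez' ez3'.
have sumE (H : seq nat -> int) : triangle_sum c H =
  (H [::] - 3%:R * c * (H [:: 1%N] + H [:: 2%N] + H [:: 3%N]) + 3%:R * (3%:R * H [:: 1%N; 3%N])
   + 9%:R * (H [:: 1%N; 2%N] + H [:: 2%N; 3%N]) - c * (27%:R * H [:: 1%N; 2%N; 3%N]))%R.
  by rewrite /triangle_sum; ring.
by rewrite !sumE ez ez' ep ep' e0 e1 e1' e12 e23 ew epy epx; ring.
Qed.

(** All bigons and one resolution of each quadrilateral are multiples of the completely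
    smoothed tangle, whose total coefficient vanishes. *)
Lemma cyclic_triangle_sum c (F : seq nat -> int) z1 z2 z3 p12 w12 p13 w13 p23 w23 :
  (c = 1 \/ c = -1)%R ->
  (9%:R * (3%:R ^+ 4 * F [:: 1%N]) = 2%:R * c * z1)%R -> (3%:R ^+ 1 * z1 = 3%:R ^+ 5 * F [::])%R ->
  (9%:R * (3%:R ^+ 4 * F [:: 2%N]) = 2%:R * c * z2)%R -> (3%:R ^+ 1 * z2 = 3%:R ^+ 5 * F [::])%R ->
  (9%:R * (3%:R ^+ 4 * F [:: 3%N]) = 2%:R * c * z3)%R -> (3%:R ^+ 1 * z3 = 3%:R ^+ 5 * F [::])%R ->
  (27%:R * (3%:R ^+ 2 * F [:: 1%N; 2%N]) = p12 + w12)%R -> (3%:R ^+ 3 * p12 = 3%:R ^+ 5 * F [::])%R ->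
  (27%:R * (3%:R ^+ 2 * F [:: 1%N; 3%N]) = p13 + w13)%R -> (3%:R ^+ 3 * p13 = 3%:R ^+ 5 * F [::])%R ->
  (27%:R * (3%:R ^+ 2 * F [:: 2%N; 3%N]) = p23 + w23)%R -> (3%:R ^+ 3 * p23 = 3%:R ^+ 5 * F [::])%R ->
  (27%:R * triangle_sum c F = w12 + w13 + w23 - 729%:R * c * F [:: 1%N; 2%N; 3%N])%R.
Proof.
move=> cs.
have cc : (c * c = 1)%R by case: cs => ->.
have single u z : (9%:R * (3%:R ^+ 4 * u) = 2%:R * c * z)%R ->
    (3%:R ^+ 1 * z = 3%:R ^+ 5 * F [::])%R -> (9%:R * (c * u) = 2%:R * F [::])%R.
  move=> e1 e2; apply: (@pow3_inj 5).
  transitivity (3%:R * c * (9%:R * (3%:R ^+ 4 * u)))%R; first by ring.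
  rewrite e1; transitivity ((c * c) * 2%:R * (3%:R ^+ 1 * z))%R; first by ring.
  by rewrite e2 cc; ring.
have double u q w : (27%:R * (3%:R ^+ 2 * u) = q + w)%R ->
    (3%:R ^+ 3 * q = 3%:R ^+ 5 * F [::])%R -> (243%:R * u = 9%:R * F [::] + w)%R.
  move=> e1 e2; transitivity (27%:R * (3%:R ^+ 2 * u))%R; first by ring.
  by rewrite e1; congr (_ + w)%R; apply: (@pow3_inj 3); rewrite e2; ring.
move=> /single s1 {}/s1 s1 /single s2 {}/s2 s2 /single s3 {}/s3 s3.
move=> /double d12 {}/d12 d12 /double d13 {}/d13 d13 /double d23 {}/d23 d23.
transitivity (27%:R * F [::] - 9%:R * (9%:R * (c * F [:: 1%N]) + 9%:R * (c * F [:: 2%N])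
    + 9%:R * (c * F [:: 3%N])) + (243%:R * F [:: 1%N; 2%N] + 243%:R * F [:: 1%N; 3%N]
    + 243%:R * F [:: 2%N; 3%N]) - 729%:R * c * F [:: 1%N; 2%N; 3%N])%R.
  by rewrite /triangle_sum; ring.
by rewrite s1 s2 s3 d12 d13 d23; ring.
Qed.

(** The other resolutions of the quadrilaterals and the hexagon agree on both sides. *)
Lemma hexagon_sum_eq (c u u' a a' b b' d d' t t' y : int) :
  (27%:R * u = a + b + d - 729%:R * c * t)%R ->
  (27%:R * u' = a' + b' + d' - 729%:R * c * t')%R ->
  (3%:R ^+ 3 * a = 3%:R ^+ 3 * a')%R -> (3%:R ^+ 3 * b = 3%:R ^+ 3 * b')%R ->
  (3%:R ^+ 3 * d = 3%:R ^+ 3 * d')%R -> y = t -> (3%:R ^+ 0 * y = 3%:R ^+ 0 * t')%R ->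
  u = u'.
Proof.
move=> e e' /pow3_inj ea /pow3_inj eb /pow3_inj ed yt /pow3_inj ty.
by apply: (@pow3_inj 3); rewrite [LHS]e ea eb ed -yt ty -e'.
Qed.

Section ThirdMove.
Variables (c : int) (ev : web -> int).
Hypothesis ev_functional : web_functional c ev.
Hypothesis c_sign : (c = 1 \/ c = -1)%R.
Variables (V : finType) (v0 : V) (nodes : seq V) (S0 : {set V}).
Hypothesis uniq_nodes : uniq nodes.
Hypothesis nodes_S0 : forall v, v \in nodes -> v \notin S0.
Hypothesis size_nodes : size nodes = 4.
Local Notation point := (point v0 nodes).
Local Notation list_perm := (list_perm v0 nodes).
Local Notation cut := (cut v0 nodes S0).
Variable G : {perm V * 'I_3}.
Hypothesis G_fixed : forall k, k \in [:: 0; 1; 2; 5; 8; 11] -> G (point k) = point k.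

Local Notation flip := [:: (3, 6); (4, 9); (7, 10)].
Local Notation smoothed H t := (value ev (H * list_perm crossing_swaps)%g (cut t)).

(** The braid relation.  The strand through 3 and 6, the one through 4 and 9 and the one
    through 7 and 10 leave the tangle at the anchors 0, 1 and 2; the move exchanges the
    two crossings on each of them. *)
Lemma acyclic_triangle :
  G (point 3) = point 6 -> G (point 4) = point 9 -> G (point 7) = point 10 ->
  triangle_sum c (fun t => smoothed G t)
  = triangle_sum c (fun t => smoothed (G ^ list_perm flip)%g t).
Proof.
move=> G3 G4 G7; pose la : swaps := [:: (6, 0); (9, 1); (10, 2)].
pose la' : swaps := [:: (3, 0); (4, 1); (7, 2)].
pose m : swaps := [:: (0, 3); (0, 6); (1, 4); (1, 9); (2, 7); (2, 10)].
pose m' := rev flip ++ m ++ flip.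
have [||k kN|b bi GE] := @anchored_base V v0 nodes uniq_nodes G la m.
- by rewrite size_nodes.
- by rewrite size_nodes.
- rewrite size_nodes in kN; have : k \in iota 3 9 by rewrite mem_iota; lia.
  by rewrite !inE; do ?case/orP; move=> /eqP->; rewrite /swap_image /= ?G3 ?G4 ?G7 ?G_fixed.
have GE' : (G ^ list_perm flip = list_perm la' * (b * list_perm m'))%g.
  have flipN : inner (3 * size nodes) flip by rewrite size_nodes.
  rewrite GE (conj_anchored uniq_nodes bi la m flipN); congr (_ * _)%g.
  by apply: eq_list_perm; rewrite ?size_nodes.
rewrite size_nodes in bi.
pose r := m ++ crossing_swaps; pose r' := m' ++ crossing_swaps.
have val t : all (fun a => 0 < a < 4) t ->
    smoothed G t = (3%:R ^+ 3 * tangle ev v0 nodes S0 b r t)%R.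
  move=> tK; rewrite GE; apply: (anchored_value ev_functional uniq_nodes nodes_S0 size_nodes bi).
  by rewrite tK.
have val' t : all (fun a => 0 < a < 4) t ->
    smoothed (G ^ list_perm flip)%g t = (3%:R ^+ 3 * tangle ev v0 nodes S0 b r' t)%R.
  move=> tK; rewrite GE'; apply: (anchored_value ev_functional uniq_nodes nodes_S0 size_nodes bi).
  by rewrite tK.
refine (etrans (triangle_sumZ c val)
  (etrans (congr1 (fun x => 3%:R ^+ 3 * x)%R _) (esym (triangle_sumZ c val')))).
have same := same_checkP ev_functional uniq_nodes nodes_S0 size_nodes bi.
have bigon := bigon_checkP ev_functional uniq_nodes nodes_S0 size_nodes bi.
have quad := quad_checkP ev_functional uniq_nodes nodes_S0 size_nodes bi.
have e0 := same _ _ _ _ _ _ _ (isT : same_check 4 [::] r [::] r' [::] 6 6).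
(* The lists [h13], [h12], [h23] and [h] match the points of isomorphic tangles. *)
pose h13 : swaps := [:: (3, 9); (4, 10); (5, 11)].
have e1 := same _ _ _ _ _ _ _ (isT : same_check 4 h13 r [:: 1] r [:: 3] 4 4).
have e1' := same _ _ _ _ _ _ _ (isT : same_check 4 h13 r' [:: 1] r' [:: 3] 4 4).
have e2 := bigon _ _ _ _ _ _ _ _ (isT : bigon_check 4 h13 r [:: 1; 3] 1 3 4 5 2).
have e3 := same _ _ _ _ _ _ _ (isT : same_check 4 [::] ((loosen (3 * 4) [:: 1; 3] r).1 ++ h13)
  (filter (predC1 1) [:: 1; 3]) r [:: 3] 1 4).
have e2' := bigon _ _ _ _ _ _ _ _ (isT : bigon_check 4 h13 r' [:: 1; 3] 3 9 10 11 2).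
have e3' := same _ _ _ _ _ _ _ (isT : same_check 4 [::] ((loosen (3 * 4) [:: 1; 3] r').1 ++ h13)
  (filter (predC1 3) [:: 1; 3]) r' [:: 1] 1 4).
pose h12 : swaps := [:: (3, 6); (4, 7); (5, 8)].
pose h23 : swaps := [:: (6, 9); (7, 10); (8, 11)].
have e4 := same _ _ _ _ _ _ _ (isT : same_check 4 h12 r [:: 1; 2] r' [:: 1; 2] 2 2).
have e5 := same _ _ _ _ _ _ _ (isT : same_check 4 h23 r [:: 2; 3] r' [:: 2; 3] 2 2).
(* When all crossings are cut, exchanging the sinks 1 and 3 brings the quadrilateral
   into normal form. *)
pose q := (loosen (3 * 4) [:: 1; 2; 3] r).1 ++ h13.
pose q' := (loosen (3 * 4) [:: 1; 2; 3] r').1 ++ h13.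
have e6 := quad _ _ _ _ _ _ _ _ _ _ _ _
  (isT : quad_check 4 h13 r [:: 1; 2; 3] 1 2 4 3 5 8 7 6 0).
have e6' := quad _ _ _ _ _ _ _ _ _ _ _ _
  (isT : quad_check 4 h13 r' [:: 1; 2; 3] 2 3 8 6 7 9 10 11 0).
have e7 := same _ _ _ _ _ _ _ (isT : same_check 4 h23 q
  (filter [predC pred2 1 2] [:: 1; 2; 3]) r' [:: 2] 3 4).
have e7' := same _ _ _ _ _ _ _ (isT : same_check 4 h12 q'
  (filter [predC pred2 2 3] [:: 1; 2; 3]) r [:: 2] 3 4).
(* What remains has one sink receiving the three strands and one source emitting them. *)
pose h : swaps := [:: (3, 9); (3, 4); (3, 10); (3, 5); (3, 11)].
have e8 := same _ _ _ _ _ _ _ (isT : same_check 4 h (rcons q (5, 6))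
  (filter [predC pred2 1 2] [:: 1; 2; 3]) (rcons q' (7, 11))
  (filter [predC pred2 2 3] [:: 1; 2; 3]) 3 3).
exact: (@acyclic_triangle_sum c (tangle ev v0 nodes S0 b r) (tangle ev v0 nodes S0 b r') _ _ _ _ _ _ e0 e1 e1' e2 e3 e2' e3' e4 e5 e6 e6' e7 e7' e8).
Qed.

(** Here the three strands run around the triangle.  Cutting one crossing gives a bigon,
    two a quadrilateral, and all three a hexagon. *)
Lemma cyclic_triangle :
  G (point 3) = point 6 -> G (point 7) = point 10 -> G (point 9) = point 4 ->
  triangle_sum c (fun t => smoothed G t)
  = triangle_sum c (fun t => smoothed (G ^ list_perm flip)%g t).
Proof.
move=> G3 G7 G9; pose la : swaps := [:: (6, 0); (4, 1); (10, 2)].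
pose la' : swaps := [:: (3, 0); (9, 1); (7, 2)].
pose m : swaps := [:: (0, 3); (0, 6); (1, 9); (1, 4); (2, 7); (2, 10)].
pose m' := rev flip ++ m ++ flip.
have [||k kN|b bi GE] := @anchored_base V v0 nodes uniq_nodes G la m.
- by rewrite size_nodes.
- by rewrite size_nodes.
- rewrite size_nodes in kN; have : k \in iota 3 9 by rewrite mem_iota; lia.
  by rewrite !inE; do ?case/orP; move=> /eqP->; rewrite /swap_image /= ?G3 ?G9 ?G7 ?G_fixed.
have GE' : (G ^ list_perm flip = list_perm la' * (b * list_perm m'))%g.
  have flipN : inner (3 * size nodes) flip by rewrite size_nodes.
  rewrite GE (conj_anchored uniq_nodes bi la m flipN); congr (_ * _)%g.
  by apply: eq_list_perm; rewrite ?size_nodes.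
rewrite size_nodes in bi.
pose r := m ++ crossing_swaps; pose r' := m' ++ crossing_swaps.
have val t : all (fun a => 0 < a < 4) t ->
    smoothed G t = (3%:R ^+ 3 * tangle ev v0 nodes S0 b r t)%R.
  move=> tK; rewrite GE; apply: (anchored_value ev_functional uniq_nodes nodes_S0 size_nodes bi).
  by rewrite tK.
have val' t : all (fun a => 0 < a < 4) t ->
    smoothed (G ^ list_perm flip)%g t = (3%:R ^+ 3 * tangle ev v0 nodes S0 b r' t)%R.
  move=> tK; rewrite GE'; apply: (anchored_value ev_functional uniq_nodes nodes_S0 size_nodes bi).
  by rewrite tK.
refine (etrans (triangle_sumZ c val)
  (etrans (congr1 (fun x => 3%:R ^+ 3 * x)%R _) (esym (triangle_sumZ c val')))).
have same := same_checkP ev_functional uniq_nodes nodes_S0 size_nodes bi.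
have bigon := bigon_checkP ev_functional uniq_nodes nodes_S0 size_nodes bi.
have quad := quad_checkP ev_functional uniq_nodes nodes_S0 size_nodes bi.
have s1D := bigon _ _ _ _ _ _ _ _ (isT : bigon_check 4 [::] r [:: 1] 1 3 5 4 4).
have t1D := same _ _ _ _ _ _ _ (isT : same_check 4 [::] ((loosen (3 * 4) [:: 1] r).1 ++ [::])
  (filter (predC1 1) [:: 1]) r [::] 1 5).
have s2D := bigon _ _ _ _ _ _ _ _ (isT : bigon_check 4 [::] r [:: 2] 2 7 8 6 4).
have t2D := same _ _ _ _ _ _ _ (isT : same_check 4 [::] ((loosen (3 * 4) [:: 2] r).1 ++ [::])
  (filter (predC1 2) [:: 2]) r [::] 1 5).
have s3D := bigon _ _ _ _ _ _ _ _ (isT : bigon_check 4 [::] r [:: 3] 3 9 11 10 4).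
have t3D := same _ _ _ _ _ _ _ (isT : same_check 4 [::] ((loosen (3 * 4) [:: 3] r).1 ++ [::])
  (filter (predC1 3) [:: 3]) r [::] 1 5).
have d12D := quad _ _ _ _ _ _ _ _ _ _ _ _
  (isT : quad_check 4 [::] r [:: 1; 2] 1 2 5 3 4 8 7 6 2).
have f12D := same _ _ _ _ _ _ _ (isT : same_check 4 [::] ((loosen (3 * 4) [:: 1; 2] r).1 ++ [::])
  (filter [predC pred2 1 2] [:: 1; 2]) r [::] 3 5).
have d13D := quad _ _ _ _ _ _ _ _ _ _ _ _
  (isT : quad_check 4 [::] r [:: 1; 3] 1 3 5 3 4 11 9 10 2).
have f13D := same _ _ _ _ _ _ _ (isT : same_check 4 [::] ((loosen (3 * 4) [:: 1; 3] r).1 ++ [::])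
  (filter [predC pred2 1 3] [:: 1; 3]) r [::] 3 5).
have d23D := quad _ _ _ _ _ _ _ _ _ _ _ _
  (isT : quad_check 4 [::] r [:: 2; 3] 2 3 8 7 6 11 9 10 2).
have f23D := same _ _ _ _ _ _ _ (isT : same_check 4 [::] ((loosen (3 * 4) [:: 2; 3] r).1 ++ [::])
  (filter [predC pred2 2 3] [:: 2; 3]) r [::] 3 5).
have s1E := bigon _ _ _ _ _ _ _ _ (isT : bigon_check 4 [::] r' [:: 1] 1 4 5 3 4).
have t1E := same _ _ _ _ _ _ _ (isT : same_check 4 [::] ((loosen (3 * 4) [:: 1] r').1 ++ [::])
  (filter (predC1 1) [:: 1]) r' [::] 1 5).
have s2E := bigon _ _ _ _ _ _ _ _ (isT : bigon_check 4 [::] r' [:: 2] 2 6 8 7 4).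
have t2E := same _ _ _ _ _ _ _ (isT : same_check 4 [::] ((loosen (3 * 4) [:: 2] r').1 ++ [::])
  (filter (predC1 2) [:: 2]) r' [::] 1 5).
have s3E := bigon _ _ _ _ _ _ _ _ (isT : bigon_check 4 [::] r' [:: 3] 3 10 11 9 4).
have t3E := same _ _ _ _ _ _ _ (isT : same_check 4 [::] ((loosen (3 * 4) [:: 3] r').1 ++ [::])
  (filter (predC1 3) [:: 3]) r' [::] 1 5).
have d12E := quad _ _ _ _ _ _ _ _ _ _ _ _
  (isT : quad_check 4 [::] r' [:: 1; 2] 1 2 5 4 3 8 6 7 2).
have f12E := same _ _ _ _ _ _ _ (isT : same_check 4 [::] ((loosen (3 * 4) [:: 1; 2] r').1 ++ [::])
  (filter [predC pred2 1 2] [:: 1; 2]) r' [::] 3 5).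
have d13E := quad _ _ _ _ _ _ _ _ _ _ _ _
  (isT : quad_check 4 [::] r' [:: 1; 3] 1 3 5 4 3 11 10 9 2).
have f13E := same _ _ _ _ _ _ _ (isT : same_check 4 [::] ((loosen (3 * 4) [:: 1; 3] r').1 ++ [::])
  (filter [predC pred2 1 3] [:: 1; 3]) r' [::] 3 5).
have d23E := quad _ _ _ _ _ _ _ _ _ _ _ _
  (isT : quad_check 4 [::] r' [:: 2; 3] 2 3 8 6 7 11 10 9 2).
have f23E := same _ _ _ _ _ _ _ (isT : same_check 4 [::] ((loosen (3 * 4) [:: 2; 3] r').1 ++ [::])
  (filter [predC pred2 2 3] [:: 2; 3]) r' [::] 3 5).
have w12 := same _ _ _ _ _ _ _ (isT : same_check 4 [::]
  (rcons ((loosen (3 * 4) [:: 1; 2] r).1 ++ [::]) (4, 6)) (filter [predC pred2 1 2] [:: 1; 2])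
  (rcons ((loosen (3 * 4) [:: 1; 2] r').1 ++ [::]) (3, 7)) (filter [predC pred2 1 2] [:: 1; 2]) 3 3).
have w13 := same _ _ _ _ _ _ _ (isT : same_check 4 [::]
  (rcons ((loosen (3 * 4) [:: 1; 3] r).1 ++ [::]) (4, 10)) (filter [predC pred2 1 3] [:: 1; 3])
  (rcons ((loosen (3 * 4) [:: 1; 3] r').1 ++ [::]) (3, 9)) (filter [predC pred2 1 3] [:: 1; 3]) 3 3).
have w23 := same _ _ _ _ _ _ _ (isT : same_check 4 [::]
  (rcons ((loosen (3 * 4) [:: 2; 3] r).1 ++ [::]) (6, 10)) (filter [predC pred2 2 3] [:: 2; 3])
  (rcons ((loosen (3 * 4) [:: 2; 3] r').1 ++ [::]) (7, 9)) (filter [predC pred2 2 3] [:: 2; 3]) 3 3).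
(* The two hexagons differ in the way their sources are paired with their sinks: [p]
   changes the pairing, [h] names the points. *)
pose p : swaps := [:: (3, 9); (3, 7); (4, 10); (4, 6); (5, 11); (5, 8)].
pose h : swaps := [:: (3, 11); (3, 6); (4, 9); (4, 8); (5, 10); (5, 7)].
have e1 := sink_checkP ev_functional v0 uniq_nodes nodes_S0 size_nodes b r
  (isT : cut_swaps (3 * 4) p [:: 1; 2; 3]) isT.
have e2 := same _ _ _ _ _ _ _ (isT : same_check 4 h (r ++ p) [:: 1; 2; 3] r' [:: 1; 2; 3] 0 0).
have sD := @cyclic_triangle_sum c (tangle ev v0 nodes S0 b r) _ _ _ _ _ _ _ _ _ c_sign s1D t1D s2D t2D s3D t3D d12D f12D d13D f13D d23D f23D.
have sE := @cyclic_triangle_sum c (tangle ev v0 nodes S0 b r') _ _ _ _ _ _ _ _ _ c_sign s1E t1E s2E t2E s3E t3E d12E f12E d13E f13E d23E f23E.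
exact: (hexagon_sum_eq sD sE w12 w13 w23 e1 e2).
Qed.

End ThirdMove.

(** * The bracket as a sum over permutations *)

(** Summation over the two states of one crossing. *)
Lemma sum_subsets1 (T : finType) (A : {set T}) (x : T) (F : {set T} -> int) : x \in A ->
  (\sum_(s : {set T} | s \subset A) F s
   = \sum_(s : {set T} | s \subset A :\ x) (F s + F (x |: s)))%R.
Proof.
move=> xA; rewrite big_split /= (bigID (fun s : {set T} => x \in s)) /= addrC; congr (_ + _)%R.
  by apply: eq_bigl => s; rewrite subsetD1.
rewrite (reindex_onto (fun s => x |: s) (fun s => s :\ x)) /=; last first.
  by move=> s /andP[_ xs]; rewrite setD1K.
apply: eq_bigl => s; rewrite subUset sub1set xA setU11 andbT /= subsetD1.
case: (boolP (x \in s)) => xs; last by rewrite setU1K // eqxx.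
rewrite andbF; apply/negP => /andP[_ /eqP e].
by rewrite -e !inE eqxx in xs.
Qed.

Section Bracket.
Variables (c : int) (ev : web -> int).
Hypothesis ev_functional : web_functional c ev.
Hypothesis c_sign : (c = 1 \/ c = -1)%R.
Local Notation B := (bracket_value c ev).

(** The bracket as a sum over the subsets of the set [A] of classical crossings, with
    one and the same permutation for all states. *)
Definition perm_bracket (C : finType) (o : C -> bool) (n : {perm C * bool}) (A : {set C}) : int :=
  (\sum_(s : {set C} | s \subset A) (- (3%:R * c)) ^+ #|s| *
      value ev (lift_perm o (n * swap_perm A)) (Some @: s))%R.

Lemma bracket_perm (D : diagram) (o : cr D -> bool) :
  (3%:R ^+ (3 + #|cr D|) * B D
   = 3%:R ^+ loops D * perm_bracket o (next D) (classical_set D))%R.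
Proof.
rewrite /bracket_value /perm_bracket !big_distrr /=; apply: eq_bigr => s scl.
have -> : #|cr D| = (#|s| + #|~: s|)%N by rewrite cardsC.
rewrite [RHS]mulrCA -(value_state ev_functional o scl) addnCA exprD.
by rewrite -mulrN exprMn; ring.
Qed.

Lemma perm_bracket_eq (D : diagram) (k : cr D -> crossing_kind) (n : {perm cr D * bool})
    (A : {set cr D}) (o : cr D -> bool) :
  (forall x, (x \in A) = if k x is Classical _ then true else false) ->
  perm_bracket o (next D) (classical_set D) = perm_bracket o n A ->
  B D = B (@Diagram (cr D) k n (loops D)).
Proof.
move=> kA e; apply: (@pow3_inj (3 + #|cr D|)); rewrite (bracket_perm o) e.
have -> : A = classical_set (@Diagram (cr D) k n (loops D)).
  by apply/setP => x; rewrite inE kA.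
by rewrite (@bracket_perm (@Diagram (cr D) k n (loops D)) o).
Qed.

Lemma swap_perm1 (C : finType) (x : C) b :
  swap_perm [set x] = tperm (x, b) (x, ~~ b).
Proof.
apply/permP => -[y d]; rewrite swap_permE inE permE /= !xpair_eqE.
by case: eqP => [->|]; case: b d => -[].
Qed.

Lemma pass_inner (C : finType) (o : C -> bool) v : (v, i2) \notin codom (pass o).
Proof. by apply/negP => /codomP[p []] _; case: ifP. Qed.

Lemma pass_None (C : finType) (o : C -> bool) i : (None, i) \notin codom (pass o).
Proof. by apply/negP => /codomP[]. Qed.

(** The smoothed kink is a circle next to a strand, the cut one a bigon:
    3 - 2 * (c * c) = 1. *)
Lemma perm_bracket_kink (C : finType) (o : C -> bool) (n : {perm C * bool}) (A : {set C}) x :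
  x \in A -> n (x, o x) = (x, ~~ o x) -> perm_bracket o n A = perm_bracket o n (A :\ x).
Proof.
move=> xA nx; set i := o x in nx *.
pose G := lift_perm o (n * swap_perm (A :\ x)).
have GE : lift_perm o (n * swap_perm A) = (G * tperm (pass o (x, i)) (G (pass o (x, i))))%g.
  have -> : G (pass o (x, i)) = pass o (x, ~~ i).
    by rewrite lift_pass permM nx swap_permE !inE /= eqxx.
  have dj : [disjoint A :\ x & [set x]] by rewrite disjoint_sym disjoints1 !inE eqxx.
  have -> : swap_perm A = (swap_perm (A :\ x) * tperm (x, i) (x, ~~ i))%g.
    by rewrite -swap_perm1 -swap_permU // setUC setD1K.
  by rewrite mulgA lift_permM lift_tperm.
apply: (etrans (sum_subsets1 _ xA)); apply: eq_bigr => s /subsetP sA.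
have xs : x \notin s by apply/negP => /sA; rewrite !inE eqxx.
set G' := lift_perm o (n * swap_perm A).
have G'x : G' (pass o (x, i)) = pass o (x, i).
  by rewrite lift_pass permM nx swap_permE /= xA negbK.
have imU : Some @: (x |: s) = Some x |: Some @: s by rewrite imsetU1.
have bg : (9%:R * value ev G' (Some @: (x |: s)) = 2%:R * c * value ev G' (Some @: s))%R.
  have -> : Some @: s = (Some @: (x |: s)) :\ Some x.
    by rewrite imU setU1K // mem_imset //; apply: Some_inj.
  apply: (value_bigon ev_functional (p := pass o (x, i)) (q := (Some x, i2)) (r := pass o (x, ~~ i))) => //.
  - by rewrite imU setU11.
  - by rewrite /= !inE /pass /= /i !xpair_eqE !eqxx; case: (o x).
  - exact/lift_out/pass_inner.
rewrite cardsU1 xs add1n exprS -/G.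
have fr : value ev G' (Some @: s) = (3%:R * value ev G (Some @: s))%R.
  rewrite /G' GE; apply: (value_loosen ev_functional).
    by rewrite lift_pass permM nx swap_permE !inE /= eqxx (inj_eq (@pass_inj _ o)) xpair_eqE eqxx /= /i; case: (o x).
  by rewrite /over /= mem_imset //; apply: Some_inj.
apply: (@pow3_inj 2).
transitivity ((- (3%:R * c)) ^+ #|s| * (9%:R * value ev G' (Some @: s) - 3%:R * c * (9%:R * value ev G' (Some @: (x |: s)))))%R.
  by ring.
rewrite bg fr; case: c_sign => ->; ring.
Qed.

Lemma pass0 (C : finType) (o : C -> bool) x : pass o (x, o x) = (Some x, i0).
Proof. by rewrite /pass eqxx. Qed.

Lemma pass1 (C : finType) (o : C -> bool) x : pass o (x, ~~ o x) = (Some x, i1).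
Proof. by rewrite /pass; case: (o x). Qed.

(** Smoothing one more crossing exchanges its two passages upon arrival. *)
Lemma swap_permD1 (C : finType) (o : C -> bool) (A : {set C}) x : x \in A ->
  swap_perm A = (swap_perm (A :\ x) * tperm (x, o x) (x, ~~ o x))%g.
Proof.
move=> xA; have dj : [disjoint A :\ x & [set x]] by rewrite disjoint_sym disjoints1 !inE eqxx.
by rewrite -swap_perm1 -swap_permU // setUC setD1K.
Qed.

Section LocalNodes.
Variables (C : finType) (o : C -> bool).
Local Notation nodes L := (None :: map Some L : seq (option C)).

Lemma local_nodes_out (L : seq C) (s : {set C}) : (forall x, x \in L -> x \notin s) ->
  forall v, v \in nodes L -> v \notin Some @: s.
Proof.
move=> Ls v; rewrite inE => /orP[/eqP->|/mapP[x /Ls xs ->]].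
  by apply/negP => /imsetP[].
by rewrite mem_imset //; apply: Some_inj.
Qed.

Lemma cut_local (L l : seq C) (s : {set C}) t :
  [seq nth None (nodes L) a | a <- t] = map Some l ->
  cut None (nodes L) (Some @: s) t = Some @: foldr (fun x r => x |: r) s l.
Proof.
move=> tl; apply/setP => v; rewrite inE tl.
have foldE x : (x \in foldr (fun x r => x |: r) s l) = (x \in s) || (x \in l).
  by elim: l {tl} => [|y l IHl] /=; rewrite ?orbF // !inE IHl orbCA.
apply/orP/imsetP => [[/imsetP[x xs ->]|/mapP[x xl ->]]|[x]].
- by exists x; rewrite ?foldE ?xs.
- by exists x; rewrite ?foldE ?xl ?orbT.
- rewrite foldE => /orP[xs|xl] ->; [left|right].
    by apply/imsetP; exists x.
  by apply/mapP; exists x.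
Qed.

Lemma point_fixed (L : seq C) (n : {perm C * bool}) k :
  (k < 3) || (k %% 3 == 2) -> lift_perm o n (point None (nodes L) k) = point None (nodes L) k.
Proof.
case/orP => [k3|/eqP k2]; apply: lift_out.
  by rewrite /point divn_small //; apply: pass_None.
by rewrite /point k2; case: (nth _ _ _) => [x|]; [apply: pass_inner|apply: pass_None].
Qed.

End LocalNodes.

(** For both relative orientations of the two strands, two crossings that differ only
    by their signs cancel. *)
Lemma perm_bracket_pair (C : finType) (o : C -> bool) (n : {perm C * bool}) (A : {set C}) x y :
  x != y -> x \in A -> y \in A -> n (x, o x) = (y, o y) ->
  n (x, ~~ o x) = (y, ~~ o y) \/ n (y, ~~ o y) = (x, ~~ o x) ->
  perm_bracket o n A = perm_bracket o n (A :\: [set x; y]).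
Proof.
move=> xy xA yA nx nxy; pose nodes : seq (option C) := [:: None; Some x; Some y].
have xA' : x \in A :\ y by rewrite !inE xy.
have -> : A :\: [set x; y] = A :\ y :\ x by rewrite setDDl setUC.
apply: (etrans (sum_subsets1 _ yA)); apply: (etrans (sum_subsets1 _ xA')).
apply: eq_bigr => s /subsetP sA.
have [xs ys] : x \notin s /\ y \notin s.
  by split; apply/negP => /sA; rewrite !inE eqxx ?andbF.
pose G := lift_perm o (n * swap_perm (A :\ y :\ x)).
have -> : lift_perm o (n * swap_perm A) = (G * list_perm None nodes [:: (3, 4); (6, 7)])%g.
  rewrite (swap_permD1 o yA) (swap_permD1 o xA') !mulgA !lift_permM !lift_tperm !pass0 !pass1.
  by rewrite /G lift_permM /= mulg1 -!mulgA.
have un : uniq nodes by rewrite /= !inE xy.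
have nS : forall v, v \in nodes -> v \notin Some @: s.
  by apply: (@local_nodes_out C [:: x; y]) => v; rewrite !inE => /orP[]/eqP->.
have Gf k : k \in [:: 0; 1; 2; 5; 8] -> G (point None nodes k) = point None nodes k.
  move=> kL; apply: (@point_fixed C o [:: x; y]).
  by move: k kL; apply/allP.
have G3 : G (point None nodes 3) = point None nodes 6.
  by rewrite -[point _ _ 3]/(Some x, i0) -(pass0 o) lift_pass permM nx swap_permE !inE eqxx andbF pass0.
have cut_ := @cut_local C [:: x; y] _ s.
have move2 : (value ev (G * list_perm None nodes [:: (3, 4); (6, 7)])%g (Some @: s)
    - 3%:R * c * value ev (G * list_perm None nodes [:: (3, 4); (6, 7)])%g (Some @: (x |: s))
    - 3%:R * c * value ev (G * list_perm None nodes [:: (3, 4); (6, 7)])%g (Some @: (y |: s))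
    + 9%:R * value ev (G * list_perm None nodes [:: (3, 4); (6, 7)])%g (Some @: (y |: (x |: s)))
    = value ev G (Some @: s))%R.
  rewrite (setUCA [set y]) -[in LHS](cut_ [:: x; y] [:: 1; 2] erefl).
  rewrite -(cut_ [:: x] [:: 1] erefl) -(cut_ [:: y] [:: 2] erefl).
  have c0 : Some @: s = cut None nodes (Some @: s) [::] := esym (cut_ [::] [::] erefl).
  rewrite [X in (value _ _ X - _)%R]c0 [X in _ = value _ _ X]c0.
  case: nxy => nxy.
    apply: (parallel_move ev_functional c_sign un nS erefl Gf G3).
    by rewrite -[point _ _ 4]/(Some x, i1) -(pass1 o) lift_pass permM nxy swap_permE !inE eqxx andbF pass1.
  apply: (antiparallel_move ev_functional c_sign un nS erefl Gf G3).
  by rewrite -[point _ _ 7]/(Some y, i1) -(pass1 o) lift_pass permM nxy swap_permE !inE eqxx pass1.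
have yxs : y \notin x |: s by rewrite !inE eq_sym negb_or xy.
rewrite -/G -move2 !cardsU1 xs ys yxs /= !exprD.
have cc : (c * c = 1)%R by case: c_sign => ->.
set H := (G * _)%g.
move: (value ev H (Some @: s)) (value ev H (Some @: (x |: s))) (value ev H (Some @: (y |: s)))
  (value ev H (Some @: (y |: (x |: s)))) => v0 v1 v2 v3.
transitivity ((- (3%:R * c)) ^+ #|s| * (v0 - 3%:R * c * v1 - 3%:R * c * v2 + 9%:R * (c * c) * v3))%R.
  by ring.
by rewrite cc; ring.
Qed.

Section Triangle.
Variables (C : finType) (o : C -> bool) (A : {set C}) (x y z : C).
Hypotheses (xyz : uniq [:: x; y; z]) (xA : x \in A) (yA : y \in A) (zA : z \in A).

Let nodes : seq (option C) := [:: None; Some x; Some y; Some z].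
Let A' := A :\ z :\ y :\ x.
Let xyzE : [/\ x != y, x != z & y != z].
Proof. by move: xyz; rewrite /= !inE negb_or andbT -andbA => /and3P. Qed.

Let A'E v : (v \in A') = [&& v != x, v != y, v != z & v \in A].
Proof. by rewrite !inE. Qed.

Let smoothed (m : {perm C * bool}) (s : {set C}) (t : seq nat) : int :=
  value ev (lift_perm o (m * swap_perm A') * list_perm None nodes crossing_swaps)%g
    (cut None nodes (Some @: s) t).

Lemma perm_bracket_triangle_sum (m : {perm C * bool}) :
  perm_bracket o m A = (\sum_(s : {set C} | s \subset A')
    (- (3%:R * c)) ^+ #|s| * triangle_sum c (smoothed m s))%R.
Proof.
have [xy xz yz] := xyzE.
have yA' : y \in A :\ z by rewrite !inE yz.
have xA' : x \in A :\ z :\ y by rewrite !inE xy xz.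
apply: (etrans (sum_subsets1 _ zA)); apply: (etrans (sum_subsets1 _ yA')).
apply: (etrans (sum_subsets1 _ xA')); apply: eq_bigr => s /subsetP sA.
have [xs ys zs] : [/\ x \notin s, y \notin s & z \notin s].
  by split; apply/negP => /sA; rewrite !inE eqxx ?andbF.
have -> : lift_perm o (m * swap_perm A)
    = (lift_perm o (m * swap_perm A') * list_perm None nodes crossing_swaps)%g.
  rewrite (swap_permD1 o zA) (swap_permD1 o yA') (swap_permD1 o xA') !mulgA !lift_permM !lift_tperm !pass0 !pass1.
  by rewrite /= mulg1 -!mulgA.
have cut_ := @cut_local C [:: x; y; z] _ s.
rewrite /triangle_sum /smoothed.
rewrite (cut_ [::] [::] erefl) (cut_ [:: x] [:: 1] erefl) (cut_ [:: y] [:: 2] erefl).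
rewrite (cut_ [:: z] [:: 3] erefl) (cut_ [:: x; y] [:: 1; 2] erefl).
rewrite (cut_ [:: x; z] [:: 1; 3] erefl) (cut_ [:: y; z] [:: 2; 3] erefl).
rewrite (cut_ [:: x; y; z] [:: 1; 2; 3] erefl) /=.
have -> : z |: (y |: (x |: s)) = x |: (y |: (z |: s)).
  by rewrite (setUCA [set z]) (setUCA [set z]) (setUCA [set y]).
rewrite (setUCA [set z] [set y]) (setUCA [set z] [set x]) (setUCA [set y] [set x]).
have yzs : y \notin z |: s by rewrite !inE negb_or yz.
have xzs : x \notin z |: s by rewrite !inE negb_or xz.
have xys : x \notin y |: s by rewrite !inE negb_or xy.
have xyzs : x \notin y |: (z |: s) by rewrite !inE !negb_or xy xz.
rewrite !cardsU1 xs ys zs yzs xzs xys xyzs /= !exprD !expr1.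
have cc : (c * c = 1)%R by case: c_sign => ->.
set H := (_ * _)%g.
move: (value ev H (Some @: s)) (value ev H (Some @: (x |: s))) (value ev H (Some @: (y |: s)))
  (value ev H (Some @: (z |: s))) (value ev H (Some @: (x |: (y |: s))))
  (value ev H (Some @: (x |: (z |: s)))) (value ev H (Some @: (y |: (z |: s))))
  (value ev H (Some @: (x |: (y |: (z |: s))))) => v0 v1 v2 v3 v12 v13 v23 v123.
transitivity ((- (3%:R * c)) ^+ #|s| * (v0 - 3%:R * c * (v1 + v2 + v3)
  + 9%:R * (c * c) * (v12 + v13 + v23) - 27%:R * (c * c) * c * v123))%R.
  by ring.
by rewrite cc; ring.
Qed.

(** The points of the crossings and the exterior are the same on both sides of the third
    move; conjugation with [s] exchanges the two crossings on each strand. *)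
Lemma perm_bracket_triangle (n : {perm C * bool}) :
  let s := (tperm (x, o x) (y, o y) * tperm (x, ~~ o x) (z, o z)
            * tperm (y, ~~ o y) (z, ~~ o z))%g in
  n (x, o x) = (y, o y) -> n (y, ~~ o y) = (z, ~~ o z) ->
  n (x, ~~ o x) = (z, o z) \/ n (z, o z) = (x, ~~ o x) ->
  perm_bracket o n A = perm_bracket o (n ^ s)%g A.
Proof.
move=> s nx ny nxz; have [xy xz yz] := xyzE.
refine (etrans (perm_bracket_triangle_sum n)
  (etrans _ (esym (perm_bracket_triangle_sum (n ^ s)%g)))).
apply: eq_bigr => s0 /subsetP sA; apply: (congr1 (fun u => (- (3%:R * c)) ^+ #|s0| * u)%R).
have un : uniq nodes by rewrite /= !inE !negb_or /= xy xz yz.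
have nS : forall v, v \in nodes -> v \notin Some @: s0.
  apply: (@local_nodes_out C [:: x; y; z]) => v vL; apply/negP => /sA.
  by rewrite A'E; move: vL; rewrite !inE => /or3P[]/eqP->; rewrite eqxx ?andbF.
pose G := lift_perm o (n * swap_perm A').
have Gf k : k \in [:: 0; 1; 2; 5; 8; 11] -> G (point None nodes k) = point None nodes k.
  move=> kL; apply: (@point_fixed C o [:: x; y; z]).
  by move: k kL; apply/allP.
have sw : (swap_perm A' ^ s = swap_perm A')%g.
  have commt u v : u.1 \notin A' -> v.1 \notin A' -> (swap_perm A' ^ tperm u v = swap_perm A')%g.
    move=> uA vA; apply/permP => p; rewrite -(permKV (tperm u v) p) permJ.
    move: ((tperm u v)^-1%g p) => q.
    have tA w : (tperm u v w).1 \in A' = (w.1 \in A').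
      by case: tpermP => [->|->|//]; rewrite (negPf uA) (negPf vA).
    rewrite !swap_permE tA; case: ifP => // qA.
    have fx w : w.1 \in A' -> tperm u v w = w.
      by move=> wA; apply: tpermD; [apply: contraNneq uA | apply: contraNneq vA] => ->.
    by rewrite !fx.
  by rewrite /s !conjgM !commt // A'E /= !eqxx ?andbF.
have GE : lift_perm o (n ^ s * swap_perm A') =
    (G ^ list_perm None nodes [:: (3, 6); (4, 9); (7, 10)])%g.
  rewrite -{1}sw -conjMg lift_permJ; congr (_ ^ _)%g.
  by rewrite /s !lift_permM !lift_tperm !pass0 !pass1 /= mulg1 mulgA.
have G3 : G (point None nodes 3) = point None nodes 6.
  by rewrite -[point _ _ 3]/(Some x, i0) -(pass0 o) lift_pass permM nx swap_permE A'E /= eqxx andbF pass0.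
have G7 : G (point None nodes 7) = point None nodes 10.
  by rewrite -[point _ _ 7]/(Some y, i1) -(pass1 o) lift_pass permM ny swap_permE A'E /= eqxx !andbF pass1.
rewrite /smoothed GE.
case: nxz => nxz.
  apply: (acyclic_triangle ev_functional c_sign un nS erefl Gf G3 _ G7).
  by rewrite -[point _ _ 4]/(Some x, i1) -(pass1 o) lift_pass permM nxz swap_permE A'E /= eqxx !andbF pass0.
apply: (cyclic_triangle ev_functional c_sign un nS erefl Gf G3 G7).
by rewrite -[point _ _ 9]/(Some z, i0) -(pass0 o) lift_pass permM nxz swap_permE A'E /= eqxx pass1.
Qed.

End Triangle.

End Bracket.

(** * Invariance under the moves of loosen links *)

Section Invariance.
Variables (c : int) (ev : web -> int).
Hypothesis ev_functional : web_functional c ev.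
Hypothesis c_sign : (c = 1 \/ c = -1)%R.
Local Notation B := (bracket_value c ev).

Lemma bracket_reidemeister1 (D E : diagram) : reidemeister1 D E -> B D = B E.
Proof.
move=> [x [i [xcl nx er]]]; rewrite -(bracket_make_virtual ev_functional er).
apply: (@perm_bracket_eq c ev ev_functional D _ (next D) (classical_set D :\ x) (fun _ => i)).
  by move=> y; rewrite !inE; case: eqP.
by apply: (perm_bracket_kink ev_functional c_sign) => //; rewrite inE.
Qed.

Lemma bracket_reidemeister2 (D E : diagram) : reidemeister2 D E -> B D = B E.
Proof.
move=> [x [y [i [b [[kx ky] nx nxy er]]]]]; rewrite -(bracket_make_virtual ev_functional er).
have xy : x != y by apply/eqP => e; move: ky; rewrite -e kx => -[]; case: (b).
pose o z := if z == x then i else ~~ i.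
have [ox oy] : o x = i /\ o y = ~~ i by rewrite /o eqxx eq_sym (negPf xy).
apply: (@perm_bracket_eq c ev ev_functional D _ (next D) (classical_set D :\: [set x; y]) o).
  by move=> z; rewrite !inE; case: (_ || _).
apply: (perm_bracket_pair ev_functional c_sign xy); rewrite ?inE /is_classical ?kx ?ky ?ox ?oy ?negbK //.
Qed.

Lemma bracket_triangle (D : diagram) (u v w : cr D) (a b d : bool) :
  uniq [:: u; v; w] -> is_classical u -> is_classical v -> is_classical w ->
  next D (u, a) = (v, b) -> next D (v, ~~ b) = (w, ~~ d) ->
  next D (u, ~~ a) = (w, d) \/ next D (w, d) = (u, ~~ a) ->
  B D = B (reorder (tperm (u, a) (v, b) * tperm (u, ~~ a) (w, d) * tperm (v, ~~ b) (w, ~~ d))%g).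
Proof.
move=> uvw ucl vcl wcl nu nv nw; pose o z := if z == u then a else if z == v then b else d.
have [uv uw vw] : [/\ u != v, u != w & v != w].
  by move: uvw; rewrite /= !inE negb_or andbT -andbA => /and3P.
have ou : o u = a by rewrite /o eqxx.
have ov : o v = b by rewrite /o eq_sym (negPf uv) eqxx.
have ow : o w = d by rewrite /o eq_sym (negPf uw) eq_sym (negPf vw).
apply: (@perm_bracket_eq c ev ev_functional D _ _ (classical_set D) o).
  by move=> z; rewrite inE.
have clE t : is_classical t -> t \in classical_set D by rewrite inE.
have := @perm_bracket_triangle c ev ev_functional c_sign (cr D) o (classical_set D) u v w uvw
  (clE _ ucl) (clE _ vcl) (clE _ wcl) (next D).
by clearbody o; rewrite ou ov ow => tri; apply: (tri nu nv nw).
Qed.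

(** On each of the three strands either crossing may come first.  Of the eight cases six
    order the crossings linearly, and the other two cyclically; in each of them the
    crossings and their passages are named so that [bracket_triangle] applies. *)
Lemma bracket_reidemeister3 (D E : diagram) : reidemeister3 D E -> B D = B E.
Proof.
move=> [x [y [z [i [j [k [s [xyz [kx ky kz] [p1 p2 p3] iso]]]]]]]].
rewrite -(bracket_iso ev_functional iso) => {iso}.
have xcl : is_classical x by rewrite /is_classical kx.
have ycl : is_classical y by rewrite /is_classical ky.
have zcl : is_classical z by rewrite /is_classical kz.
have [xy xz yz] : [/\ x != y, x != z & y != z].
  by move: xyz; rewrite /= !inE negb_or andbT -andbA => /and3P.
have yx : y != x by rewrite eq_sym.
have zx : z != x by rewrite eq_sym.
have zy : z != y by rewrite eq_sym.
have tC (p q p' q' : cr D * bool) : p != p' -> p != q' -> q != p' -> q != q' ->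
    (tperm p q * tperm p' q' = tperm p' q' * tperm p q)%g.
  by move=> pp' pq' qp' qq'; rewrite conjgC tpermJ !tpermD // eq_sym.
set t1 := tperm (x, i) (y, j); set t2 := tperm (x, ~~ i) (z, k).
set t3 := tperm (y, ~~ j) (z, ~~ k).
have c12 : (t1 * t2 = t2 * t1)%g.
  by apply: tC; rewrite xpair_eqE ?(negPf xy) ?(negPf xz) ?(negPf yx) ?(negPf yz) //; case: (i); rewrite ?andbF.
have c13 : (t1 * t3 = t3 * t1)%g.
  by apply: tC; rewrite xpair_eqE ?(negPf xy) ?(negPf xz) ?(negPf yx) ?(negPf yz) //; case: (j); rewrite ?andbF.
have c23 : (t2 * t3 = t3 * t2)%g.
  by apply: tC; rewrite xpair_eqE ?(negPf xy) ?(negPf xz) ?(negPf zx) ?(negPf zy) //; case: (k); rewrite ?andbF.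
have o231 : (t1 * t2 * t3 = t2 * t3 * t1)%g by rewrite c12 -mulgA c13 mulgA.
have o132 : (t1 * t2 * t3 = t1 * t3 * t2)%g by rewrite -mulgA c23 mulgA.
have o312 : (t1 * t2 * t3 = t3 * t1 * t2)%g by rewrite o132 c13.
have o321 : (t1 * t2 * t3 = t3 * t2 * t1)%g by rewrite o312 -mulgA c12 mulgA.
have un : [/\ uniq [:: x; z; y], uniq [:: z; x; y], uniq [:: y; x; z], uniq [:: y; z; x]
    & uniq [:: z; y; x]] by rewrite /= !inE !negb_or xy xz yx yz zx zy.
have [xzy zxy yxz yzx zyx] := un.
have tri := @bracket_triangle D.
move: p1 p2 p3; case: (s (+) i (+) j); case: (s (+) i (+) k); case: (s (+) j (+) k);
  rewrite /precedes => p1 p2 p3.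
- by apply: (tri x y z i j k) => //; left.
- have := tri x z y (~~ i) k j xzy xcl zcl ycl; rewrite !negbK.
  rewrite -/t1 -/t2 (tpermC (z, ~~ k)) -/t3 c12; apply=> //; by left.
- by apply: (tri x y z i j k) => //; right.
- have := tri z x y k (~~ i) (~~ j) zxy zcl xcl ycl; rewrite !negbK.
  rewrite (tpermC (z, k)) (tpermC (z, ~~ k)) -/t1 -/t2 -/t3.
  rewrite o231; apply=> //; by left.
- have := tri y x z j i (~~ k) yxz ycl xcl zcl; rewrite !negbK.
  rewrite (tpermC (y, j)) -/t1 -/t2 -/t3 o132; apply=> //; by left.
- have := tri x z y (~~ i) k j xzy xcl zcl ycl; rewrite !negbK.
  rewrite -/t1 -/t2 (tpermC (z, ~~ k)) -/t3 c12; apply=> //; by right.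
- have := tri y z x (~~ j) (~~ k) i yzx ycl zcl xcl; rewrite !negbK.
  rewrite (tpermC (y, j)) (tpermC (z, k)) -/t1 -/t2 -/t3.
  rewrite o312; apply=> //; by left.
- have := tri z y x (~~ k) (~~ j) (~~ i) zyx zcl ycl xcl; rewrite !negbK.
  rewrite (tpermC (z, ~~ k)) (tpermC (z, k)) (tpermC (y, j)) -/t1 -/t2 -/t3.
  rewrite o321; apply=> //; by left.
Qed.

Lemma bracket_free_link (D E : vdiagram) : same_free_link D E -> B D = B E.
Proof.
elim=> [{}D {}E [[iso|r1|r2|r3|dt]|vz|sw]|//|{}D {}E _ ->|{}D F {}E _ -> _ ->] //.
- exact: bracket_iso.
- exact: bracket_reidemeister1.
- exact: bracket_reidemeister2.
- exact: bracket_reidemeister3.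
- exact: bracket_detour.
- exact: bracket_virtualization.
- exact: bracket_switch.
Qed.

End Invariance.

Lemma mcoeff_sum_map (K : choiceType) (G H : zmodType) (x : {malg G[K]}) m (phi : G -> H) :
  phi 0%R = 0%R ->
  mcoeff m (\sum_(k <- msupp x) << phi (mcoeff k x) *g k >>)%R = phi (mcoeff m x).
Proof.
move=> phi0; rewrite raddf_sum /=; have [ms|nms] := boolP (m \in msupp x).
  rewrite (bigD1_seq m ms (fset_uniq _)) /= mcoeffUU big1 ?addr0 // => m' m'm.
  by rewrite mcoeffU (negPf m'm).
rewrite (mcoeff_outdom nms) phi0 big_seq big1 // => m' m's.
by rewrite mcoeffU; case: eqP => // e; rewrite -e m's in nms.
Qed.

Section Specialization.
Variable c : int.
Hypothesis c_sign : (c = 1 \/ c = -1)%R.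

Let c_unit : c \is a GRing.unit.
Proof. by case: c_sign => ->. Qed.

Let X_neq0 n : (tofrac ('X : {poly int}) ^+ n != 0)%R.
Proof. by rewrite expf_neq0 ?tofracX_neq0. Qed.

Lemma laurent_atD x y : laurent_at c (x + y)%R = (laurent_at c x + laurent_at c y)%R.
Proof.
have [[p n] /= xE] := laurent_fracP x; have [[q m] /= yE] := laurent_fracP y.
rewrite (laurent_at_frac c_unit xE) (laurent_at_frac c_unit yE).
rewrite (@laurent_at_frac _ _ (p * 'X^m + q * 'X^n)%R (n + m)) //; last first.
  have -> : (laurent_val (x + y) = laurent_val x + laurent_val y)%R := rmorphD val x y.
  rewrite xE yE addf_div ?X_neq0 // exprD.
  by rewrite rmorphD !rmorphM !rmorphXn.
rewrite hornerD !hornerM !hornerXn exprD mulrDl; congr (_ + _)%R.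
  by rewrite invrM ?unitrX // mulrA mulrK ?unitrX.
rewrite invrM ?unitrX // -mulrA; congr (_ * _)%R.
by rewrite mulrCA mulrV ?unitrX // mulr1.
Qed.

Lemma laurent_atM x y : laurent_at c (x * y)%R = (laurent_at c x * laurent_at c y)%R.
Proof.
have [[p n] /= xE] := laurent_fracP x; have [[q m] /= yE] := laurent_fracP y.
rewrite (laurent_at_frac c_unit xE) (laurent_at_frac c_unit yE).
rewrite (@laurent_at_frac _ _ (p * q)%R (n + m)) //; last first.
  have -> : (laurent_val (x * y) = laurent_val x * laurent_val y)%R := rmorphM val x y.
  by rewrite xE yE mulf_div exprD rmorphM.
by rewrite hornerM exprD invrM ?unitrX //; ring.
Qed.

Lemma laurent_at1 : laurent_at c 1%R = 1%R.
Proof.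
by rewrite (@laurent_at_frac _ _ 1%R 0) // ?hornerC ?expr0 ?divr1 // rmorph1.
Qed.

Lemma laurent_at0 : laurent_at c 0%R = 0%R.
Proof. by apply: (@addrI _ (laurent_at c 0%R)); rewrite -laurent_atD !addr0. Qed.

Lemma laurent_atN x : laurent_at c (- x)%R = (- laurent_at c x)%R.
Proof. by apply: (@addrI _ (laurent_at c x)); rewrite -laurent_atD !subrr laurent_at0. Qed.

Lemma laurent_at_sum (I : Type) (r : seq I) (P : pred I) F :
  (laurent_at c (\sum_(i <- r | P i) F i) = \sum_(i <- r | P i) laurent_at c (F i))%R.
Proof. by apply: (big_morph (laurent_at c) laurent_atD laurent_at0). Qed.

Lemma laurent_at_prod (I : Type) (r : seq I) (P : pred I) F :
  (laurent_at c (\prod_(i <- r | P i) F i) = \prod_(i <- r | P i) laurent_at c (F i))%R.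
Proof. by apply: (big_morph (laurent_at c) laurent_atM laurent_at1). Qed.

Lemma laurent_at_weight (D : diagram) (s : {set cr D}) : s \subset classical_set D ->
  laurent_at c (state_weight s) = ((- c) ^+ #|s|)%R.
Proof.
move=> /subsetP scl; rewrite /state_weight laurent_at_prod (bigID (mem s)) /=.
rewrite [X in (_ * X)%R]big1 ?mulr1; last first.
  move=> x /andP[_ /negPf->]; rewrite laurent_at_Apow // /crossing_sign.
  by case: (kind x) => [[]|]; case: c_sign => ->.
rewrite -prodr_const; apply: eq_big => [x|x /andP[_ xs]].
  by rewrite andb_idl // => /scl; rewrite inE.
rewrite xs laurent_atN laurent_at_Apow // /crossing_sign.
by case: (kind x) => [[]|]; case: c_sign => ->.
Qed.

Lemma mcoeff_specialize x m : mcoeff m (specialize c x) = laurent_at c (mcoeff m x).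
Proof. exact: (mcoeff_sum_map x m laurent_at0). Qed.

Variables (f : web -> ring_M) (hf : web_evaluation f).

(** At A = c the coefficients A^6 + 1 + A^-6 and A^3 + A^-3 become 3 and 2 c. *)
Lemma web_functional_coefficient m : web_functional c (fun G => laurent_at c (mcoeff m (f G))).
Proof.
split=> [G H iso|G|G H bg|G G1 G2 qd].
- by rewrite (eval_iso hf iso).
- rewrite (eval_union hf) (eval_circle hf) -scalerAr mulr1 mcoeffZ laurent_atM.
  congr (_ * _)%R; rewrite !laurent_atD laurent_at1 !laurent_at_Apow //.
  by case: c_sign => ->.
- rewrite (eval_bigon hf bg) mcoeffZ laurent_atM laurent_atD !laurent_at_Apow //.
  by congr (_ * _)%R; case: c_sign => ->.
- by rewrite (eval_quadrilateral hf qd) mcoeffD laurent_atD.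
Qed.

Lemma specialize_bracket (D E : vdiagram) : same_free_link D E ->
  specialize c (bracket f D) = specialize c (bracket f E).
Proof.
move=> DE; apply/malgP => m.
refine (etrans (mcoeff_specialize _ _) (etrans _ (esym (mcoeff_specialize _ _)))).
have coefE F : laurent_at c (mcoeff m (bracket f F))
    = bracket_value c (fun G => laurent_at c (mcoeff m (f G))) F.
  rewrite /bracket raddf_sum /= laurent_at_sum; apply: eq_bigr => s scl.
  by rewrite mcoeffZ laurent_atM laurent_at_weight.
refine (etrans (coefE D) (etrans _ (esym (coefE E)))).
exact: (bracket_free_link (web_functional_coefficient m) c_sign).
Qed.

End Specialization.

Local Open Scope ring_scope.

Theorem corollary3p3 (f : web -> ring_M) (hf : web_evaluation f)
    (D E : vdiagram) (hDE : same_free_link D E) :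
  specialize 1 (bracket f D) = specialize 1 (bracket f E) /\
  specialize (-1) (bracket f D) = specialize (-1) (bracket f E).
Proof.
by split; apply: specialize_bracket => //; [left|right].
Qed.
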